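(* Let $\mathfrak P=(P_n)_{n\ge0}$ be a subfactor planar algebra and $k\ge 0$. Let $X$ be the linear endomorphism of $\bigoplus_{n\ge 0}P_{n+k}$ given by the sum of all epi Temperley-Lieb diagrams, and let $\bullet$ and $\star$ be the two products on $\bigoplus_{n\ge 0}P_{n+k}$ defined in the context. Then $X(a\bullet b)=X(a)\star X(b)$ for all $a,b\in\bigoplus_{n\ge 0}P_{n+k}$.
   Context: $\mathfrak P=(P_n)_{n\ge 0}$ is a subfactor planar algebra; elements of $P_n$ label discs with $2n$ boundary points. Write $P_{n,k}=P_{n+k}$ for the $n$-th summand of $\bigoplus_{n\ge 0}P_{n+k}$ (algebraic direct sum); an element of $P_{n,k}$ is drawn as a box with $k$ strings on the left, $k$ on the right, $2n$ strings on top, none at the bottom, with distinguished interval at the top left corner. Products. For $a\in P_{m,k}$, $b\in P_{n,k}$ and $0\le i\le\min(2m,2n)$ let $(a\star b)_i\in P_{m+n-i,k}$ be obtained by placing $a$ to the left of $b$, joining the $k$ right strings of $a$ to the $k$ left strings of $b$ horizontally, joining the rightmost $i$ top strings of $a$ to the leftmost $i$ top strings of $b$ by $i$ parallel (nested) arcs, and letting all other top strings go to the top. Then $a\star b=\sum_{i=0}^{\min(2m,2n)}(a\star b)_i$, and $a\bullet b=(a\star b)_0\in P_{m+n,k}$ (simple juxtaposition). Both are extended bilinearly. The map $X$. A Temperley-Lieb (TL) diagram is a loopless planar pairing, up to isotopy, of boundary points on the bottom (incoming) and top (outgoing) sides of a rectangle. A TL diagram with $2i$ points on the bottom and $2j$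 points on top is regarded as a linear map $P_{i,k}\to P_{j,k}$, by attaching its bottom points to the $2i$ top strings of an element of $P_{i,k}$. A TL diagram is epi if each point on its top side is connected to a point on its bottom side. The block $P_{i,k}\to P_{j,k}$ of $X$ is the finite sum of all epi TL diagrams from $2i$ points to $2j$ points (the identity if $i=j$, zero if $i<j$). *)

(* Defs.v *)
From HB Require Import structures.
From mathcomp Require Import all_boot all_order all_algebra.
From mathcomp Require Import zify complex.
From mathcomp Require Import boolp classical_sets functions cardinality fsbigop reals.

Set Implicit Arguments.
Unset Strict Implicit.
Unset Printing Implicit Defensive.

Import GRing.Theory.
Local Open Scope nat_scope.

(* (e, n) : a disc with 2n boundary points; e tells whether the region at its
   distinguished boundary interval is shaded. *)
Definition color : Type := bool * nat.

Section Boundary.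
Variables (I : finType) (c : I -> color) (c0 : color).

(* The discs of a tangle: Some i is the i-th input disc, None the output disc. *)
Definition dcol (d : option I) : color := if d is Some i then c i else c0.

(* Going clockwise around every disc, input or output, one meets
     gap 0 (the distinguished one), point 0, gap 1, point 1, ..., point 2n-1,
     gap 2n;
   gaps 0 and 2n are the same boundary interval. *)
Definition endpt : finType := {d : option I & 'I_((dcol d).2.*2)}.
Definition gap : finType := {d : option I & 'I_((dcol d).2.*2).+1}.

Definition mkend d (x : 'I_((dcol d).2.*2)) : endpt := Tagged _ x.
Definition mkgap d (x : 'I_((dcol d).2.*2).+1) : gap := Tagged _ x.

Definition first_gap d : gap := @mkgap d ord0.
Definition last_gap d : gap := @mkgap d ord_max.
Definition before (p : endpt) : gap := mkgap (widen_ord (leqnSn _) (tagged p)).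
Definition after (p : endpt) : gap := mkgap (lift ord0 (tagged p)).

Definition shade (d : option I) (x : nat) : bool := (dcol d).1 (+) odd x.

(* Orient every string so that the shaded region is on its left; [source p]
   says that the string at p starts at p.  The output disc has the strings on
   its inner side, hence the sign. *)
Definition source (p : endpt) : bool :=
  shade (tag p) (tagged p) (+) (tag p == None).

(* The gap next to p lying in the region of shading b. *)
Definition side_gap (p : endpt) (b : bool) : gap :=
  if shade (tag p) (tagged p) == b then before p else after p.

(* A shaded planar tangle up to isotopy, with inputs of colors c and output of
   color c0.  The isotopy class is recorded by the finite sets of strings
   (closed ones included) and of regions, and by their incidences with the
   boundaries of the discs and with each other.  Gluing discs, thickened strings
   and regions (each a sphere with as many holes as it has boundary circles)
   along these incidences yields a closed oriented surface; the last two fields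
   say that it is a sphere.  With coefficients F_2, [tg_connected] is H^0 = F_2,
   and [tg_jordan] is the Jordan curve property: a set of strings that meets
   every disc evenly separates the regions into two sides.  On a surface of
   positive genus the latter fails, since the regions have genus 0. *)
Record tangle : Type := Tangle {
  str : finType;
  reg : finType;
  tend : endpt -> str;
  tgap : gap -> reg;
  tside : str -> bool -> reg;   (* the shaded and unshaded sides of a string *)
  tshade : reg -> bool;
  tg_string : forall s : str, (forall p, tend p <> s) \/
    exists p q, [/\ source p, ~~ source q &
                    forall r, tend r = s <-> r = p \/ r = q];
  tg_wrap : forall d, tgap (first_gap d) = tgap (last_gap d);
  tg_side : forall p b, tgap (side_gap p b) = tside (tend p) b;
  tg_shade_gap : forall g : gap, tshade (tgap g) = shade (tag g) (tagged g);
  tg_shade_side : forall s b, tshade (tside s b) = b;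
  tg_connected : forall h : reg -> bool,
    (forall s, h (tside s true) = h (tside s false)) -> forall r r', h r = h r';
  tg_jordan : forall f : str -> bool,
    (forall d, \big[addb/false]_(x < (dcol d).2.*2) f (tend (mkend x)) = false) ->
    exists h : reg -> bool,
      forall s, f s = h (tside s true) (+) h (tside s false)
}.

End Boundary.

Arguments tside {I c c0} T s b : rename.

(* Tangles without closed strings all of whose regions touch a disc.  Such a
   tangle is given by the involution exchanging the two ends of each string and
   by pairs of gaps that lie in a common region; two gaps are in the same region
   if this follows from these pairs and from following the sides of strings. *)
Section Pairing.
Variables (I : finType) (c : I -> color) (c0 : color).
Local Notation endpt := (endpt c c0).
Local Notation gap := (gap c c0).
Variables (mate : endpt -> endpt) (corners : seq (gap * gap)).

Definition touch (x y : gap) : bool :=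
  [|| (x, y) \in corners,
      [exists d, (x == first_gap c c0 d) && (y == last_gap c c0 d)] |
      [exists p, [exists b, (x == side_gap p b) && (y == side_gap (mate p) b)]]].

Definition adj : rel gap := fun x y => touch x y || touch y x.

Record planar_pairing : Prop := PlanarPairing {
  pp_mateK : involutive mate;
  pp_source : forall p, source (mate p) = ~~ source p;
  pp_corner : forall x y, (x, y) \in corners ->
    shade c c0 (tag x) (tagged x) = shade c c0 (tag y) (tagged y);
  pp_connected : forall h : gap -> bool, {homo h : x y / touch x y >-> x = y} ->
    (forall p, h (before p) = h (after p)) -> forall x y, h x = h y;
  pp_jordan : forall f : endpt -> bool, (forall p, f (mate p) = f p) ->
    (forall d, \big[addb/false]_(x < (dcol c c0 d).2.*2) f (mkend x) = false) ->
    exists2 h : gap -> bool, {homo h : x y / touch x y >-> x = y} &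
      forall p, f p = h (before p) (+) h (after p)
}.

Hypothesis pp : planar_pairing.

Definition pstr : finType := {p : endpt | source p}.
Definition preg : finType := {x : gap | fingraph.root adj x == x}.

Lemma adj_sym : connect_sym adj.
Proof. by apply: sym_connect_sym => x y; rewrite /adj /= orbC. Qed.

Lemma pend_proof p : source (if source p then p else mate p).
Proof. by case: ifPn => // np; rewrite (pp_source pp). Qed.

Definition pend (p : endpt) : pstr :=
  exist (fun p => is_true (source p)) _ (pend_proof p).

Lemma pgap_proof x : fingraph.root adj (fingraph.root adj x) == fingraph.root adj x.
Proof. by rewrite (root_root adj_sym). Qed.

Definition pgap (x : gap) : preg :=
  exist (fun x => is_true (fingraph.root adj x == x)) _ (pgap_proof x).
Definition pside (s : pstr) (b : bool) : preg := pgap (side_gap (val s) b).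
Definition pshade (r : preg) : bool := shade c c0 (tag (val r)) (tagged (val r)).

Lemma pgapE x y : (pgap x == pgap y) = connect adj x y.
Proof. by rewrite -val_eqE /= (root_connect adj_sym). Qed.

Lemma pgap_touch x y : touch x y -> pgap x = pgap y.
Proof. by move=> xy; apply/eqP; rewrite pgapE connect1 // /adj xy. Qed.

Lemma pgap_val r : pgap (val r) = r.
Proof. by apply: val_inj; exact/eqP/(valP r). Qed.

Lemma pconnectP (T : Type) (h : gap -> T) :
  {homo h : x y / touch x y >-> x = y} -> forall x y, connect adj x y -> h x = h y.
Proof.
move=> hh x y /connectP[s]; elim: s x => [|z s IHs] x /=; first by move=> _ ->.
case/andP=> /orP[xz|zx] zs yE; first by rewrite (hh _ _ xz) (IHs z).
by rewrite -(hh _ _ zx) (IHs z).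
Qed.

Lemma shade_side (p : endpt) b :
  shade c c0 (tag (side_gap p b)) (tagged (side_gap p b)) = b.
Proof.
rewrite /side_gap; case: eqP => // /eqP; rewrite /= /shade /bump /=.
by case: (_.1); case: (odd _); case: b.
Qed.

Lemma touch_shade (x y : gap) : touch x y ->
  shade c c0 (tag x) (tagged x) = shade c c0 (tag y) (tagged y).
Proof.
case/or3P=> [/(pp_corner pp) //|/existsP[d /andP[/eqP-> /eqP->]]|].
  by rewrite /shade /= odd_double.
by case/existsP=> p /existsP[b /andP[/eqP-> /eqP->]]; rewrite !shade_side.
Qed.

Lemma pshade_gap x : pshade (pgap x) = shade c c0 (tag x) (tagged x).
Proof.
rewrite /pshade; apply/esym.
apply: (pconnectP (h := fun x : gap => shade c c0 (tag x) (tagged x))).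
  exact: touch_shade.
by rewrite /= connect_root.
Qed.

Lemma pside_end p b : pgap (side_gap p b) = pside (pend p) b.
Proof.
rewrite /pside /=; case: ifPn => // np; apply: pgap_touch; apply/or3P/Or33.
by apply/existsP; exists p; apply/existsP; exists b; rewrite !eqxx.
Qed.

Lemma pstring s : (forall p, pend p <> s) \/
    exists p q, [/\ source p, ~~ source q & forall r, pend r = s <-> r = p \/ r = q].
Proof.
right; case: s => p sp; exists p, (mate p).
rewrite (pp_source pp) sp; split=> // r; split.
  move/(congr1 val) => /=; case: ifP => _; first by left.
  by move=> <-; right; rewrite (pp_mateK pp).
case=> ->; apply: val_inj => /=; first by rewrite sp.
by rewrite (pp_source pp) sp (pp_mateK pp).
Qed.

Lemma side_gapTF p (h : gap -> bool) :
  h (side_gap p true) (+) h (side_gap p false) = h (before p) (+) h (after p).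
Proof. by rewrite /side_gap; case: shade => //=; rewrite addbC. Qed.

Lemma side_gap_eq p (h : gap -> bool) :
  h (side_gap p true) = h (side_gap p false) -> h (before p) = h (after p).
Proof. by rewrite /side_gap; case: shade. Qed.

Lemma pconnected (h : preg -> bool) :
  (forall s, h (pside s true) = h (pside s false)) -> forall r r', h r = h r'.
Proof.
move=> hs r r'; rewrite -(pgap_val r) -(pgap_val r').
apply: (pp_connected pp (h := fun x => h (pgap x))) => [x y /pgap_touch -> //|p].
by apply: (side_gap_eq (h := fun x => h (pgap x))); rewrite !pside_end.
Qed.

Lemma pjordan (f : pstr -> bool) :
  (forall d, \big[addb/false]_(x < (dcol c c0 d).2.*2) f (pend (mkend x)) = false) ->
  exists h : preg -> bool, forall s, f s = h (pside s true) (+) h (pside s false).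
Proof.
move=> fd; have fm p : f (pend (mate p)) = f (pend p).
  congr f; apply: val_inj => /=; rewrite (pp_source pp).
  by case: source => //=; rewrite (pp_mateK pp).
have [h hh hf] := pp_jordan pp fm fd.
have hpg x : h (val (pgap x)) = h x.
  by apply: (pconnectP hh); rewrite adj_sym /= connect_root.
exists (fun r => h (val r)) => s; rewrite !hpg side_gapTF -hf.
by congr f; apply: val_inj => /=; rewrite (valP s).
Qed.

Definition pairing_tangle : tangle c c0 :=
  @Tangle I c c0 pstr preg pend pgap pside pshade pstring
    (fun d => pgap_touch (introT or3P (Or32 _ _ (introT existsP (ex_intro _ d
       (introT andP (conj (eqxx _) (eqxx _)))))))) 
    pside_end pshade_gap (fun s b => etrans (pshade_gap _) (shade_side _ _))
    pconnected pjordan.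

End Pairing.

Definition parity (a : nat -> bool) (x : nat) := \big[addb/false]_(0 <= y < x) a y.

Lemma parity0 a : parity a 0 = false.
Proof. by rewrite /parity big_geq. Qed.

Lemma parityS a x : parity a x.+1 = parity a x (+) a x.
Proof. by rewrite /parity big_nat_recr. Qed.

Lemma parity_shift a b x x' l : (forall y, y < l -> a (x + y) = b (x' + y)) ->
  parity a (x + l) (+) parity a x = parity b (x' + l) (+) parity b x'.
Proof.
elim: l => [|l IHl] ab; first by rewrite !addn0 !addbb.
rewrite !addnS !parityS addbAC IHl; last by move=> y yl; exact/ab/ltnW.
by rewrite ab // addbAC.
Qed.

Lemma parity_rev a b x x' l : l <= x' ->
  (forall y, y < l -> a (x + y) = b (x'.-1 - y)) ->
  parity a (x + l) (+) parity a x = parity b x' (+) parity b (x' - l).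
Proof.
elim: l => [|l IHl] lx ab; first by rewrite addn0 subn0 !addbb.
rewrite addnS parityS addbAC (IHl (ltnW lx)); last by move=> y yl; exact/ab/ltnW.
rewrite ab // -addbA; congr (_ (+) _).
have -> : x' - l = (x' - l.+1).+1 by lia.
rewrite parityS.
have -> : x' - l.+1 = x'.-1 - l by lia.
by rewrite -addbA addbb addbF.
Qed.

(* Endpoints and gaps given by a disc and a position on it. *)
Section Positions.
Variables (I : finType) (c : I -> color) (c0 : color).
Local Notation endpt := (endpt c c0).
Local Notation gap := (gap c c0).
Local Notation size_of d := ((dcol c c0 d).2.*2).

Definition end_pos (p : endpt) : option I * nat := (tag p, tagged p : nat).
Definition gap_at (d : option I) (x : nat) : gap := @mkgap I c c0 d (inord x).

(* If f (end_pos p) is not a position of an endpoint, the value is p; this does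
   not happen for the functions f used below. *)
Definition mate_of (f : option I * nat -> option I * nat) (p : endpt) : endpt :=
  let q := f (end_pos p) in
  if insub q.2 is Some y then @mkend I c c0 q.1 y else p.

Definition source_at (q : option I * nat) : bool :=
  shade c c0 q.1 q.2 (+) (q.1 == None).

Lemma end_pos_inj : injective end_pos.
Proof.
case=> d x [d' x']; rewrite /end_pos /= => -[dd'].
by case: _ / dd' x' => x' xx'; congr Tagged; apply: val_inj.
Qed.

Lemma end_pos_lt p : (end_pos p).2 < size_of (end_pos p).1.
Proof. by case: p => d x /=; exact: ltn_ord. Qed.

Lemma end_pos_mate f p : (f (end_pos p)).2 < size_of (f (end_pos p)).1 ->
  end_pos (mate_of f p) = f (end_pos p).
Proof.
rewrite /mate_of; case: (f _) => d x /= xd.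
by rewrite insubT /end_pos /= .
Qed.

Lemma mkend_pos (p : endpt) d (x : nat) (xd : x < size_of d) :
  end_pos p = (d, x) -> p = @mkend I c c0 d (Ordinal xd).
Proof. by move=> e; apply: end_pos_inj; rewrite e. Qed.

Lemma gap_at_pos (g : gap) d (x : nat) :
  tag g = d -> tagged g = x :> nat -> g = gap_at d x.
Proof.
case: g => d' y /= dd'; case: _ / dd' => <-; congr Tagged.
by apply: val_inj; rewrite /= inordK.
Qed.

Lemma gap_const (h : gap -> bool) : (forall p, h (before p) = h (after p)) ->
  forall g, h g = h (first_gap c c0 (tag g)).
Proof.
move=> hba [d [x /= xlt]]; elim: x xlt => [|x IHx] xlt.
  by congr h; congr Tagged; apply: val_inj.
rewrite -(IHx (ltnW xlt)); have := hba (@mkend I c c0 d (Ordinal (xlt : x < _))).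
by move=> e; apply: etrans (etrans (esym e) _); congr h; congr Tagged; exact: val_inj.
Qed.

Variables (f : option I * nat -> option I * nat) (corners : seq (gap * gap)).

Hypothesis fP : forall d x, x < size_of d ->
  [/\ (f (d, x)).2 < size_of (f (d, x)).1, f (f (d, x)) = (d, x) &
      source_at (f (d, x)) = ~~ source_at (d, x)].

Hypothesis corner_ok : forall x y, (x, y) \in corners ->
  shade c c0 (tag x) (tagged x) = shade c c0 (tag y) (tagged y).

Hypothesis connected_ok : forall h : option I -> bool,
  (forall x y, (x, y) \in corners -> h (tag x) = h (tag y)) ->
  forall d d', h d = h d'.

Hypothesis jordan_ok : forall g : option I -> nat -> bool,
  (forall d x, x < size_of d -> g (f (d, x)).1 (f (d, x)).2 = g d x) ->
  (forall d, parity (g d) (size_of d) = false) ->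
  exists h0 : option I -> bool,
  let H d x := h0 d (+) parity (g d) x in
  (forall x y, (x, y) \in corners ->
     H (tag x) (tagged x) = H (tag y) (tagged y)) /\
  forall d x, x < size_of d ->
    let q := f (d, x) in
    if (d == None) == (q.1 == None) then H d x.+1 = H q.1 q.2
    else H d x = H q.1 q.2.

Let mate := mate_of f.

Lemma pos_mate p : end_pos (mate p) = f (end_pos p).
Proof. by apply: end_pos_mate; case: (fP (end_pos_lt p)); case: (end_pos p). Qed.

Lemma sourceE p : source p = source_at (end_pos p).
Proof. by []. Qed.

Lemma mate_planar : planar_pairing mate corners.
Proof.
have fP' p := fP (end_pos_lt p).
have fs p : source (mate p) = ~~ source p.
  by rewrite !sourceE pos_mate; case: (fP' p); case: (end_pos p).
have fK : involutive mate.
  move=> p; apply: end_pos_inj; rewrite !pos_mate.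
  by case: (fP' p); case: (end_pos p).
split=> //.
- move=> h ht hba; have hg := gap_const hba; move=> x y.
  rewrite (hg x) (hg y).
  apply: (connected_ok (h := fun d => h (first_gap c c0 d))) => z w zw.
  by rewrite -(hg z) -(hg w); apply: ht; rewrite /touch zw.
move=> phi phim phid.
pose g d x : bool := if insub x is Some y then phi (@mkend I c c0 d y) else false.
have gphi p : g (end_pos p).1 (end_pos p).2 = phi p.
  by case: p => d x; rewrite /g /= valK.
have gpos d x (xd : x < size_of d) :
    exists2 p : endpt, end_pos p = (d, x) & g d x = phi p.
  by exists (@mkend I c c0 d (Ordinal xd)) => //; rewrite -gphi.
have gN d : parity (g d) (size_of d) = false.
  by rewrite /parity big_mkord -[RHS](phid d); apply: eq_bigr => x _; rewrite -gphi.
have [d x xd|//|h0] := jordan_ok (g := g).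
  by have [p pE ->] := gpos _ _ xd; rewrite -pE -pos_mate gphi.
set H := fun d x => h0 d (+) parity (g d) x; move=> /= [Hc Hs].
have HS d x : H d x.+1 = H d x (+) g d x.
  by rewrite /H /parity big_nat_recr //= addbA.
have Hg p : phi p = H (tag p) (tagged p : nat) (+) H (tag p) (tagged p : nat).+1.
  by rewrite HS addKb -gphi.
exists (fun x : gap => H (tag x) (tagged x)); last first.
  by move=> p; rewrite /= /bump /= Hg.
move=> x y /or3P[/Hc //|/existsP[d /andP[/eqP-> /eqP->]]|].
  by rewrite /H /= gN /parity big_geq.
case/existsP=> p /existsP[b /andP[/eqP-> /eqP->]].
have := Hs _ _ (end_pos_lt p); rewrite -surjective_pairing -pos_mate.
have := fs p; have := Hg p; have := Hg (mate p); rewrite phim.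
rewrite /side_gap /source; case: (mate p) => d2 x2; case: p => d1 x1 /=.
move=> ->; case: (shade _ _ d1 x1); case: (shade _ _ d2 x2); case: (d1 == None);
  case: (d2 == None); case: b => //=; rewrite /bump /= ?add1n;
  by case: (H d1 x1); case: (H d1 x1.+1); case: (H d2 x2); case: (H d2 x2.+1).
Qed.

End Positions.

Lemma mem_second (T : eqType) (x y : T) : y \in [:: x; y].
Proof. by rewrite !inE eqxx orbT. Qed.

Lemma gap_atK (I : finType) (c : I -> color) c0 d x :
  x <= (dcol c c0 d).2.*2 -> tagged (gap_at c c0 d x) = x :> nat.
Proof. by move=> xd; rewrite /= inordK. Qed.

Section EmptyTangle.
Variable e : bool.

Definition no_color (v : void) : color := match v with end.

Lemma empty_planar :
  planar_pairing (mate_of (c := no_color) (c0 := (e, 0)) id) [::].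
Proof.
apply: mate_planar => //; first by case=> [[]|].
  by move=> h _ [[]|] [[]|].
by move=> g _ _; exists (fun _ => false); split=> // -[[]|].
Qed.

Definition empty_tangle : tangle no_color (e, 0) := pairing_tangle empty_planar.

End EmptyTangle.

Section IdTangle.
Variable c : color.

Definition id_end (q : option unit * nat) : option unit * nat :=
  (if q.1 is None then Some tt else None, q.2).

Definition id_corners : seq (gap (fun _ : unit => c) c * gap (fun _ : unit => c) c) :=
  [:: (gap_at _ _ (Some tt) 0, gap_at _ _ None 0)].

Lemma id_planar :
  planar_pairing (mate_of (c := fun _ : unit => c) (c0 := c) id_end) id_corners.
Proof.
apply: mate_planar.
- by case=> [[]|] x xc; split=> //=; rewrite /source_at /shade /= addbT addbF ?negbK.
- by move=> x y; rewrite inE => /eqP[-> ->]; rewrite /shade !gap_atK.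
- move=> h hc; have {}hc : h (Some tt) = h None by exact: hc _ _ (mem_head _ _).
  by move=> [[]|] [[]|].
move=> g gf gN; exists (fun _ => false); split.
  by move=> x y; rewrite inE => /eqP[-> ->]; rewrite !gap_atK //= !parity0.
have E x : x <= c.2.*2 -> parity (g (Some tt)) x = parity (g None) x.
  move=> xc; have := @parity_shift (g (Some tt)) (g None) 0 0 x; rewrite !parity0 !addbF.
  by apply=> y yx; rewrite !add0n -(gf None) //=; lia.
by case=> [[]|] x xc; rewrite /= E // ltnW.
Qed.

Definition id_tangle : tangle (fun _ : unit => c) c := pairing_tangle id_planar.

End IdTangle.

(* The closed tangle of (x, y) |-> tr(y x): point p of either input disc is joined
   to point 2n-1-p of the other, and both distinguished intervals lie in the
   outer region. *)
Section TraceTangle.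
Variable c : color.

Definition trace_end (q : option bool * nat) : option bool * nat :=
  if q.1 is Some b then (Some (~~ b), c.2.*2.-1 - q.2) else q.

Definition trace_corners :
    seq (gap (fun _ : bool => c) (c.1, 0) * gap (fun _ : bool => c) (c.1, 0)) :=
  [:: (gap_at _ _ (Some false) 0, gap_at _ _ None 0);
      (gap_at _ _ (Some true) 0, gap_at _ _ None 0)].

Lemma trace_planar : planar_pairing
  (mate_of (c := fun _ : bool => c) (c0 := (c.1, 0)) trace_end) trace_corners.
Proof.
apply: mate_planar.
- case=> [b|] x xc //; split=> /=.
  + by move: xc => /=; move: c.2.*2 => N; lia.
  + rewrite /trace_end /= negbK; congr (_, _); move: xc => /=; move: c.2.*2 => N; lia.
  have sN (b' : bool) : (Some b' == None) = false by [].
  rewrite /source_at /shade /trace_end /= !sN !addbF.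
  move: xc => /=; case: (c.1) => /=; move: (c.2) => N; lia.
- by move=> x y; rewrite !inE => /orP[] /eqP[-> ->]; rewrite /shade !gap_atK.
- move=> h hc.
  have h0 : h (Some false) = h None by exact: hc _ _ (mem_head _ _).
  have h1 : h (Some true) = h None by exact: hc _ _ (mem_second _ _).
  by move=> [[]|] [[]|]; rewrite ?h0 ?h1.
move=> g gf gN; exists (fun _ => false); split.
  by move=> x y; rewrite !inE => /orP[] /eqP[-> ->]; rewrite !gap_atK //= !parity0.
case=> [b|] x xc //=; rewrite /= in xc.
have := @parity_rev (g (Some b)) (g (Some (~~ b))) 0 c.2.*2 x.+1 xc.
have /= -> := gN (Some (~~ b)); rewrite parity0 addbF add0n => ->.
  by congr parity; lia.
by move=> y yx; rewrite -(gf (Some b)) //=; lia.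
Qed.

Definition trace_tangle : tangle (fun _ : bool => c) (c.1, 0) :=
  pairing_tangle trace_planar.

End TraceTangle.


Definition two (c c' : color) (b : bool) : color := if b then c' else c.

(* (a \star b)_i, with a = input false, b = input true.  On the discs of a, b and of
   the product the points are met in the order: top strings from left to right,
   right strings from top to bottom, left strings from bottom to top. *)
Section StarTangle.
Variables (m n k i : nat).

Definition star_end (q : option bool * nat) : option bool * nat :=
  let: (d, x) := q in
  match d with
  | Some false =>
      if x < m.*2 - i then (None, x)
      else if x < m.*2 then (Some true, m.*2.-1 - x)
      else if x < m.*2 + k then (Some true, (m.*2 + n.*2 + k.*2).-1 - x)
      else (None, x + n.*2 - i.*2)
  | Some true =>
      if x < i then (Some false, m.*2.-1 - x)
      else if x < n.*2 + k then (None, x + m.*2 - i.*2)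
      else (Some false, (m.*2 + n.*2 + k.*2).-1 - x)
  | None =>
      if x < m.*2 - i then (Some false, x)
      else if x < m.*2 - i + (n.*2 - i) + k then (Some true, x + i.*2 - m.*2)
      else (Some false, x + i.*2 - n.*2)
  end.

Local Notation star_in := (two (false, m + k) (false, n + k)).
Local Notation star_out := (false, m + n - i + k).

(* The regions at the top left corners of a and of b. *)
Definition star_corners : seq (gap star_in star_out * gap star_in star_out) :=
  [:: (gap_at _ _ (Some false) 0, gap_at _ _ None 0);
      (gap_at _ _ (Some false) m.*2, gap_at _ _ (Some true) 0)].

Lemma star_planar : i <= minn m.*2 n.*2 ->
  planar_pairing (mate_of (c := star_in) (c0 := star_out) star_end) star_corners.
Proof.
move=> imn; have [im ik] : i <= m.*2 /\ i <= n.*2 by lia.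
apply: mate_planar.
- have sN (b : bool) : (Some b == None) = false by [].
  case=> [[]|] x /= xN; repeat (case: ifP => ? /=);
    (split; [|rewrite /star_end|rewrite /source_at /shade /= ?sN ?eqxx ?addbF ?addbT];
     repeat (case: ifP => ? /=); try congr (_, _); lia).
- move=> x y; rewrite !inE => /orP[] /eqP[-> ->]; rewrite /shade !gap_atK //=; lia.
- move=> h hc.
  have h0 : h (Some false) = h None by exact: hc _ _ (mem_head _ _).
  have h1 : h (Some false) = h (Some true) by exact: hc _ _ (mem_second _ _).
  by move=> [[]|] [[]|]; rewrite -?h1 ?h0.
move=> g gf gN.
pose A := parity (g (Some false)); pose B := parity (g (Some true)); pose O := parity (g None).
exists (fun d => if d is Some true then A m.*2 else false).
have A1 y : y <= m.*2 - i -> A y = O y.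
  move=> yl; have := @parity_shift (g (Some false)) (g None) 0 0 y.
  rewrite !parity0 !addbF !add0n; apply=> z zy; rewrite -(gf None) /= ?add0n; last by lia.
  by rewrite ifT //; lia.
have A2 y : y <= i -> B y = A m.*2 (+) A (m.*2 - y).
  move=> yl; have := @parity_rev (g (Some true)) (g (Some false)) 0 m.*2 y.
  rewrite !parity0 !addbF !add0n; apply=> [|z zy]; first by lia.
  rewrite -(gf (Some true)) /=; last by lia.
  by rewrite ifT //; lia.
have A3 y : y <= n.*2 - i + k -> B (i + y) (+) B i = O (m.*2 - i + y) (+) O (m.*2 - i).
  move=> yl; apply: parity_shift => z zy; rewrite -(gf (Some true)) /=; last by lia.
  rewrite ifF ?ifT /=; try lia; congr (g _ _); lia.
have A4 y : y <= k -> A (m.*2 + y) (+) A m.*2 = B (n.*2 + k.*2 - y).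
  move=> yl; have := gN (Some true); rewrite /= doubleD -/B => BN.
  rewrite -[RHS]addFb -BN; apply: parity_rev => [|z zy]; first by lia.
  rewrite -(gf (Some false)); last by rewrite /=; lia.
  rewrite (_ : star_end _ = (Some true, (n.*2 + k.*2).-1 - z)) /star_end //.
  by repeat (case: ifP => ?); try congr (_, _); lia.
have A5 y : y <= k -> A (m.*2 + k + y) (+) A (m.*2 + k) =
    O (m.*2 - i + (n.*2 - i) + k + y) (+) O (m.*2 - i + (n.*2 - i) + k).
  move=> yl; apply: parity_shift => z zy; rewrite -(gf (Some false)); last by rewrite /=; lia.
  rewrite (_ : star_end _ = (None, m.*2 - i + (n.*2 - i) + k + z)) /star_end //.
  by repeat (case: ifP => ?); try congr (_, _); lia.
have A5' y : y <= k -> A (m.*2 + k + y) = O (m.*2 - i + (n.*2 - i) + k + y).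
  move=> yl; have := A5 y yl; have := A4 k (leqnn _); have := A3 _ (leqnn _).
  have -> : n.*2 + k.*2 - k = i + (n.*2 - i + k) by lia.
  rewrite (A2 i (leqnn _)) (A1 (m.*2 - i) (leqnn _)) addnA addnA.
  case: (B _); case: (A (m.*2 + k)); case: (A m.*2); case: (O _); case: (O _);
  case: (A _); case: (O _) => //.
have A3' y : y <= n.*2 - i + k -> A m.*2 (+) B (i + y) = O (m.*2 - i + y).
  move=> yl; have := A3 y yl; rewrite (A2 i (leqnn _)) (A1 (m.*2 - i) (leqnn _)).
  by case: (B _); case: (A m.*2); case: (O _); case: (O _).
have A4' y : y <= k -> A (m.*2 + y) = A m.*2 (+) B (n.*2 + k.*2 - y).
  by move=> yl; rewrite -A4 // addbC -addbA addbb addbF.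
have A2' y : y <= i -> A (m.*2 - y) = A m.*2 (+) B y.
  by move=> yl; rewrite A2 // addbA addbb.
split.
  move=> x y; rewrite !inE => /orP[] /eqP[-> ->]; rewrite !gap_atK //= ?parity0 ?addbF //=; lia.
have EQ (F : nat -> bool) u v : u = v -> F u = F v by move=> ->.
case=> [[]|] x /= xN; rewrite -/A -/B -/O.
- case: (boolP (x < i)) => xi /=; first by rewrite -A2' //; apply: EQ; lia.
  case: (boolP (x < n.*2 + k)) => xk /=; rewrite -/A -/B -/O.
    have -> : x = i + (x - i) by lia.
    by rewrite A3'; [apply: EQ|]; lia.
  have -> : x.+1 = n.*2 + k.*2 - (n.*2 + k.*2 - x.+1) by lia.
  by rewrite -A4'; [apply: EQ|]; lia.
- case: (boolP (x < m.*2 - i)) => xi /=; first by rewrite A1 //; lia.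
  case: (boolP (x < m.*2)) => xm /=.
    have -> : x.+1 = m.*2 - (m.*2.-1 - x) by lia.
    by rewrite A2' //; lia.
  case: (boolP (x < m.*2 + k)) => xk /=; rewrite -/A -/B -/O.
    have -> : x.+1 = m.*2 + (x.+1 - m.*2) by lia.
    by rewrite A4'; [congr (_ (+) _); apply: EQ|]; lia.
  have -> : x = m.*2 + k + (x - (m.*2 + k)) by lia.
  by rewrite A5'; [apply: EQ|]; lia.
case: (boolP (x < m.*2 - i)) => xi /=; first by rewrite -/A A1 //; lia.
case: (boolP (x < m.*2 - i + (n.*2 - i) + k)) => xk /=; rewrite -/A -/B -/O.
  have -> : x + i.*2 - m.*2 = i + (x - (m.*2 - i)) by lia.
  by rewrite A3'; [apply: EQ|]; lia.
rewrite -/A -/B -/O.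
have -> : x + i.*2 - n.*2 = m.*2 + k + (x - (m.*2 - i + (n.*2 - i) + k)) by lia.
by rewrite A5'; [apply: EQ|]; lia.
Qed.

End StarTangle.

Definition star_tangle (m n k : nat) (i : 'I_(minn m.*2 n.*2).+1) :
  tangle (two (false, m + k) (false, n + k)) (false, m + n - i + k) :=
  pairing_tangle (star_planar k (ltn_ord i : i <= _)).

(* Temperley-Lieb diagrams from 2i bottom points to 2j top points.  Around the
   rectangle, the points are 0, ..., 2i-1 on the bottom from left to right, then
   2i, ..., 2i+2j-1 on the top from right to left. *)
Section TemperleyLieb.
Variables (i j : nat).
Local Notation N := (i.*2 + j.*2).

Definition planar_matching (s : {ffun 'I_N -> 'I_N}) : bool :=
  [forall p, (s p != p) && (s (s p) == p)] &&
  [forall p : 'I_N, forall q : 'I_N, ~~ [&& p < q, q < s p & s p < s q]].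

Definition TL : finType := {s : {ffun 'I_N -> 'I_N} | planar_matching s}.

Definition epi (D : TL) : bool :=
  [forall p : 'I_N, (i.*2 <= p) ==> (val D p < i.*2)].

Definition TL_mate (D : TL) (x : nat) : nat :=
  if insub x is Some p then nat_of_ord (val D p) else x.

Section Mate.
Variable D : TL.
Local Notation s := (TL_mate D).

Lemma TL_mateE (p : 'I_N) : s p = val D p.
Proof. by rewrite /TL_mate valK. Qed.

Lemma TL_mateP x : x < N -> [/\ s x < N, s x <> x & s (s x) = x].
Proof.
move=> xN; have [/forallP/(_ (Ordinal xN))/andP[sx /eqP ssx] _] := andP (valP D).
have := TL_mateE (Ordinal xN) => /= ->; rewrite TL_mateE ssx; split=> //.
by move=> e; case/eqP: sx; apply: val_inj.
Qed.

Lemma TL_noncrossing x y : x < y -> y < s x -> s x < N -> s x < s y -> False.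
Proof.
move=> xy ysx sxN; have yN := ltn_trans ysx sxN; have xN := ltn_trans xy yN.
have [_ /forallP/(_ (Ordinal xN))/forallP/(_ (Ordinal yN))] := andP (valP D).
by rewrite -!TL_mateE /= xy ysx /= => /negP.
Qed.

Lemma TL_between x y : x < N -> x < y -> y < s x -> x < s y < s x.
Proof.
move=> xN xy ysx; have [sxN sx ssx] := TL_mateP xN.
have yN := ltn_trans ysx sxN; have [syN sy ssy] := TL_mateP yN.
have e1 : s y <> x by move=> e; rewrite e in ssy; lia.
have e2 : s y <> s x by move=> e; rewrite e ssx in ssy; lia.
have [lt1|] := ltnP (s x) (s y); first by case: (TL_noncrossing xy ysx).
have [//|lt2 le2] := ltnP x (s y); first by lia.
by case: (@TL_noncrossing (s y) x); rewrite ?ssy //; lia.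
Qed.

Lemma TL_parity (g : nat -> bool) lo hi : (forall x, x < N -> g (s x) = g x) ->
  lo <= hi <= N -> (forall x, lo <= x < hi -> lo <= s x < hi) ->
  parity g lo = parity g hi.
Proof.
move=> gs /andP[lohi hiN] clo.
have P x : x <= N -> parity g x = \big[addb/false]_(p < N | p < x) g p.
  by move=> xN; rewrite /parity big_mkord (big_ord_widen _ _ xN).
rewrite !P //; last exact: leq_trans hiN.
rewrite [RHS](bigID (fun p : 'I_N => p < lo)) /=.
rewrite (_ : \big[addb/false]_(p < N | (p < hi) && ~~ (p < lo)) g p = false) ?addbF.
  by apply: eq_bigl => p; lia.
rewrite (bigID (fun p : 'I_N => p < s p)) /=.
set X := (X in X (+) _); rewrite (_ : \big[addb/false]_(_ < N | _) _ = X) ?addbb //.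
rewrite (reindex_inj (h := val D)) /=; last first.
  apply: (can_inj (g := val D)) => p; apply: val_inj.
  by rewrite /= -!TL_mateE; case: (TL_mateP (ltn_ord p)).
apply: eq_big => p; last by rewrite -TL_mateE gs.
rewrite -TL_mateE; have [sN sp ssp] := TL_mateP (ltn_ord p).
rewrite ssp; have := clo p; have := clo (s p); rewrite ssp; lia.
Qed.

Lemma TL_odd x : x < N -> odd (s x) = ~~ odd x.
Proof.
wlog lt_x : x / x < s x => [H xN|xN].
  have [sN sx ssx] := TL_mateP xN; have [/H -> //|le_s] := ltnP x (s x).
  by have := H (s x); rewrite ssx => ->; rewrite ?negbK //; lia.
have [sN sx ssx] := TL_mateP xN.
have P y : parity (fun _ => true) y = odd y.
  by elim: y => [|y IHy]; rewrite ?parity0 // parityS IHy /= addbT.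
suff : odd x.+1 = odd (s x) by move=> <-.
rewrite -!P; apply: TL_parity => //; first by lia.
by move=> y yx; have := @TL_between x y; lia.
Qed.

Lemma TL_sides (g : nat -> bool) x : (forall x, x < N -> g (s x) = g x) ->
  x < N -> parity g x.+1 = parity g (s x).
Proof.
move=> gs; wlog lt_x : x / x < s x => [H xN|xN].
  have [sN sx ssx] := TL_mateP xN; have [/H -> //|le_s] := ltnP x (s x).
  have E : parity g (s x).+1 = parity g x by have := H (s x); rewrite ssx; apply; lia.
  by rewrite parityS -E parityS gs // -addbA addbb addbF.
have [sN sx ssx] := TL_mateP xN; apply: TL_parity => //; first by lia.
by move=> y yx; have := @TL_between x y; lia.
Qed.

Lemma TL_total (g : nat -> bool) : (forall x, x < N -> g (s x) = g x) ->
  parity g N = false.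
Proof.
move=> gs; rewrite -(@TL_parity g 0 N) ?parity0 ?leqnn // => x /andP[_ xN].
by case: (TL_mateP xN).
Qed.

End Mate.

Lemma epi_leq (D : TL) : epi D -> j <= i.
Proof.
move=> /forallP eD; rewrite -leq_double.
pose u (x : 'I_j.*2) : 'I_N := rshift i.*2 x.
have uP x : val D (u x) < i.*2 by have /implyP := eD (u x); apply; exact: leq_addr.
have /leq_card : injective (fun x => Ordinal (uP x)); last by rewrite !card_ord.
move=> x y /(congr1 val) /= e; apply: val_inj.
have uI z : val D (val D (u z)) = u z.
  by have [_ _] := TL_mateP D (ltn_ord (u z)); rewrite !TL_mateE => /val_inj.
have : u x = u y by rewrite -(uI x) -(uI y); congr (val D _); exact: val_inj.
by move/(congr1 val) => /= /addnI.
Qed.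

(* The diagram attached to the top strings of a box with k strings on the left
   and on the right, which it leaves alone. *)
Variables (k : nat) (D : TL).

Definition TL_end (q : option unit * nat) : option unit * nat :=
  let: (d, x) := q in
  let point y := if y < i.*2 then (Some tt, y) else (None, N.-1 - y) in
  match d with
  | Some _ => if x < i.*2 then point (TL_mate D x) else (None, x + j.*2 - i.*2)
  | None => if x < j.*2 then point (TL_mate D (N.-1 - x))
            else (Some tt, x + i.*2 - j.*2)
  end.

Local Notation TL_in := (fun _ : unit => (false, i + k)).
Local Notation TL_out := (false, j + k).

(* The region at the top left corners. *)
Definition TL_corners : seq (gap TL_in TL_out * gap TL_in TL_out) :=
  [:: (gap_at _ _ (Some tt) 0, gap_at _ _ None 0)].

Lemma TL_planar :
  planar_pairing (mate_of (c := TL_in) (c0 := TL_out) TL_end) TL_corners.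
Proof.
have mP := TL_mateP D; have oP := TL_odd D.
apply: mate_planar.
- have sN (b : unit) : (Some b == None) = false by [].
  have aux x y : N.-1 - (N.-1 - x) = y -> x < N -> x = y by lia.
  case=> [[]|] x /= xN.
  + case: (boolP (x < i.*2)) => xi.
      have xN' : x < N by lia.
      have [] := mP x xN'; have := oP x xN'; move: (TL_mate D x) => y oy yN yx ymx.
      case: (boolP (y < i.*2)) => yi; split=> /=.
      * by lia.
      * by rewrite /= yi ymx xi.
      * by rewrite /source_at /shade /= !sN !addbF oy //; lia.
      * by lia.
      * rewrite (_ : N.-1 - y < j.*2); last by lia.
        by rewrite (_ : N.-1 - (N.-1 - y) = y) ?ymx ?xi //; lia.
      * by rewrite /source_at /shade /= !sN eqxx !addbF addbT; have := oy; lia.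
    split=> /=; first by lia.
      rewrite (_ : x + j.*2 - i.*2 < j.*2 = false); last by lia.
      by congr (_, _); lia.
    by rewrite /source_at /shade /= !sN eqxx !addbF addbT; lia.
  case: (boolP (x < j.*2)) => xj.
    have xN' : N.-1 - x < N by lia.
    have [] := mP _ xN'; have := oP _ xN'.
    move: (TL_mate D (N.-1 - x)) => y oy yN yx ymx.
    case: (boolP (y < i.*2)) => yi; split=> /=.
    + by lia.
    + rewrite /= yi ymx ifF; last by lia.
      by congr (_, _); lia.
    + by rewrite /source_at /shade /= !sN eqxx !addbF addbT; have := oy; lia.
    + by lia.
    + rewrite (_ : N.-1 - y < j.*2); last by lia.
      rewrite (_ : N.-1 - (N.-1 - y) = y) ?ymx; last by lia.
      by rewrite ifF; [congr (_, _)|]; lia.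
    + by rewrite /source_at /shade /= eqxx !addbT; have := oy; lia.
  split=> /=; first by lia.
    rewrite (_ : x + i.*2 - j.*2 < i.*2 = false); last by lia.
    by congr (_, _); lia.
  by rewrite /source_at /shade /= !sN eqxx !addbF addbT; lia.
- by move=> x y; rewrite inE => /eqP[-> ->]; rewrite /shade !gap_atK.
- move=> h hc; have {}hc : h (Some tt) = h None by exact: hc _ _ (mem_head _ _).
  by move=> [[]|] [[]|].
move=> g gf gN.
pose A := parity (g (Some tt)); pose O := parity (g None).
pose G y := if y < i.*2 then g (Some tt) y else g None (N.-1 - y).
have GS x : x < N -> G (TL_mate D x) = G x.
  move=> xN; rewrite {2}/G; case: ifP => xi.
    have := gf (Some tt) x; rewrite /= xi /G.
    by case: ifP => _ /= -> //; lia.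
  have := gf None (N.-1 - x); rewrite /= (_ : N.-1 - x < j.*2); last by lia.
  rewrite (_ : N.-1 - (N.-1 - x) = x) /G; last by lia.
  by case: ifP => _ /= -> //; lia.
have GA y : y <= i.*2 -> A y = parity G y.
  move=> yl; have := @parity_shift (g (Some tt)) G 0 0 y.
  rewrite !parity0 !addbF !add0n; apply=> z zy; rewrite /G add0n ifT //; lia.
have GO y : y <= j.*2 -> O y = parity G (N - y).
  move=> yl; have := @parity_rev (g None) G 0 N y.
  rewrite !parity0 !addbF !add0n (TL_total GS); apply=> [|z zy]; first by lia.
  by rewrite /G ifF; [congr (g _ _)|]; lia.
have L y : A (i.*2 + y) = O (j.*2 + y) \/ ~~ (y <= k.*2).
  case: (boolP (y <= k.*2)) => yk; [left|by right].
  have := @parity_shift (g (Some tt)) (g None) i.*2 j.*2 y; rewrite -/A -/O (GA _ (leqnn _)) (GO _ (leqnn _)).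
  rewrite addnK => H; rewrite -[LHS](addbK (parity G i.*2)) H ?addbK // => z zy.
  rewrite -(gf (Some tt)) /=; last by lia.
  by rewrite ifF /=; [congr (g _ _)|]; lia.
exists (fun _ => false); split.
  by move=> x y; rewrite inE => /eqP[-> ->]; rewrite !gap_atK //= !parity0.
have EQ (F : nat -> bool) u v : u = v -> F u = F v by move=> ->.
case=> [[]|] x xc; rewrite /= in xc.
  rewrite /TL_end; case: (boolP (x < i.*2)) => xi /=; last first.
    rewrite -/A -/O; have -> : x = i.*2 + (x - i.*2) by lia.
    by case: (L (x - i.*2)); [move=> ->; apply: EQ|]; lia.
  have xN : x < N by lia.
  have [yN _ _] := mP x xN; have gy := GS x xN; have Sx := TL_sides GS xN.
  move: (TL_mate D x) yN gy Sx => y yN gy Sx.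
  case: (boolP (y < i.*2)) => yi /=; rewrite -/A -/O.
    by rewrite GA // GA ?Sx // ltnW.
  rewrite GA; last exact: ltnW.
  rewrite GO; last by lia.
  have -> : N - (N.-1 - y) = y.+1 by lia.
  by rewrite parityS gy -Sx parityS -addbA addbb addbF.
rewrite /TL_end; case: (boolP (x < j.*2)) => xj /=; last first.
  rewrite -/A -/O; have -> : x = j.*2 + (x - j.*2) by lia.
  have -> : j.*2 + (x - j.*2) + i.*2 - j.*2 = i.*2 + (x - j.*2) by lia.
  by case: (L (x - j.*2)); [move=> ->|lia].
have xN : N.-1 - x < N by lia.
have [yN _ _] := mP _ xN; have gy := GS _ xN; have Sx := TL_sides GS xN.
move: (TL_mate D (N.-1 - x)) yN gy Sx => y yN gy Sx.
case: (boolP (y < i.*2)) => yi /=; rewrite -/A -/O.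
  rewrite GO; last exact: ltnW.
  rewrite GA; last exact: ltnW.
  have -> : N - x = (N.-1 - x).+1 by lia.
  by rewrite Sx.
rewrite GO // GO; last by lia.
have -> : N - x.+1 = N.-1 - x by lia.
have -> : N - (N.-1 - y) = y.+1 by lia.
by rewrite parityS gy -Sx parityS -addbA addbb addbF.
Qed.

Definition TL_tangle : tangle TL_in TL_out := pairing_tangle TL_planar.

End TemperleyLieb.

(* Q is the pushout of A and B along G, in the category of sets. *)
Definition pushout (G A B Q : Type) (u : G -> A) (v : G -> B)
    (f : A -> Q) (g : B -> Q) : Prop :=
  (forall x, f (u x) = g (v x)) /\
  forall (Z : Type) (p : A -> Z) (q : B -> Z), (forall x, p (u x) = q (v x)) ->
  exists w : Q -> Z, [/\ forall x, w (f x) = p x, forall y, w (g y) = q y &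
    forall w' : Q -> Z, (forall x, w' (f x) = p x) -> (forall y, w' (g y) = q y) ->
      w' =1 w].

Section Gluing.
Variables (I : finType) (J : I -> finType) (c : I -> color) (c0 : color).
Variable d : forall i, J i -> color.
Arguments d : clear implicits.

Definition glue_color (p : {i : I & J i}) : color := d (tag p) (tagged p).

Variables (T : tangle c c0) (S : forall i, tangle (d i) (c i)).
Variable U : tangle glue_color c0.

(* U is T with S i put into its i-th input disc, for every i: strings and
   regions are glued along the boundaries of these discs. *)
Record gluing_maps (fT : str T -> str U) (fS : {i : I & str (S i)} -> str U)
    (gT : reg T -> reg U) (gS : {i : I & reg (S i)} -> reg U) : Prop := GluingMaps {
  glue_str : pushout
    (fun q : {i : I & 'I_((c i).2.*2)} =>
       tend T (@mkend I c c0 (Some (tag q)) (tagged q)))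
    (fun q => Tagged (fun i => str (S i))
       (tend (S (tag q)) (@mkend _ (d (tag q)) (c (tag q)) None (tagged q)))) fT fS;
  glue_reg : pushout
    (fun q : {i : I & 'I_((c i).2.*2).+1} =>
       tgap T (@mkgap I c c0 (Some (tag q)) (tagged q)))
    (fun q => Tagged (fun i => reg (S i))
       (tgap (S (tag q)) (@mkgap _ (d (tag q)) (c (tag q)) None (tagged q)))) gT gS;
  glue_end_out : forall x, tend U (@mkend _ glue_color c0 None x) =
    fT (tend T (@mkend I c c0 None x));
  glue_gap_out : forall x, tgap U (@mkgap _ glue_color c0 None x) =
    gT (tgap T (@mkgap I c c0 None x));
  glue_end_in : forall i (j : J i) x,
    tend U (@mkend _ glue_color c0 (Some (Tagged J j)) x) =
    fS (Tagged (fun i => str (S i)) (tend (S i) (@mkend _ (d i) (c i) (Some j) x)));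
  glue_gap_in : forall i (j : J i) x,
    tgap U (@mkgap _ glue_color c0 (Some (Tagged J j)) x) =
    gS (Tagged (fun i => reg (S i)) (tgap (S i) (@mkgap _ (d i) (c i) (Some j) x)));
  glue_side_out : forall s b, tside U (fT s) b = gT (tside T s b);
  glue_side_in : forall i (s : str (S i)) b,
    tside U (fS (Tagged (fun i => str (S i)) s)) b =
    gS (Tagged (fun i => reg (S i)) (tside (S i) s b))
}.

Definition is_gluing : Prop := exists fT fS gT gS, @gluing_maps fT fS gT gS.

End Gluing.

(* T' is T with its input discs renumbered along h, up to isotopy. *)
Definition isotopic (I I' : finType) (h : I' -> I) (c : I -> color) (c0 : color)
    (T : tangle c c0) (T' : tangle (fun i => c (h i)) c0) : Prop :=
  exists (f : str T -> str T') (g : reg T -> reg T'),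
  [/\ bijective f /\ bijective g,
      (forall i x, tend T' (@mkend _ (fun i => c (h i)) c0 (Some i) x) =
                   f (tend T (@mkend _ c c0 (Some (h i)) x))) /\
      (forall i x, tgap T' (@mkgap _ (fun i => c (h i)) c0 (Some i) x) =
                   g (tgap T (@mkgap _ c c0 (Some (h i)) x))),
      (forall x, tend T' (@mkend _ (fun i => c (h i)) c0 None x) =
                 f (tend T (@mkend _ c c0 None x))) /\
      (forall x, tgap T' (@mkgap _ (fun i => c (h i)) c0 None x) =
                 g (tgap T (@mkgap _ c c0 None x))) &
      forall s b, tside T' (f s) b = g (tside T s b)].

(* T' is the reflection of T. *)
Definition mirror (I : finType) (c : I -> color) (c0 : color)
    (T T' : tangle c c0) : Prop :=
  exists (f : str T -> str T') (g : reg T -> reg T'),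
  [/\ bijective f /\ bijective g,
      forall d x, tend T' (@mkend _ c c0 d x) = f (tend T (@mkend _ c c0 d (rev_ord x))),
      forall d x, tgap T' (@mkgap _ c c0 d x) = g (tgap T (@mkgap _ c c0 d (rev_ord x))) &
      forall s b, tside T' (f s) b = g (tside T s b)].

(* T and T', whose output discs have no boundary points, agree up to an isotopy
   on the sphere: the outer disc may lie in any region. *)
Definition sphere_isotopic (I : finType) (c : I -> color) (e e' : bool)
    (T : tangle c (e, 0)) (T' : tangle c (e', 0)) : Prop :=
  exists (f : str T -> str T') (g : reg T -> reg T'),
  [/\ bijective f /\ bijective g,
      forall i x, tend T' (@mkend _ c (e', 0) (Some i) x) =
                  f (tend T (@mkend _ c (e, 0) (Some i) x)),
      forall i x, tgap T' (@mkgap _ c (e', 0) (Some i) x) =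
                  g (tgap T (@mkgap _ c (e, 0) (Some i) x)) &
      forall s b, tside T' (f s) b = g (tside T s b)].

Local Open Scope ring_scope.

Record planar_algebra (K : fieldType) := PlanarAlgebra {
  space :> color -> vectType K;
  act : forall (I : finType) (c : I -> color) (c0 : color),
    tangle c c0 -> (forall i, space (c i)) -> space c0;
  act_linear : forall (I : finType) (c : I -> color) c0 (T : tangle c c0) (i : I)
      (a : K) (x y z : forall i, space (c i)),
    z i = a *: x i + y i -> (forall j, j != i -> z j = x j /\ z j = y j) ->
    act T z = a *: act T x + act T y;
  act_isotopic : forall (I I' : finType) (h : I' -> I) (c : I -> color) c0
      (T : tangle c c0) (T' : tangle (fun i => c (h i)) c0),
    bijective h -> isotopic T T' ->
    forall x, act T' (fun i => x (h i)) = act T x;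
  act_id : forall c0 (x : unit -> space c0), act (id_tangle c0) x = x tt;
  act_gluing : forall (I : finType) (J : I -> finType) (c : I -> color) c0
      (d : forall i, J i -> color) (T : tangle c c0)
      (S : forall i, tangle (d i) (c i)) (U : tangle (glue_color d) c0),
    is_gluing T S U ->
    forall x, act U x = act T (fun i => act (S i) (fun j => x (Tagged J j)))
}.

Arguments act {K} P {I c c0} T x : rename.

Definition no_input (V : color -> Type) (v : void) : V (no_color v) :=
  match v with end.

Definition two_inputs (V : color -> Type) (c c' : color) (x : V c) (y : V c') :
    forall b, V (two c c' b) :=
  fun b => if b is true then y else x.

(* The unit of P_{0,+} or P_{0,-}, by which this space is identified with K. *)
Definition pa_one (K : fieldType) (P : planar_algebra K) (e : bool) : P (e, 0%N) :=
  act P (empty_tangle e) (no_input (fun c => P c)).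

Record subfactor_planar_algebra (R : realType) := SubfactorPlanarAlgebra {
  spa :> planar_algebra R[i];
  spa_dim1 : forall e, \dim {: spa (e, 0%N)} = 1%N;
  adj_op : forall c, spa c -> spa c;
  adj_opK : forall c, involutive (@adj_op c);
  adj_op_antilinear : forall c (a : R[i]) (x y : spa c),
    adj_op (a *: x + y) = Num.conj a *: adj_op x + adj_op y;
  adj_op_mirror : forall (I : finType) (c : I -> color) c0 (T T' : tangle c c0),
    mirror T T' -> forall x, adj_op (act spa T x) = act spa T' (fun i => adj_op (x i));
  spa_spherical : forall (I : finType) (c : I -> color) e e'
      (T : tangle c (e, 0%N)) (T' : tangle c (e', 0%N)), sphere_isotopic T T' ->
    forall x (a : R[i]), act spa T x = a *: pa_one spa e ->
                         act spa T' x = a *: pa_one spa e';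
  spa_positive : forall c (x : spa c), x != 0 -> exists2 a : R[i], 0 < a &
    act spa (trace_tangle c) (fun b : bool => if b then adj_op x else x)
      = a *: pa_one spa c.1
}.

(* Algebraic direct sums. *)
Record dsum (V : nat -> zmodType) := DSum {
  comp :> forall n, V n;
  comp_finite : exists N, forall n, (N <= n)%N -> comp n = 0
}.

Section Graded.
Variables (R : realType) (P : subfactor_planar_algebra R) (k : nat).

(* P_n is the space of color (false, n): distinguished intervals are unshaded. *)
Definition Pk (n : nat) : vectType R[i] := P (false, (n + k)%N).
Definition Gr : Type := dsum Pk.

(* The component in degree p of an element x of degree d. *)
Definition homog d (x : Pk d) (p : nat) : Pk p :=
  if d =P p is ReflectT e then ecast n (Pk n) e x else 0.

(* The summand (a \star b)_i of the product a \star b *)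
Definition star_i m n (i : 'I_(minn m.*2 n.*2).+1) (a : Pk m) (b : Pk n) :
    Pk (m + n - i) :=
  act P (star_tangle k i) (@two_inputs (fun c => P c) _ _ a b).

Definition TL_act i j (D : TL i j) (a : Pk i) : Pk j :=
  act P (TL_tangle k D) (fun _ => a).

Definition X_block i j (a : Pk i) : Pk j := \sum_(D : TL i j | epi D) TL_act D a.

Definition X_comp (a : Gr) (j : nat) : Pk j :=
  \sum_(i \in [set: nat]) X_block j (a i).

Definition star_comp (a b : Gr) (p : nat) : Pk p :=
  \sum_(mn \in [set: nat * nat])
    \sum_(i < (minn mn.1.*2 mn.2.*2).+1) homog (star_i i (a mn.1) (b mn.2)) p.

Definition bullet_comp (a b : Gr) (p : nat) : Pk p :=
  \sum_(mn \in [set: nat * nat])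
    homog (star_i (ord0 : 'I_(minn mn.1.*2 mn.2.*2).+1) (a mn.1) (b mn.2)) p.

Lemma act0 (I : finType) (c : I -> color) c0 (T : tangle c c0) i
  (x : forall i, P (c i)) : x i = 0 -> act P T x = 0.
Proof.
move=> xi; have := @act_linear _ P I c c0 T i (-1) x x x.
rewrite xi scaler0 addr0 scaleN1r addNr; apply=> // j _.
Qed.

Lemma star_i0 m n (i : 'I_(minn m.*2 n.*2).+1) (a : Pk m) (b : Pk n) :
  a = 0 \/ b = 0 -> star_i i a b = 0.
Proof. by case=> e; [apply: (@act0 _ _ _ _ false)|apply: (@act0 _ _ _ _ true)]. Qed.

Lemma homog0 d p : homog (0 : Pk d) p = 0.
Proof. by rewrite /homog; case: eqP => // e; case: _ / e. Qed.

Lemma homog_neq d (x : Pk d) p : d != p -> homog x p = 0.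
Proof. by rewrite /homog; case: eqP. Qed.

Lemma X_finite (a : Gr) : exists N, forall n, (N <= n)%N -> X_comp a n = 0.
Proof.
have [N aN] := comp_finite a; exists N => j Nj; apply: fsbig1 => i _.
rewrite /X_block; have [ij|ji] := ltnP i j.
  by apply: big1 => D /epi_leq; rewrite leqNgt ij.
apply: big1 => D _; apply: (@act0 _ _ _ _ tt); apply: aN.
exact: leq_trans ji.
Qed.

Lemma star_vanish (a b : Gr) : exists N, forall p, (N <= p)%N ->
  forall m n (i : 'I_(minn m.*2 n.*2).+1), homog (star_i i (a m) (b n)) p = 0.
Proof.
have [[M aM] [N bN]] := (comp_finite a, comp_finite b).
exists (M + N)%N => p pMN m n i.
have [Mm|mM] := leqP M m; first by rewrite star_i0 ?homog0 //; left; apply: aM.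
have [Nn|nN] := leqP N n; first by rewrite star_i0 ?homog0 //; right; apply: bN.
by apply: homog_neq; lia.
Qed.

Lemma star_finite (a b : Gr) : exists N, forall n, (N <= n)%N -> star_comp a b n = 0.
Proof.
have [N v] := star_vanish a b; exists N => p Np; apply: fsbig1 => mn _.
by apply: big1 => i _; apply: v.
Qed.

Lemma bullet_finite (a b : Gr) :
  exists N, forall n, (N <= n)%N -> bullet_comp a b n = 0.
Proof.
have [N v] := star_vanish a b; exists N => p Np; apply: fsbig1 => mn _.
exact: v.
Qed.

Definition X_map (a : Gr) : Gr := DSum (X_finite a).
Definition star (a b : Gr) : Gr := DSum (star_finite a b).
Definition bullet (a b : Gr) : Gr := DSum (bullet_finite a b).

End Graded.

(* Main.v *)
(** The diagrams of [X (a \bullet b)] are the epi diagrams D attached to the tops of a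
and b side by side.  Cutting D between the two boxes gives an epi diagram D1 on a, an
epi diagram D2 on b, and the number i of strings of D joining the two boxes.  A string
from a that does not return to a cannot be enclosed by one that does, so these i
strings are nested arcs joining the last i top points of D1 to the first i top points
of D2, and (D1, D2, i) determines D.  Hence the terms of [X (a \bullet b)] correspond
bijectively to those of [X a \star X b].

Corresponding terms are equal because the two composite tangles are isotopic.  Both
composites are built as pushouts; their strings join the same boundary points, and
their regions then agree by the Jordan curve property of one composite and the
connectedness of the other. *)

From HB Require Import structures.
From mathcomp Require Import all_boot all_order all_algebra.
From mathcomp Require Import zify.
From mathcomp Require Import boolp classical_sets functions cardinality fsbigop reals.
Require Import Defs.

Set Implicit Arguments.
Unset Strict Implicit.
Unset Printing Implicit Defensive.
Import GRing.Theory.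
Local Open Scope nat_scope.

(** * Pushouts and gluing of tangles *)

(** [act_gluing] only speaks of a tangle already known to be a gluing, so both composites have to be
    constructed as tangles, with every axiom, the Jordan property included. Strings are the delicate
    point: a string that winds several times through a glued circle could become a long chain or
    close up. Here no inner tangle has a string joining two points of its outer disc (for
    Temperley-Lieb diagrams this is what epi says), so each end of the outer tangle is prolonged
    exactly once.

    The pairing of ends alone does not fix the regions, since the picture may be disconnected (for
    instance when [k = 0]) and a floating piece could lie in any region. Two coincidences of corner
    regions, which connect the discs of a, of b and of the output, remove this freedom. The region
    pushouts are thus never computed. *)

Section Pushouts.
Variables (G A B : finType) (u : G -> A) (v : G -> B).

(** The quotient of [A + B] by the equivalence generated by [u z ~ v z]; canonical roots of the
    components represent the classes, which keeps [Q] finite. It serves for regions, where neither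
    map need be injective. *)
Lemma pushout_exists :
  exists (Q : finType) (f : A -> Q) (g : B -> Q), pushout u v f g.
Proof.
pose e (x y : A + B) := [exists z, (x == inl (u z)) && (y == inr (v z))].
pose a : rel (A + B)%type := fun x y => e x y || e y x.
have asym : connect_sym a.
  by apply: sym_connect_sym => x y; rewrite /a orbC.
pose Q : finType := {x : (A + B)%type | fingraph.root a x == x}.
have cP x : fingraph.root a (fingraph.root a x) == fingraph.root a x.
  by rewrite (root_root asym).
pose cl x : Q := exist (fun x => is_true (fingraph.root a x == x)) _ (cP x).
exists Q, (fun x => cl (inl x)), (fun y => cl (inr y)); split.
  move=> z; apply/val_inj/eqP; rewrite /= (root_connect asym) connect1 //.
  by apply/orP; left; apply/existsP; exists z; rewrite !eqxx.
move=> Z p q pq; pose w0 (x : A + B) := match x with inl x => p x | inr y => q y end.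
have w0e x y : e x y -> w0 x = w0 y.
  by case/existsP=> z /andP[/eqP-> /eqP->]; exact: pq.
have w0c x y : connect a x y -> w0 x = w0 y.
  case/connectP=> s; elim: s x => [x _ -> //|z s IHs x] /= /andP[xz zs] yE.
  by rewrite -(IHs z) //; case/orP: xz => /w0e.
exists (fun r => w0 (val r)); split.
- by move=> x; rewrite -[RHS]/(w0 (inl x)); apply: w0c; rewrite asym connect_root.
- by move=> x; rewrite -[RHS]/(w0 (inr x)); apply: w0c; rewrite asym connect_root.
move=> w' wp wq r; have -> : r = cl (val r) by apply/val_inj/esym/eqP/(valP r).
rewrite -[RHS](w0c (val r)) ?connect_root //.
by case: (val r) => z; rewrite /= ?wp ?wq.
Qed.

(** For injective [v] the pushout is [A] together with the points of [B] outside the image of [v].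
    The last three clauses record this shape, which is what allows the ends of a glued string to be
    counted. *)
Lemma pushout_inj_exists : injective v ->
  exists (Q : finType) (f : A -> Q) (g : B -> Q), [/\ pushout u v f g,
    injective f,
    forall a b, g b = f a -> exists2 x, b = v x & a = u x &
    forall b b', g b = g b' -> b = b' \/ exists x, b = v x].
Proof.
move=> vI; pose rep (y : A + B) := if y is inr b then [forall x, v x != b] else true.
pose Q : finType := {y : (A + B)%type | rep y}.
pose f (a : A) : Q := exist (fun y => is_true (rep y)) (inl a) isT.
have [g gP] : {g : B -> Q & forall b, (exists2 x, b = v x & g b = f (u x)) \/
    (forall x, v x <> b) /\ val (g b) = inr b}.
  apply: (@choice _ _ (fun b (q : Q) => (exists2 x, b = v x & q = f (u x)) \/
    (forall x, v x <> b) /\ val q = inr b)) => b.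
  have [/existsP[x /eqP xb]|/existsPn nb] := boolP [exists x, v x == b].
    by exists (f (u x)); left; exists x.
  have rb : rep (inr b) by apply/forallP.
  exists (exist (fun y => is_true (rep y)) (inr b) rb); right; split=> // x.
  exact/eqP/nb.
have gv x : g (v x) = f (u x).
  by case: (gP (v x)) => [[y /vI <- ->] //|[/(_ x) []]].
exists Q, f, g; split.
- split=> // Z p q pq.
  exists (fun r => match val r with inl a => p a | inr b => q b end); split=> //.
    by move=> b; case: (gP b) => [[x -> ->] /=|[_ ->] //]; rewrite pq.
  move=> w' wp wq r; case Er: (val r) => [a|b].
    by rewrite -wp; congr w'; apply: val_inj.
  rewrite -wq; congr w'; apply: val_inj; rewrite Er; case: (gP b) => [[x bx _]|[_ ->//]].
  by have := valP r; rewrite Er /= => /forallP/(_ x); rewrite bx eqxx.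
- by move=> a a' /(congr1 val) [].
- move=> a b; case: (gP b) => [[x bx ->] /(congr1 val)[ux]|[_ e] /(congr1 val)].
    by exists x.
  by rewrite e.
move=> b b'; case: (gP b) => [[x -> _]|[nb e]]; first by right; exists x.
case: (gP b') => [[x' _ ->] /(congr1 val)|[_ e'] /(congr1 val)].
  by rewrite e.
by rewrite e e' => -[->]; left.
Qed.

End Pushouts.

(** Uniqueness in the universal property, tested on maps to [Prop]: the predicate of lying in one of
    the two images and the constant [True] restrict to the same maps, hence coincide. *)
Lemma pushout_cover (G A B Q : Type) (u : G -> A) (v : G -> B) (f : A -> Q) (g : B -> Q) :
  pushout u v f g -> forall r, (exists a, r = f a) \/ (exists b, r = g b).
Proof.
move=> [_ H] r.
have [|w [_ _ wu]] := H Prop (fun=> True) (fun=> True); first by [].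
pose w1 r := (exists a, r = f a) \/ (exists b, r = g b).
suff w1T : w1 r = True by rewrite -/(w1 r) w1T.
rewrite (wu w1) -?(wu (fun=> True)) // => x; apply/propext; split=> // _.
  by left; exists x.
by right; exists x.
Qed.

(** * Parity counts along the strings of a tangle *)

Section Tangles.
Variables (I : finType) (c : I -> color) (c0 : color).

Lemma cross_string (T : tangle c c0) (f : str T -> bool) (h : reg T -> bool) :
  (forall s, f s = h (tside T s true) (+) h (tside T s false)) ->
  forall p, f (tend T p) = h (tgap T (before p)) (+) h (tgap T (after p)).
Proof.
by move=> fh p; rewrite fh -!tg_side (side_gapTF p (fun g => h (tgap T g))).
Qed.

(** Each string contributes its value at no end or at exactly two, so everything cancels modulo
    2. *)
Lemma sum_strings (T : tangle c c0) (f : str T -> bool) :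
  \big[addb/false]_p f (tend T p) = false.
Proof.
rewrite (partition_big (tend T) predT) //= big1 // => s _.
rewrite (eq_bigr (fun=> f s)); last by move=> p /eqP ->.
have [np|[p [q [sp sq pq]]]] := tg_string s.
  by rewrite big_pred0 // => p; apply/eqP.
have pNq : p != q by apply: contraNneq sq => <-.
rewrite (bigD1 p) /=; last by apply/eqP/pq; left.
rewrite (bigD1 q) /=; last first.
  by rewrite (eq_sym q) pNq andbT; apply/eqP/pq; right.
rewrite big_pred0 ?addbF ?addbb // => r.
apply/negP => /andP[/andP[/eqP/pq[] ->]]; first by rewrite eqxx.
by rewrite eqxx.
Qed.

Lemma sum_outputs (T : tangle c c0) (f : str T -> bool) :
  (forall i, \big[addb/false]_x f (tend T (@mkend _ c c0 (Some i) x)) = false) ->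
  \big[addb/false]_x f (tend T (@mkend _ c c0 None x)) = false.
Proof.
move=> fi; have := sum_strings f.
rewrite (eq_bigr (fun p => f (tend T (@mkend _ c c0 (tag p) (tagged p))))); last by case.
rewrite -(@sig_big_dep _ _ _ _ _ xpredT (fun=> xpredT)
   (fun d x => f (tend T (@mkend _ c c0 d x)))) /=.
rewrite (bigD1 None) //= [X in _ (+) X]big1 ?addbF // => -[i _|//]; exact: fi.
Qed.

Lemma string_ends (T : tangle c c0) (p q r : endpt c c0) :
  tend T p = tend T q -> p <> q -> tend T r = tend T p -> r = p \/ r = q.
Proof.
move=> pq pNq rp; have [/(_ p)//|[p' [q' [_ _ H]]]] := tg_string (tend T p).
have /H e1 := erefl (tend T p); have /H e2 := esym pq; move: rp pNq => /H.
by case: e1 => ->; case: e2 => ->; case=> ->; tauto.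
Qed.

Lemma string_mate (T : tangle c c0) (p : endpt c c0) :
  exists q, [/\ source q = ~~ source p, tend T q = tend T p &
    forall r, tend T r = tend T p <-> r = p \/ r = q].
Proof.
have [/(_ p)//|[p' [q' [sp sq H]]]] := tg_string (tend T p).
have /H[e|e] := erefl (tend T p); subst.
  by exists q'; split; [rewrite sp (negbTE sq)|apply/H; right|move=> r; rewrite H].
exists p'; split; [by rewrite sp sq|by apply/H; left|move=> r; rewrite H; tauto].
Qed.

End Tangles.

(** * Existence of the glued tangle *)

Section GluingExists.
Variables (I : finType) (J : I -> finType) (c : I -> color) (c0 : color).
Variable d : forall i, J i -> color.
Arguments d : clear implicits.
Variables (T : tangle c c0) (S : forall i, tangle (d i) (c i)).
(** No string of an inner tangle turns back to its outer disc. This makes the map [vs] from glued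
    points to inner strings injective and prevents new closed strings. *)
Hypothesis S_nocap : forall i (x y : 'I_((c i).2.*2)),
  tend (S i) (@mkend _ (d i) (c i) None x) = tend (S i) (@mkend _ (d i) (c i) None y) ->
  x = y.

Local Notation gcol := (glue_color d).
Local Notation inner i p := (Tagged (fun i' => str (S i')) (tend (S i) p)).

Let SE := {i : I & str (S i)}.
Let RE := {i : I & reg (S i)}.
Let us (q : {i : I & 'I_((c i).2.*2)}) := tend T (@mkend I c c0 (Some (tag q)) (tagged q)).
Let vs (q : {i : I & 'I_((c i).2.*2)}) : SE := inner (tag q) (@mkend _ (d (tag q)) (c (tag q)) None (tagged q)).
Let ur (q : {i : I & 'I_((c i).2.*2).+1}) := tgap T (@mkgap I c c0 (Some (tag q)) (tagged q)).
Let vr (q : {i : I & 'I_((c i).2.*2).+1}) : RE :=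
  Tagged (fun i => reg (S i)) (tgap (S (tag q)) (@mkgap _ (d (tag q)) (c (tag q)) None (tagged q))).

Lemma vs_inj : injective vs.
Proof.
move=> [i x] [i' x'] e; have ii' : i = i' by have := congr1 tag e.
case: _ / ii' x' e => x' /eqP; rewrite -tag_eqE /tag_eq /= eqxx /= tagged_asE => /eqP.
by move/S_nocap ->.
Qed.

Section Glued.
Variables (Q : finType) (f : str T -> Q) (g : SE -> Q).
Hypotheses (po : pushout us vs f g) (f_inj : injective f).
Hypothesis gf : forall a b, g b = f a -> exists2 x, b = vs x & a = us x.
Hypothesis gg : forall b b', g b = g b' -> b = b' \/ exists x, b = vs x.
Variables (R : finType) (fr : reg T -> R) (gr : RE -> R).
Hypothesis por : pushout ur vr fr gr.

Definition gtend (p : endpt gcol c0) : Q :=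
  match p with
  | existT None x => f (tend T (@mkend I c c0 None x))
  | existT (Some (existT i j)) x => g (inner i (@mkend _ (d i) (c i) (Some j) x))
  end.

Definition gtgap (p : gap gcol c0) : R :=
  match p with
  | existT None x => fr (tgap T (@mkgap I c c0 None x))
  | existT (Some (existT i j)) x =>
     gr (Tagged (fun i => reg (S i)) (tgap (S i) (@mkgap _ (d i) (c i) (Some j) x)))
  end.

(* [over z r]: the end z of the glued tangle and the end r of T lie on the same
   string, and either z = r, or z is joined to r by a string of an inner tangle. *)
Definition over (z : endpt gcol c0) (r : endpt c c0) : Prop :=
  match z with
  | existT None x => r = @mkend I c c0 None x
  | existT (Some (existT i j)) y => exists2 x, r = @mkend I c c0 (Some i) x &
      tend (S i) (@mkend _ (d i) (c i) (Some j) y) = tend (S i) (@mkend _ (d i) (c i) None x)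
  end.

Lemma gtend_over z t : gtend z = f t <-> exists2 r, over z r & tend T r = t.
Proof.
case: z => [[[i j]|] y] /=; last first.
  split=> [/f_inj e|[r -> -> //]]; by exists (@mkend I c c0 None y).
split.
  move=> /gf[[i' x] e ->]; exists (@mkend I c c0 (Some i') x) => //.
  have ii' : i = i' by have := congr1 tag e.
  case: _ / ii' x e => x /eqP; rewrite -tag_eqE /tag_eq /= eqxx /= tagged_asE => /eqP e.
  by exists x.
case=> r [x -> e] <-; rewrite e.
by rewrite -[tend T _]/(us (Tagged (fun i => 'I_((c i).2.*2)) x)) po.1.
Qed.

(** Prolonging an end through an inner tangle keeps its orientation: [source] changes along the
    inner string and changes again because the glued circle is an output disc for [S i] but an input
    disc for [T]. *)
Lemma over_exists r : exists z, [/\ over z r, source z = source r &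
  forall z', over z' r -> z' = z].
Proof.
case: r => [[i|] x]; last first.
  exists (@mkend _ gcol c0 None x); split=> // -[[[i j]|] y] /=; first by case.
  move/eqP; rewrite -tag_eqE /tag_eq /= tagged_asE => /eqP e.
  by congr Tagged.
(* If the other end were on the outer disc, it would be the same point by [S_nocap], against the
   opposite orientation. *)
have [[[j|] y] [sy ey uy]] := string_mate (S i) (@mkend _ (d i) (c i) None x); last first.
  have e := S_nocap ey; move: sy; rewrite e; by case: source.
exists (@mkend _ gcol c0 (Some (Tagged J j)) y); split.
- by exists x.
- rewrite (_ : source _ = source (@mkend _ (d i) (c i) (Some j) y)) //.
  rewrite [LHS]sy /source /shade /= eqxx addbT negbK.
  by rewrite (_ : (Some i == None) = false) ?addbF.
move=> [[[i' j']|] y'] /=; last by [].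
case=> x' /eqP; rewrite -tag_eqE /tag_eq /= => /andP[/eqP[ii']].
case: _ / ii' j' y' x' => j' y' x'; rewrite tagged_asE => /eqP xx'; subst x'.
move/uy => [//|] /eqP; rewrite -tag_eqE /tag_eq /= => /andP[/eqP[jj']].
by case: _ / jj' y {sy ey uy} => y; rewrite tagged_asE => /eqP ->.
Qed.

Lemma g_inner i j x b : g (inner i (@mkend _ (d i) (c i) (Some j) x)) = g b ->
  (forall y, b <> vs y) -> inner i (@mkend _ (d i) (c i) (Some j) x) = b.
Proof. by move=> /esym /gg[//|[y]] yb /(_ y). Qed.

Lemma gtend_string_over t : (forall p, gtend p <> f t) \/
    exists p q, [/\ source p, ~~ source q & forall r, gtend r = f t <-> r = p \/ r = q].
Proof.
have [nt|[p [q [sp sq pq]]]] := tg_string t.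
  by left=> z /gtend_over[r _]; exact: nt.
have [p' [pp' sp' up']] := over_exists p; have [q' [qq' sq' uq']] := over_exists q.
right; exists p', q'; rewrite sp' sq'; split=> // z; rewrite gtend_over; split.
  by case=> r zr /pq[] e; subst r; [left; apply: up'|right; apply: uq'].
by case=> ->; [exists p|exists q] => //; apply/pq; auto.
Qed.

(** Either the string passes through [T], and its ends are the prolonged ends of a string of [T], or
    it stays inside one [S i] without reaching the glued circle, and its ends are those it has
    there. *)
Lemma gtend_string (s : Q) : (forall p, gtend p <> s) \/
    exists p q, [/\ source p, ~~ source q & forall r, gtend r = s <-> r = p \/ r = q].
Proof.
have [[t ->]|[[i b] ->]] := pushout_cover po s; first exact: gtend_string_over.
have [[x e]|nx] := pselect (exists x, Tagged (fun i => str (S i)) b = vs x).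
  by rewrite -[existT _ _ _]/(Tagged (fun i => str (S i)) b) e -po.1; exact: gtend_string_over.
have gb z : gtend z = g (Tagged (fun i => str (S i)) b) ->
    exists2 jy : {j : J i & 'I_((d i j).2.*2)},
    z = @mkend _ gcol c0 (Some (Tagged J (tag jy))) (tagged jy) &
    tend (S i) (@mkend _ (d i) (c i) (Some (tag jy)) (tagged jy)) = b.
  case: z => [[[i' j]|] y] /=; last first.
    by move/esym/gf => [x e _]; case: nx; exists x.
  move=> e; have {}e := g_inner e (fun y e' => nx (ex_intro _ y e')).
  have ii' : i' = i by have := congr1 tag e.
  case: _ / ii' b nx e => b nx /eqP; rewrite -tag_eqE /tag_eq /= eqxx /= tagged_asE => /eqP e.
  by exists (Tagged (fun j => 'I_((d i' j).2.*2)) y).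
have [nb|[[d1 p] [[d2 q] [sp sq pq]]]] := tg_string b.
  by left=> z /gb[jy _]; exact: nb.
have nout x : tend (S i) (@mkend _ (d i) (c i) None x) <> b.
  by move=> e; apply: nx; exists (Tagged (fun i => 'I_((c i).2.*2)) x); rewrite /vs /= e.
case: d1 p sp pq => [j|] p sp pq; last by case: (nout p); apply/pq; left.
case: d2 q sq pq => [j'|] q sq pq; last by case: (nout q); apply/pq; right.
right; exists (@mkend _ gcol c0 (Some (Tagged J j)) p).
exists (@mkend _ gcol c0 (Some (Tagged J j')) q); split=> // z; split.
  case/gb=> [[j1 y]] -> /= /pq[] /eqP; rewrite -tag_eqE /tag_eq /= => /andP[/eqP[jj']];
    case: _ / jj' p q sp sq pq; move=> p q sp sq pq; rewrite tagged_asE => /eqP ->; auto.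
case=> -> /=; congr g; congr Tagged; apply/pq; auto.
Qed.

Let grin (i : I) (r : reg (S i)) : R := gr (Tagged (fun i => reg (S i)) r).

Lemma po_ends i x : f (tend T (@mkend I c c0 (Some i) x)) =
  g (inner i (@mkend _ (d i) (c i) None x)).
Proof. exact: po.1 (Tagged (fun i => 'I_((c i).2.*2)) x). Qed.

Lemma po_gaps i x : fr (tgap T (@mkgap I c c0 (Some i) x)) =
  grin (tgap (S i) (@mkgap _ (d i) (c i) None x)).
Proof. exact: por.1 (Tagged (fun i => 'I_((c i).2.*2).+1) x). Qed.

Lemma glued_sides b : exists w : Q -> R, (forall t, w (f t) = fr (tside T t b)) /\
  forall i s, w (g (Tagged (fun i => str (S i)) s)) = grin (tside (S i) s b).
Proof.
have [|w [wf wg _]] := po.2 R (fun t => fr (tside T t b))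
    (fun s => grin (tside (S (tag s)) (tagged s) b)); last by exists w.
case=> i x; rewrite /us /vs /= -!tg_side /side_gap /=.
by case: (_ == b); rewrite -po_gaps.
Qed.

Lemma glued_shades : exists w : R -> bool, (forall r, w (fr r) = tshade r) /\
  forall i r, w (@grin i r) = tshade r.
Proof.
have [|w [wf wg _]] := por.2 bool (@tshade _ _ _ T)
    (fun r => tshade (tagged r)).
  by case=> i x; rewrite /ur /vr /= !tg_shade_gap.
by exists w; split=> // i r; rewrite wg.
Qed.

(** [h] is constant on each piece, and each [S i] shares with [T] the region at the first gap of the
    glued circle. *)
Lemma glued_connected (h : R -> bool) :
  (forall t, h (fr (tside T t true)) = h (fr (tside T t false))) ->
  (forall i (s : str (S i)), h (grin (tside (S i) s true)) = h (grin (tside (S i) s false))) ->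
  forall r r', h r = h r'.
Proof.
move=> hT hS; set r0 := fr (tgap T (first_gap c c0 None)).
have fr0 r : h (fr r) = h r0 by exact: (tg_connected (h := fun r => h (fr r))).
have gr0 i r : h (@grin i r) = h r0.
  rewrite (tg_connected (h := fun r => h (@grin i r)) (hS i) r
    (tgap (S i) (first_gap (d i) (c i) None))).
  by rewrite -po_gaps fr0.
suff H r : h r = h r0 by move=> r r'; rewrite !H.
by have [[a ->]|[[i b] ->]] := pushout_cover por r; [exact: fr0|exact: gr0].
Qed.

(** By [sum_outputs], evenness on the remaining discs gives evenness on the glued circles, so each
    piece has its own two-colouring of regions. Around circle [i] the colourings of [T] and [S i]
    change at the same points, hence differ by a constant [e i]. Shifting the inner colouring by
    [e i] makes the two agree, and the region pushout glues them. *)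
Lemma glued_jordan (F : Q -> bool) :
  (forall dd, \big[addb/false]_(x < (dcol gcol c0 dd).2.*2) F (gtend (mkend x)) = false) ->
  exists h : R -> bool,
    (forall t, F (f t) = h (fr (tside T t true)) (+) h (fr (tside T t false))) /\
    (forall i (s : str (S i)), F (g (Tagged (fun i => str (S i)) s)) =
      h (grin (tside (S i) s true)) (+) h (grin (tside (S i) s false))).
Proof.
move=> F0.
have Fin i (j : J i) : \big[addb/false]_(x < (d i j).2.*2)
    F (g (inner i (@mkend _ (d i) (c i) (Some j) x))) = false.
  exact: (F0 (Some (Tagged J j))).
have Fout i : \big[addb/false]_(x < (c i).2.*2)
    F (g (inner i (@mkend _ (d i) (c i) None x))) = false.
  apply: (@sum_outputs _ _ _ (S i) (fun s => F (g (Tagged (fun i => str (S i)) s)))) => j.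
  exact: Fin.
have FT dd : \big[addb/false]_(x < (dcol c c0 dd).2.*2) F (f (tend T (mkend x))) = false.
  case: dd => [i|]; last exact: (F0 None).
  by rewrite -[RHS](Fout i); apply: eq_bigr => x _; rewrite po_ends.
have [hT hTE] := @tg_jordan _ _ _ T (fun s => F (f s)) FT.
have [hS hSE] : {hS : forall i, reg (S i) -> bool | forall i s,
    F (g (Tagged (fun i => str (S i)) s)) =
      hS i (tside (S i) s true) (+) hS i (tside (S i) s false)}.
  have H i : exists hS : reg (S i) -> bool, forall s,
      F (g (Tagged (fun i => str (S i)) s)) =
        hS (tside (S i) s true) (+) hS (tside (S i) s false).
    apply: (@tg_jordan _ _ _ (S i) (fun s => F (g (Tagged (fun i => str (S i)) s)))).
    by case=> [j|]; [exact: Fin|exact: Fout].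
  by exists (fun i => projT1 (cid (H i))) => i; exact: (projT2 (cid (H i))).
have crossT := cross_string hTE; have crossS i := cross_string (hSE i).
pose e i := hT (tgap T (first_gap c c0 (Some i))) (+) hS i (tgap (S i) (first_gap (d i) (c i) None)).
have he i x : hT (tgap T (@mkgap I c c0 (Some i) x)) =
    hS i (tgap (S i) (@mkgap _ (d i) (c i) None x)) (+) e i.
  case: x => x; elim: x => [|x IHx] xl.
    rewrite /e /first_gap (_ : Ordinal xl = ord0); last exact: val_inj.
    by rewrite addbC addbK.
  have xl' : x < (c i).2.*2 by [].
  have := crossT (@mkend I c c0 (Some i) (Ordinal xl')).
  have := crossS i (@mkend _ (d i) (c i) None (Ordinal xl')).
  rewrite po_ends => ->.
  have -> : before (@mkend I c c0 (Some i) (Ordinal xl')) = @mkgap I c c0 (Some i) (Ordinal (ltnW xl)).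
    by congr Tagged; exact: val_inj.
  have -> : after (@mkend I c c0 (Some i) (Ordinal xl')) = @mkgap I c c0 (Some i) (Ordinal xl).
    by congr Tagged; exact: val_inj.
  have -> : before (@mkend _ (d i) (c i) None (Ordinal xl')) = @mkgap _ (d i) (c i) None (Ordinal (ltnW xl)).
    by congr Tagged; exact: val_inj.
  have -> : after (@mkend _ (d i) (c i) None (Ordinal xl')) = @mkgap _ (d i) (c i) None (Ordinal xl).
    by congr Tagged; exact: val_inj.
  rewrite IHx; move: (hS i _) => u1; move: (hS i _) => u2; move: (hT _) (e i) => u3 u4.
  by case: u1; case: u2; case: u3; case: u4.
have [|h [hf hg _]] := por.2 bool hT (fun r => hS (tag r) (tagged r) (+) e (tag r)).
  by case=> i x; rewrite /ur /vr /= he.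
exists h; split=> [t|i s]; first by rewrite !hf hTE.
by rewrite !hg /= hSE; case: (hS i _); case: (hS i _); case: (e i).
Qed.

End Glued.

Lemma gluing_exists : exists U : tangle gcol c0, is_gluing T S U.
Proof.
have [Q [f [g [po f_inj gf gg]]]] := pushout_inj_exists us vs_inj.
have [R [fr [gr por]]] := pushout_exists ur vr.
have [wT [wTf wTg]] := glued_sides po por true.
have [wF [wFf wFg]] := glued_sides po por false.
have [sh [shf shg]] := glued_shades por.
pose side (s : Q) (b : bool) := if b then wT s else wF s.
have sidef t b : side (f t) b = fr (tside T t b) by case: b => /=.
have sideg i s b : side (g (Tagged (fun i => str (S i)) s)) b =
  gr (Tagged (fun i => reg (S i)) (tside (S i) s b)) by case: b => /=.
have ax1 := gtend_string po f_inj gf gg.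
have ax2 dd : gtgap fr gr (first_gap gcol c0 dd) = gtgap fr gr (last_gap gcol c0 dd).
  case: dd => [[i j]|] /=; last by congr fr; exact: tg_wrap.
  by congr gr; congr Tagged; exact: tg_wrap.
have ax3 p b : gtgap fr gr (side_gap p b) = side (gtend f g p) b.
  case: p => [[[i j]|] x] /=; rewrite ?sidef ?sideg -tg_side /side_gap /=;
    by case: (_ == b).
have ax4 x : sh (gtgap fr gr x) = shade gcol c0 (tag x) (tagged x).
  by case: x => [[[i j]|] x] /=; rewrite ?shf ?shg tg_shade_gap.
have ax5 s b : sh (side s b) = b.
  by have [[t ->]|[[i t] ->]] := pushout_cover po s;
    [rewrite sidef shf tg_shade_side|rewrite (sideg i t) shg tg_shade_side].
have ax6 (h : R -> bool) : (forall s, h (side s true) = h (side s false)) ->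
    forall r r', h r = h r'.
  move=> hs; apply: (glued_connected por) => [t|i s]; first by rewrite -!sidef.
  by rewrite -!sideg.
have ax7 (F : Q -> bool) : (forall dd,
    \big[addb/false]_(x < (dcol gcol c0 dd).2.*2) F (gtend f g (mkend x)) = false) ->
    exists h : R -> bool, forall s, F s = h (side s true) (+) h (side s false).
  case/(glued_jordan po por) => h [hf hg]; exists h => s.
  by have [[t ->]|[[i t] ->]] := pushout_cover po s; [rewrite !sidef hf|rewrite !(sideg i t) hg].
exists (@Tangle _ gcol c0 Q R (gtend f g) (gtgap fr gr) side sh ax1 ax2 ax3 ax4 ax5 ax6 ax7).
by exists f, g, fr, gr; split.
Qed.

End GluingExists.

(** * Recognizing isotopic tangles *)

Section Touching.
Variables (I : finType) (c : I -> color) (c0 : color).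

(** Under this condition the strings and the regions are quotients of the endpoints and of the gaps,
    so an isotopy can be found by comparing two equivalence relations on boundary data. *)
Definition touching (T : tangle c c0) : Prop :=
  (forall s, exists p, tend T p = s) /\ (forall r, exists g, tgap T g = r).

Lemma pairing_touching mate corners (pp : @planar_pairing I c c0 mate corners) :
  touching (pairing_tangle pp).
Proof.
split=> [s|r]; last by exists (val r); exact: pgap_val.
by exists (val s); apply: val_inj => /=; rewrite (valP s).
Qed.

Lemma gap_telescope (H : gap c c0 -> bool) d :
  \big[addb/false]_(x < (dcol c c0 d).2.*2)
    (H (before (@mkend I c c0 d x)) (+) H (after (@mkend I c c0 d x))) =
  H (first_gap c c0 d) (+) H (last_gap c c0 d).
Proof.
pose phi x := H (gap_at c c0 d x).
have -> : H (first_gap c c0 d) = phi 0 by congr H; exact: gap_at_pos.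
have -> : H (last_gap c c0 d) = phi (dcol c c0 d).2.*2 by congr H; exact: gap_at_pos.
rewrite (eq_bigr (fun x : 'I__ => phi x (+) phi x.+1)); last first.
  by move=> x _; congr (H _ (+) H _); exact: gap_at_pos.
elim: (_.2.*2) => [|n IHn]; first by rewrite big_ord0 addbb.
by rewrite big_ord_recr /= IHn addbA addbK.
Qed.

(** The Jordan property of [W] gives a colouring [h] of its regions that changes at the same
    endpoints as [H]. The sum of [H] and [h] is then constant along each disc, and constant across
    discs because both are preserved by [K] and [K] connects the discs. So [H], like [h], depends
    only on the region. Wrapping of [H] around each disc supplies the evenness that the Jordan
    property asks for. *)
Lemma jordan_transfer (W : tangle c c0) (K : gap c c0 -> gap c c0 -> Prop)
    (H : gap c c0 -> bool) (F : str W -> bool) :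
  (forall d, H (first_gap c c0 d) = H (last_gap c c0 d)) ->
  (forall p, F (tend W p) = H (before p) (+) H (after p)) ->
  (forall D : option I -> bool, (forall x y, K x y -> D (tag x) = D (tag y)) ->
    forall d d', D d = D d') ->
  (forall x y, K x y -> tgap W x = tgap W y /\ H x = H y) ->
  forall x y, tgap W x = tgap W y -> H x = H y.
Proof.
move=> Hwrap HF Kconn KH.
have [d|h hE] := @tg_jordan _ _ _ W F.
  rewrite (eq_bigr _ (fun x _ => HF (mkend x))) gap_telescope Hwrap; exact: addbb.
have hc := cross_string hE.
pose D g := H g (+) h (tgap W g).
have Dba p : D (before p) = D (after p).
  have := HF p; rewrite hc /D.
  by case: (H _); case: (H _); case: (h _); case: (h _).
have Dc := gap_const Dba.
have Dxy x y : D x = D y.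
  rewrite (Dc x) (Dc y); apply: (Kconn (fun d => D (first_gap c c0 d))) => z w zw.
  by rewrite -(Dc z) -(Dc w) /D; have [-> ->] := KH _ _ zw.
by move=> x y xy; have := Dxy x y; rewrite /D xy => /addIb.
Qed.

(** The indicator of one region is a colouring whose jumps are read off the strings; these are the
    colourings fed to [jordan_transfer]. *)
Lemma cross_reg (W : tangle c c0) (r : reg W) p :
  (tside W (tend W p) true == r) (+) (tside W (tend W p) false == r) =
  (tgap W (before p) == r) (+) (tgap W (after p) == r).
Proof.
by rewrite -(cross_string (f := fun s => (tside W s true == r) (+) (tside W s false == r))
  (h := fun r' => r' == r)).
Qed.

End Touching.

Lemma same_kernel_bij (A S S' : Type) (al : A -> S) (be : A -> S') :
  (forall s, exists a, al a = s) -> (forall s, exists a, be a = s) ->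
  (forall a a', al a = al a' <-> be a = be a') ->
  exists2 phi : S -> S', bijective phi & forall a, phi (al a) = be a.
Proof.
move=> /choice[al' al'K] /choice[be' be'K] H.
have E a : be (al' (al a)) = be a by apply/H.
have E' a : al (be' (be a)) = al a by apply/H.
exists (fun s => be (al' s)) => //; exists (fun s => al (be' s)) => s.
  by rewrite E' al'K.
by rewrite E be'K.
Qed.

Section Isotopic.
Variables (I I' : finType) (h : I' -> I) (c : I -> color) (c0 : color).
Hypothesis h_bij : bijective h.
Local Notation c' := (fun i => c (h i)).

Definition emap (p : endpt c' c0) : endpt c c0 :=
  match p with
  | existT (Some i) x => @mkend I c c0 (Some (h i)) x
  | existT None x => @mkend I c c0 None x
  end.

Definition gmap (g : gap c' c0) : gap c c0 :=
  match g with
  | existT (Some i) x => @mkgap I c c0 (Some (h i)) x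
  | existT None x => @mkgap I c c0 None x
  end.

Lemma emap_surj p : exists p', emap p' = p.
Proof.
have [h' hK h'K] := h_bij.
case: p => [[i|] x]; last by exists (@mkend I' c' c0 None x).
move: x; rewrite -(h'K i) => x; by exists (@mkend I' c' c0 (Some (h' i)) x).
Qed.

Lemma gmap_surj g : exists g', gmap g' = g.
Proof.
have [h' hK h'K] := h_bij.
case: g => [[i|] x]; last by exists (@mkgap I' c' c0 None x).
move: x; rewrite -(h'K i) => x; by exists (@mkgap I' c' c0 (Some (h' i)) x).
Qed.

Lemma gmap_inj : injective gmap.
Proof.
case=> [[i|] x] [[i'|] x'] // /eqP; rewrite -tag_eqE /tag_eq /=.
  case/andP=> /eqP[/(bij_inj h_bij) e]; case: _ / e x' => x'.
  by rewrite tagged_asE => /eqP ->.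
by rewrite tagged_asE => /eqP ->.
Qed.

Lemma gmap_before p : gmap (before p) = before (emap p).
Proof. by case: p => -[]. Qed.

Lemma gmap_after p : gmap (after p) = after (emap p).
Proof. by case: p => -[]. Qed.

Lemma gmap_first d : gmap (first_gap c' c0 d) = first_gap c c0 (omap h d).
Proof. by case: d. Qed.

Lemma gmap_last d : gmap (last_gap c' c0 d) = last_gap c c0 (omap h d).
Proof. by case: d. Qed.

Lemma gmap_side p b : gmap (side_gap p b) = side_gap (emap p) b.
Proof. by case: p => -[i|] x; rewrite /side_gap /=; case: (_ == b). Qed.

Lemma omap_surj d : exists d', omap h d' = d.
Proof.
have [h' hK h'K] := h_bij.
by case: d => [i|]; [exists (Some (h' i)); rewrite /= h'K|exists None].
Qed.

(* By the Jordan curve property, applied to each tangle in turn, the strings and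
   enough coincidences of regions determine which gaps share a region. *)
Lemma isotopic_pairing (T : tangle c c0) (T' : tangle c' c0)
    (K : gap c' c0 -> gap c' c0 -> Prop) :
  touching T -> touching T' ->
  (forall p q, tend T (emap p) = tend T (emap q) <-> tend T' p = tend T' q) ->
  (forall D : option I' -> bool, (forall x y, K x y -> D (tag x) = D (tag y)) ->
    forall d d', D d = D d') ->
  (forall x y, K x y -> tgap T (gmap x) = tgap T (gmap y)) ->
  (forall x y, K x y -> tgap T' x = tgap T' y) ->
  isotopic T T'.
Proof.
move=> [Ts Tr] [Ts' Tr'] ends Kconn KT KT'.
have [s|f f_bij fE] := same_kernel_bij (al := fun p => tend T (emap p))
    (be := tend T') _ Ts' ends.
  by have [p <-] := Ts s; have [p' <-] := emap_surj p; exists p'.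
have [f' fK f'K] := f_bij.
have gaps x y : tgap T (gmap x) = tgap T (gmap y) <-> tgap T' x = tgap T' y.
  split=> xy; apply/eqP.
    (* The indicator of the region of [y] in [T'], carried to the gaps of [T]; the existential
       stands for the inverse of [gmap]. *)
    pose H g := [exists z, (gmap z == g) && (tgap T' z == tgap T' y)].
    have HE z : H (gmap z) = (tgap T' z == tgap T' y).
      apply/existsP/idP => [[w /andP[/eqP/gmap_inj ->]] //|e].
      by exists z; rewrite eqxx.
    rewrite -HE (@jordan_transfer _ _ _ T (fun x y => exists2 u, x = gmap u &
      exists2 v, y = gmap v & K u v) H (fun s => (tside T' (f s) true == tgap T' y)
        (+) (tside T' (f s) false == tgap T' y)) _ _ _ _ _ (gmap y)) ?HE ?eqxx //.
    - by move=> d; have [d' <-] := omap_surj d; rewrite -gmap_first -gmap_last !HE tg_wrap.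
    - move=> p; have [p' <-] := emap_surj p.
      by rewrite fE cross_reg -gmap_before -gmap_after !HE.
    - move=> D Dc d d1; have [d' <-] := omap_surj d; have [d1' <-] := omap_surj d1.
      apply: (Kconn (fun d => D (omap h d))) => z w zw.
      have := Dc (gmap z) (gmap w); case: z zw => -[z|] xz; case: w => -[w|] xw zw;
        apply; do 2 eexists; eauto.
    by move=> _ _ [u -> [v -> uv]]; rewrite !HE (KT' _ _ uv); split=> //; apply: KT.
  have := @jordan_transfer _ _ _ T' K (fun z => tgap T (gmap z) == tgap T (gmap y))
    (fun s => (tside T (f' s) true == tgap T (gmap y)) (+) (tside T (f' s) false == tgap T (gmap y))).
  move=> jt; apply: etrans (jt _ _ _ _ x y xy) _; rewrite ?eqxx //.
  - by move=> d; rewrite gmap_first gmap_last tg_wrap.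
  - by move=> p; rewrite -fE fK cross_reg -gmap_before -gmap_after.
  by move=> u v uv; rewrite (KT _ _ uv); split=> //; apply: KT'.
have [r|g g_bij gE] := same_kernel_bij (al := fun x => tgap T (gmap x))
    (be := tgap T') _ Tr' gaps.
  by have [x <-] := Tr r; have [x' <-] := gmap_surj x; exists x'.
exists f, g; split=> //.
- by split=> i x; rewrite -?fE -?gE.
- by split=> x; rewrite -?fE -?gE.
move=> s b; have [p <-] := Ts s; have [p' <-] := emap_surj p.
by rewrite fE -!tg_side -gmap_side gE.
Qed.

End Isotopic.

Section PositionStrings.
Variables (I : finType) (c : I -> color) (c0 : color).

(* Options dispense with proofs that positions are in range. *)
Definition sat (T : tangle c c0) (d : option I) (x : nat) : option (str T) :=
  omap (fun y => tend T (@mkend I c c0 d y)) (insub x).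
Definition gat (T : tangle c c0) (d : option I) (x : nat) : option (reg T) :=
  omap (fun y => tgap T (@mkgap I c c0 d y)) (insub x).

Lemma satE T (p : endpt c c0) : sat T (tag p) (tagged p : nat) = Some (tend T p).
Proof. by case: p => d x; rewrite /sat valK. Qed.

Lemma gatE T (g : gap c c0) : gat T (tag g) (tagged g : nat) = Some (tgap T g).
Proof. by case: g => d x; rewrite /gat valK. Qed.

Lemma sat_mate f corners (pp : planar_pairing (mate_of (c := c) (c0 := c0) f) corners)
    d x d' x' : f (d, x) = (d', x') ->
  x < (dcol c c0 d).2.*2 -> x' < (dcol c c0 d').2.*2 ->
  sat (pairing_tangle pp) d x = sat (pairing_tangle pp) d' x'.
Proof.
move=> fdx xd xd'.
rewrite -[x]/(tagged (@mkend I c c0 d (Ordinal xd)) : nat) -[d]/(tag (@mkend I c c0 d (Ordinal xd))).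
rewrite -[x']/(tagged (@mkend I c c0 d' (Ordinal xd')) : nat) -[d']/(tag (@mkend I c c0 d' (Ordinal xd'))).
rewrite !satE; congr Some; apply: val_inj => /=.
have -> : @mkend I c c0 d' (Ordinal xd') = mate_of f (@mkend I c c0 d (Ordinal xd)).
  by apply: end_pos_inj; rewrite end_pos_mate /end_pos /= fdx.
by rewrite (pp_source pp) (pp_mateK pp); case: source.
Qed.

Lemma sat_pairing_eq f corners (pp : planar_pairing (mate_of (c := c) (c0 := c0) f) corners)
    d x d' x' d1 x1 : f (d, x) = (d1, x1) ->
  x < (dcol c c0 d).2.*2 -> x1 < (dcol c c0 d1).2.*2 -> x' < (dcol c c0 d').2.*2 ->
  sat (pairing_tangle pp) d x = sat (pairing_tangle pp) d' x' ->
  (d', x') = (d, x) \/ (d', x') = (d1, x1).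
Proof.
move=> fdx xd xd1 xd'.
rewrite -[x]/(tagged (@mkend I c c0 d (Ordinal xd)) : nat) -[d]/(tag (@mkend I c c0 d (Ordinal xd))).
rewrite -[x']/(tagged (@mkend I c c0 d' (Ordinal xd')) : nat) -[d']/(tag (@mkend I c c0 d' (Ordinal xd'))).
rewrite !satE => -[] e.
set p := mkend _ in e *; set q := mkend _ in e *.
have pm : mate_of f p = @mkend I c c0 d1 (Ordinal xd1).
  by apply: end_pos_inj; rewrite end_pos_mate /end_pos /= fdx.
suff [->|->] : q = p \/ q = mate_of f p; first by left.
  by right; rewrite pm.
move: e; case: ifP => _; case: ifP => _ e.
- by left.
- by right; rewrite e (pp_mateK pp).
- by right.
by left; rewrite -[q](pp_mateK pp) -e (pp_mateK pp).
Qed.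

Lemma gat_first T d : gat T d 0 = Some (tgap T (first_gap c c0 d)).
Proof. by rewrite -gatE. Qed.

Lemma gat_last T d : gat T d (dcol c c0 d).2.*2 = gat T d 0.
Proof. by rewrite gat_first tg_wrap -gatE. Qed.

Lemma gat_corner mate corners (pp : @planar_pairing I c c0 mate corners) d x d' x' :
  (gap_at c c0 d x, gap_at c c0 d' x') \in corners ->
  x <= (dcol c c0 d).2.*2 -> x' <= (dcol c c0 d').2.*2 ->
  gat (pairing_tangle pp) d x = gat (pairing_tangle pp) d' x'.
Proof.
move=> xc xd xd'; have gE z w : z <= (dcol c c0 w).2.*2 ->
    gat (pairing_tangle pp) w z = Some (tgap (pairing_tangle pp) (gap_at c c0 w z)).
  by move=> zw; rewrite -gatE gap_atK.
by rewrite !gE //; congr Some; apply: pgap_touch; rewrite /touch xc.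
Qed.

End PositionStrings.

Lemma omap_insub_eq n (X Y : Type) (p : 'I_n -> X) (q : 'I_n -> Y) (f : Y -> X) x :
  (forall y, p y = f (q y)) ->
  omap p (insub x : option 'I_n) = omap f (omap q (insub x : option 'I_n)).
Proof. by move=> pq; case: insub => //= y; rewrite pq. Qed.

(** * Strings and regions of a given gluing *)

Section GluingMaps.
Variables (I : finType) (J : I -> finType) (c : I -> color) (c0 : color).
Variable d : forall i, J i -> color.
Arguments d : clear implicits.
Variables (T : tangle c c0) (S : forall i, tangle (d i) (c i)).
Local Notation gcol := (glue_color d).
Variable U : tangle gcol c0.
Variables (fT : str T -> str U) (fS : {i : I & str (S i)} -> str U).
Variables (gT : reg T -> reg U) (gS : {i : I & reg (S i)} -> reg U).
Hypothesis gm : @gluing_maps I J c c0 d T S U fT fS gT gS.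

Let inS i (s : str (S i)) := fS (Tagged (fun i => str (S i)) s).
Let inR i (r : reg (S i)) := gS (Tagged (fun i => reg (S i)) r).

Lemma glue_sat_out x : sat U None x = omap fT (sat T None x).
Proof. by apply: omap_insub_eq; exact: (glue_end_out gm). Qed.

Lemma glue_sat_in i (j : J i) x :
  sat U (Some (Tagged J j)) x = omap (@inS i) (sat (S i) (Some j) x).
Proof. by apply: omap_insub_eq => y; exact: (glue_end_in gm). Qed.

Lemma glue_sat_mid i x : omap (@inS i) (sat (S i) None x) = omap fT (sat T (Some i) x).
Proof.
rewrite /sat /=; case: insub => //= y; congr Some.
exact: (esym ((glue_str gm).1 (Tagged (fun i => 'I_((c i).2.*2)) y))).
Qed.

Lemma glue_gat_out x : gat U None x = omap gT (gat T None x).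
Proof. by apply: omap_insub_eq; exact: (glue_gap_out gm). Qed.

Lemma glue_gat_in i (j : J i) x :
  gat U (Some (Tagged J j)) x = omap (@inR i) (gat (S i) (Some j) x).
Proof. by apply: omap_insub_eq => y; exact: (glue_gap_in gm). Qed.

Lemma glue_gat_mid i x : omap (@inR i) (gat (S i) None x) = omap gT (gat T (Some i) x).
Proof.
rewrite /gat /=; case: insub => //= y; congr Some.
exact: (esym ((glue_reg gm).1 (Tagged (fun i => 'I_((c i).2.*2).+1) y))).
Qed.

Hypothesis S_nocap : forall i (x y : 'I_((c i).2.*2)),
  tend (S i) (@mkend _ (d i) (c i) None x) = tend (S i) (@mkend _ (d i) (c i) None y) ->
  x = y.
Hypothesis S_first : forall i, exists j x,
  tgap (S i) (@mkgap _ (d i) (c i) (Some j) x) = tgap (S i) (first_gap (d i) (c i) None).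
Hypothesis T_touch : touching T.
Hypothesis S_touch : forall i, touching (S i).

Lemma inner_partner i x : exists j y,
  tend (S i) (@mkend _ (d i) (c i) (Some j) y) = tend (S i) (@mkend _ (d i) (c i) None x).
Proof.
have [[[j|] y] [sy ey uy]] := string_mate (S i) (@mkend _ (d i) (c i) None x).
  by exists j, y.
by have e := S_nocap ey; move: sy; rewrite e; case: source.
Qed.

(** A gap on the outer disc other than gap 0 comes right after some point; the string there ends on
    an inner disc, and following its side leads to a gap of that disc. Gap 0 has no preceding point,
    whence [S_first]. *)
Lemma inner_gap i g : exists j x,
  tgap (S i) g = tgap (S i) (@mkgap _ (d i) (c i) (Some j) x).
Proof.
case: g => [[j|] x]; first by exists j, x.
case: x => [[|x] xl].
  have [j [y e]] := S_first i; exists j, y; rewrite e; congr tgap; congr Tagged.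
  exact: val_inj.
have xl' : x < (c i).2.*2 by [].
set p := @mkend _ (d i) (c i) None (Ordinal xl').
have -> : existT _ None (Ordinal xl) = after p by congr Tagged; exact: val_inj.
have [j [y e]] := inner_partner (Ordinal xl').
have [b ->] : exists b, after p = side_gap p b.
  by rewrite /side_gap; exists (~~ shade (d i) (c i) (tag p) (tagged p)); case: shade.
rewrite tg_side -e -tg_side /side_gap; case: ifP => _.
  by exists j, (widen_ord (leqnSn _) y).
by exists j, (lift ord0 y).
Qed.

(** The glued circles disappear in [U], so an end or gap seen only there must be traded for one on
    an inner disc, by [inner_partner] and [inner_gap]. *)
Lemma gluing_touching : touching U.
Proof.
have glS i (s : str (S i)) : exists p, tend U p = inS s.
  have [[[j|] y] <-] := (S_touch i).1 s; last have [j [z <-]] := inner_partner y.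
    by exists (@mkend _ gcol c0 (Some (Tagged J j)) y); rewrite (glue_end_in gm).
  by exists (@mkend _ gcol c0 (Some (Tagged J j)) z); rewrite (glue_end_in gm).
have glR i (r : reg (S i)) : exists g, tgap U g = inR r.
  have [g <-] := (S_touch i).2 r; have [j [x ->]] := inner_gap g.
  by exists (@mkgap _ gcol c0 (Some (Tagged J j)) x); rewrite (glue_gap_in gm).
split=> [s|r].
  have [[t ->]|[[i t] ->]] := pushout_cover (glue_str gm) s; last exact: glS.
  have [[[i|] y] <-] := T_touch.1 t; last first.
    by exists (@mkend _ gcol c0 None y); rewrite (glue_end_out gm).
  rewrite [fT _]((glue_str gm).1 (Tagged (fun i => 'I_((c i).2.*2)) y)); exact: glS.
have [[t ->]|[[i t] ->]] := pushout_cover (glue_reg gm) r; last exact: glR.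
have [[[i|] y] <-] := T_touch.2 t; last first.
  by exists (@mkgap _ gcol c0 None y); rewrite (glue_gap_out gm).
rewrite [gT _]((glue_reg gm).1 (Tagged (fun i => 'I_((c i).2.*2).+1) y)); exact: glR.
Qed.

End GluingMaps.

(** * Epi Temperley-Lieb diagrams *)

Definition increasing_on (A : nat) (u : nat -> nat) : Prop :=
  forall t t', t < t' -> t' < A -> u t < u t'.

(** Strictly sorted lists with the same members are equal. This identifies the feet of a diagram, in
    order, once they are known as a set. *)
Lemma enumeration_unique (A B : nat) (u v : nat -> nat) :
  increasing_on A u -> increasing_on B v ->
  (forall x, (exists2 t, t < A & u t = x) <-> (exists2 t, t < B & v t = x)) ->
  A = B /\ forall t, t < A -> u t = v t.
Proof.
have inc C w : increasing_on C w -> sorted ltn (map w (iota 0 C)).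
  move=> wI; apply/(sortedP 0) => t; rewrite size_map size_iota => tC.
  by rewrite !(nth_map 0) ?size_iota ?nth_iota //; [exact: wI | lia | lia].
have mem C w x : (x \in map w (iota 0 C)) <-> exists2 t, t < C & w t = x.
  split=> [/mapP[t] | [t tC <-]].
    by rewrite mem_iota => tC ->; exists t.
  by apply/mapP; exists t; rewrite // mem_iota.
move=> uI vI uv.
have e : map u (iota 0 A) = map v (iota 0 B).
  apply: (irr_sorted_eq ltn_trans ltnn (inc _ _ uI) (inc _ _ vI)) => x.
  by apply/idP/idP => /mem/uv/mem.
have AB : A = B by have := congr1 size e; rewrite !size_map !size_iota.
split=> // t tA; have := congr1 (fun s => nth 0 s t) e.
by rewrite !(nth_map 0) ?size_iota ?nth_iota //; lia.
Qed.

Lemma filter_enumeration (P : pred nat) L : let w := nth 0 [seq x <- iota 0 L | P x] in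
  let A := count P (iota 0 L) in
  [/\ increasing_on A w, forall t, t < A -> (w t < L) && P (w t) &
      forall x, x < L -> P x -> exists2 t, t < A & w t = x].
Proof.
set F := filter _ _ => w A; have FA : size F = A by rewrite size_filter.
have mF x : (x \in F) = (x < L) && P x by rewrite mem_filter mem_iota andbC.
split.
- move=> t t' tt' t'A; apply: (sorted_ltn_nth ltn_trans); rewrite ?inE ?FA //.
    by apply: sorted_filter; [exact: ltn_trans | exact: iota_ltn_sorted].
  exact: ltn_trans t'A.
- by move=> t tA; rewrite -mF mem_nth ?FA.
move=> x xL Px; exists (index x F); first by rewrite -FA index_mem mF xL.
by apply: nth_index; rewrite mF xL.
Qed.

Lemma threshold (P : pred nat) L : (forall t t', t < t' -> t' < L -> P t' -> P t) ->
  exists2 q, q <= L & forall t, t < L -> P t = (t < q).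
Proof.
elim: L => [|L IHL] H; first by exists 0.
have [|q qL qP] := IHL; first by move=> t t' tt' t'L; apply: H => //; lia.
have [PL|nPL] := boolP (P L).
  exists L.+1 => // t; rewrite ltnS leq_eqVlt => /orP[/eqP -> | tL]; first by rewrite PL; lia.
  by rewrite (H _ _ tL) //; lia.
exists q; first lia.
move=> t; rewrite ltnS leq_eqVlt => /orP[/eqP -> | tL]; last by rewrite qP.
by rewrite (negbTE nPL); lia.
Qed.

Section EpiDiagrams.
Variables (i j : nat).
Local Notation N := (i.*2 + j.*2).

(* The bottom point joined to the t-th top point from the left; Temperley-Lieb
   diagrams number their top points from the right. *)
Definition foot (D : TL i j) (t : nat) : nat := TL_mate D (N.-1 - t).

Lemma epi_mate (D : TL i j) x : epi D -> i.*2 <= x -> x < N -> TL_mate D x < i.*2.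
Proof.
move=> /forallP eD ix xN; have := eD (Ordinal xN).
by rewrite -TL_mateE /= => /implyP; apply.
Qed.

Variables (D : TL i j) (eD : epi D).
Local Notation s := (TL_mate D).

Lemma foot_lt t : t < j.*2 -> foot D t < i.*2.
Proof. by move=> tj; apply: epi_mate => //; lia. Qed.

Lemma mate_foot t : t < j.*2 -> s (foot D t) = N.-1 - t.
Proof. by move=> tj; rewrite /foot; case: (@TL_mateP _ _ D (N.-1 - t)) => //; lia. Qed.

Lemma foot_mate x : x < i.*2 -> i.*2 <= s x -> exists2 t, t < j.*2 & foot D t = x.
Proof.
move=> xi ix; have xN : x < N by lia.
have [sN _ ssx] := TL_mateP D xN; exists (N.-1 - s x); first lia.
by rewrite /foot (_ : N.-1 - (N.-1 - s x) = s x) //; lia.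
Qed.

Lemma mate_or_foot x : x < i.*2 -> s x < i.*2 \/ exists2 t, t < j.*2 & foot D t = x.
Proof.
move=> xi; have [|ge] := ltnP (s x) i.*2; first by left.
by right; exact: foot_mate.
Qed.

(** Top points further to the right have smaller positions around the rectangle, so two feet in the
    wrong order would give crossing strings. *)
Lemma foot_increasing : increasing_on j.*2 (foot D).
Proof.
move=> t t' tt' t'j; have tj := ltn_trans tt' t'j.
have := foot_lt tj; have := foot_lt t'j; have := mate_foot tj; have := mate_foot t'j.
move=> e' e lt' lt; rewrite ltnNge; apply/negP => le.
have ne : foot D t <> foot D t' by move=> E; move: e; rewrite E e'; lia.
by apply: (@TL_noncrossing _ _ D (foot D t') (foot D t)); rewrite ?e ?e'; lia.
Qed.

Lemma foot_uncovered x t : t < j.*2 -> x < foot D t -> foot D t < s x -> s x < i.*2 -> False.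
Proof.
move=> tj xf fs si; have fl := foot_lt tj; have e := mate_foot tj.
by have := @TL_between _ _ D x (foot D t); rewrite e; lia.
Qed.

Lemma mate_in x : x < i.*2 -> s x < i.*2 -> [/\ s x <> x, s (s x) = x & s (s x) < i.*2].
Proof.
move=> xi si; have xN : x < N by lia.
by have [sN sx ssx] := TL_mateP D xN; rewrite ssx.
Qed.

End EpiDiagrams.

Lemma TL_eq i j (D D' : TL i j) : epi D -> epi D' ->
  (forall x, x < i.*2 -> TL_mate D x = TL_mate D' x) -> D = D'.
Proof.
move=> eD eD' DD'; apply/val_inj/ffunP => x; apply: ord_inj; rewrite -!TL_mateE.
have [xi|ix] := ltnP x i.*2; first exact: DD'.
have sx := epi_mate eD ix (ltn_ord x).
have [_ _ e] := TL_mateP D (ltn_ord x); have := DD' _ sx; rewrite e => {2}->.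
have sN : TL_mate D x < i.*2 + j.*2 by lia.
by have [_ _ ->] := TL_mateP D' sN.
Qed.

(** The bottom arcs determine an epi diagram: the bottom points left over are the feet, and they
    meet the top points in order. Their number gives [j], which is why the conclusion is an equality
    of dependent pairs. *)
Lemma epi_bottom_eq m j j' (D : TL m j) (D' : TL m j') : epi D -> epi D' ->
  (forall x, x < m.*2 -> (TL_mate D x < m.*2) = (TL_mate D' x < m.*2)) ->
  (forall x, x < m.*2 -> TL_mate D x < m.*2 -> TL_mate D x = TL_mate D' x) ->
  Tagged (TL m) D = Tagged (TL m) D'.
Proof.
move=> eD eD' lt eq.
have [|e E] := enumeration_unique (foot_increasing eD) (foot_increasing eD').
  move=> x; split=> -[t tj <-].
    have fl := foot_lt eD tj; have := lt _ fl; rewrite (mate_foot eD tj) => H.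
    by apply: foot_mate => //; lia.
  have fl := foot_lt eD' tj; have := lt _ fl; rewrite (mate_foot eD' tj) => H.
  by apply: foot_mate => //; lia.
have jj' : j = j' by lia.
case: _ / jj' D' eD' lt eq e E => D' eD' lt eq _ E; congr Tagged.
apply: TL_eq => // x xm; have [sm|[t tj <-]] := mate_or_foot eD xm; first exact: eq.
by rewrite (mate_foot eD tj) E // (mate_foot eD' tj).
Qed.

Lemma make_TL i j (s : nat -> nat) : let N := i.*2 + j.*2 in
  (forall x, x < N -> [/\ s x < N, s x <> x & s (s x) = x]) ->
  (forall x y, x < y -> y < s x -> s x < s y -> s y < N -> False) ->
  exists D : TL i j, forall x, x < N -> TL_mate D x = s x.
Proof.
move=> N sP nc.
pose f : {ffun 'I_N -> 'I_N} := [ffun x : 'I_N => insubd x (s x)].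
have fE (x : 'I_N) : f x = s x :> nat.
  by rewrite ffunE val_insubd; case: (sP _ (ltn_ord x)) => ->.
have fm : planar_matching f.
  apply/andP; split.
    apply/forallP => x; have [_ sx ssx] := sP _ (ltn_ord x).
    by rewrite -!val_eqE /= !fE ssx eqxx andbT; apply/eqP.
  apply/forallP => x; apply/forallP => y; apply/negP => /and3P[xy yx xy'].
  by apply: (nc x y) => //; rewrite -?fE.
exists (exist (fun f => is_true (planar_matching f)) f fm) => x xN.
by rewrite (TL_mateE _ (Ordinal xN)) /= fE.
Qed.

(** The points that an involution moves come in pairs. It provides the even number of top points
    that a diagram in [TL m j] must have. *)
Lemma even_nonfixed (f : nat -> nat) n :
  (forall x, x < n -> f x < n /\ f (f x) = x) ->
  odd (count (fun x => f x == x) (iota 0 n)) = odd n.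
Proof.
move=> fP; pose fo (x : 'I_n) : 'I_n := Ordinal (fP x (ltn_ord x)).1.
have foK : involutive fo by move=> x; apply: val_inj => /=; case: (fP x (ltn_ord x)).
have -> : odd n = odd (\sum_(x < n) 1) by rewrite sum1_card card_ord.
have -> : count (fun x => f x == x) (iota 0 n) = \sum_(x < n | f x == x) 1.
  rewrite -(big_mkord (fun x => f x == x) (fun=> 1)) sum1_count.
  by rewrite /index_iota subn0.
rewrite (bigID (fun x : 'I_n => f x == x) xpredT) /= oddD.
rewrite [X in _ = _ (+) odd X](bigID (fun x : 'I_n => x < f x)) /= oddD.
suff -> : \sum_(x < n | (f x != x) && ~~ (x < f x)) 1 =
          \sum_(x < n | (f x != x) && (x < f x)) 1 by rewrite [X in _ (+) X]addbb addbF.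
rewrite (reindex_inj (inv_inj foK)) /=; apply: eq_bigl => x.
by have [fx ->] := fP x (ltn_ord x); lia.
Qed.

(* The fixed points of f are the points to be joined to the top. *)
Lemma epi_exists m (f : nat -> nat) :
  (forall x, x < m.*2 -> f x < m.*2 /\ f (f x) = x) ->
  (forall x y, x < y -> y < f x -> f x < m.*2 -> f y <> y /\ x < f y < f x) ->
  exists j (D : TL m j), epi D /\ forall x, x < m.*2 ->
    (f x = x -> m.*2 <= TL_mate D x) /\ (f x <> x -> TL_mate D x = f x).
Proof.
move=> fP nc; have ev := even_nonfixed fP.
have [wI wP Pw] := filter_enumeration (fun x => f x == x) m.*2.
set F := filter _ _ in wI wP Pw; set L := count _ _ in ev wI wP Pw; set w := nth 0 F in wI wP Pw.
pose j := L./2; have Lj : L = j.*2 by lia.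
rewrite Lj in wI wP Pw.
pose N := m.*2 + j.*2.
(* The fixed point number [t] from the left goes to the top point number [t] from the left, which
   sits at position [N.-1 - t]. *)
pose s x := if x < m.*2 then if f x == x then N.-1 - index x F else f x else w (N.-1 - x).
have FL : size F = j.*2 by rewrite size_filter -/L Lj.
have Fu : uniq F by rewrite filter_uniq // iota_uniq.
have iw t : t < j.*2 -> index (w t) F = t by move=> tj; rewrite index_uniq ?FL.
have sw t : t < j.*2 -> s (w t) = N.-1 - t.
  by move=> tj; have /andP[wl wf] := wP _ tj; rewrite /s wl wf iw.
have sf x : x < m.*2 -> f x <> x -> s x = f x.
  by move=> xm /eqP/negbTE fx; rewrite /s xm fx.
have st t : t < j.*2 -> s (N.-1 - t) = w t.
  move=> tj; rewrite /s ifF; last by rewrite /N; lia.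
  by congr w; rewrite /N; lia.
have cases x : x < N -> [\/ x < m.*2 /\ f x <> x, exists2 t, t < j.*2 & x = w t |
    exists2 t, t < j.*2 & x = N.-1 - t].
  move=> xN; have [xm|mx] := ltnP x m.*2; last first.
    by apply: Or33; exists (N.-1 - x); lia.
  have [/eqP fx|fx] := eqVneq (f x) x; last by apply: Or31; split=> //; apply/eqP.
  by have [t tj <-] := Pw _ xm fx; apply: Or32; exists t.
have [||D DE] := @make_TL m j s.
- move=> x /cases[[xm fx]|[t tj ->]|[t tj ->]].
  + rewrite sf //; have [fl ffx] := fP _ xm; rewrite sf ?ffx //; last by move=> e; exact: fx (esym e).
    by split=> //; lia.
  + by rewrite sw // st //; have /andP[wl _] := wP _ tj; rewrite /N; split=> //; lia.
  by rewrite st // sw //; have /andP[wl _] := wP _ tj; rewrite /N; split=> //; lia.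
- move=> x y xy yx sxy syN.
  have xN : x < N by rewrite -/N in syN; lia.
  have yN : y < N by rewrite -/N in syN; lia.
  have := cases x xN; have := cases y yN => /= cy [[xm fx]|[t tj ex]|[t tj ex]].
  + rewrite sf // in yx sxy; have [fl _] := fP _ xm; have [fy yb] := nc x y xy yx fl.
    rewrite sf // in sxy; lia.
  + subst x; rewrite sw // in yx sxy; have /andP[wl _] := wP _ tj.
    case: cy => [[ym fy]|[t' tj' ey]|[t' tj' ey]].
    * by rewrite sf // in sxy; have := fP _ ym; rewrite /N in sxy; lia.
    * subst y; rewrite sw // in sxy.
      have tt' : t' < t by move: sxy; rewrite /N; lia.
      by have := wI _ _ tt' tj; lia.
    by subst y; rewrite st // in sxy; have /andP[wl' _] := wP _ tj'; rewrite /N in sxy; lia.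
  by subst x; rewrite st // in yx; have /andP[wl' _] := wP _ tj; rewrite /N in xy yx; lia.
exists j, D; split.
  apply/forallP => x; apply/implyP => mx; rewrite -TL_mateE DE //.
  have /cases[[xm _]|[t tj e]|[t tj ->]] := ltn_ord x; first lia.
    by have /andP[wl _] := wP _ tj; rewrite -e in wl; lia.
  by rewrite st //; have /andP[] := wP _ tj.
move=> x xm; have xN : x < N by rewrite /N; lia.
rewrite DE //; split=> fx; last exact: sf.
have [[//]|[t tj ->]|[t tj e]] := cases x xN; last by move: xm; rewrite e /N; lia.
by rewrite sw // /N; lia.
Qed.

(** * Cutting an epi diagram *)

(* D is the diagram D1 next to D2, with the last i top points of D1 joined to the
   first i top points of D2. *)
Record splits m n M p m' n' (i : nat) (D : TL M p) (D1 : TL m m') (D2 : TL n n') : Prop :=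
  Splits {
  splits_left : forall x, x < m.*2 -> TL_mate D1 x < m.*2 -> TL_mate D x = TL_mate D1 x;
  splits_right : forall x, x < n.*2 -> TL_mate D2 x < n.*2 ->
    TL_mate D (m.*2 + x) = m.*2 + TL_mate D2 x;
  splits_top_left : forall t, t < m'.*2 - i ->
    TL_mate D (foot D1 t) = (M.*2 + p.*2).-1 - t;
  splits_cross : forall t, t < i ->
    TL_mate D (foot D1 (m'.*2.-1 - t)) = m.*2 + foot D2 t;
  splits_top_right : forall t, i <= t -> t < n'.*2 ->
    TL_mate D (m.*2 + foot D2 t) = (M.*2 + p.*2).-1 - (m'.*2 + t - i.*2)
}.

Section Split.
Variables (m n M p : nat).
(** [M] is a separate variable because these results are applied in degree [m + n - ord0], which
    [subn0] identifies with [m + n]. *)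
Hypothesis Mmn : M = m + n.

Section Join.
Variables (m' n' i : nat) (D1 : TL m m') (D2 : TL n n').
Hypotheses (e1 : epi D1) (e2 : epi D2).
Hypotheses (im : i <= m'.*2) (ik : i <= n'.*2) (pi : p + i = m' + n').

Local Notation N := (M.*2 + p.*2).
Local Notation s1 := (TL_mate D1).
Local Notation s2 := (TL_mate D2).
Local Notation u1 := (foot D1).
Local Notation u2 := (foot D2).

Lemma splits_unique (D D' : TL M p) : epi D -> epi D' ->
  splits i D D1 D2 -> splits i D' D1 D2 -> D = D'.
Proof.
move=> eD eD' [L R Tl C Tr] [L' R' Tl' C' Tr'].
apply: TL_eq => // x xM.
(* [splits_cross] describes a joining string from its left end; involutivity gives its right end. *)
have crossE (E : TL M p) t : epi E -> t < i ->
    TL_mate E (u1 (m'.*2.-1 - t)) = m.*2 + u2 t ->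
    TL_mate E (m.*2 + u2 t) = u1 (m'.*2.-1 - t).
  move=> eE ti <-; have := foot_lt e1 (_ : m'.*2.-1 - t < m'.*2) => h.
  have h1 : m'.*2.-1 - t < m'.*2 by lia.
  have h2 : u1 (m'.*2.-1 - t) < N by have := h h1; lia.
  by have [_ _ ->] := TL_mateP E h2.
have [xm|mx] := ltnP x m.*2.
  have [sx|[t tm <-]] := mate_or_foot e1 xm; first by rewrite L ?L'.
  have [tl|tl] := ltnP t (m'.*2 - i); first by rewrite Tl ?Tl'.
  have -> : t = m'.*2.-1 - (m'.*2.-1 - t) by lia.
  by rewrite C ?C' //; lia.
have xn : x - m.*2 < n.*2 by lia.
have -> : x = m.*2 + (x - m.*2) by lia.
have [sx|[t tn <-]] := mate_or_foot e2 xn; first by rewrite R ?R'.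
have [ti|it] := ltnP t i; last by rewrite Tr ?Tr'.
by rewrite !crossE ?C ?C'.
Qed.

(** The matching prescribed by [splits]. In the branches on bottom points, [t] inverts [mate_foot]:
    it is the number, from the left, of the top point of [D1] or [D2] above [z]. *)
Let s z :=
  if z < m.*2 then
    if s1 z < m.*2 then s1 z else
      let t := (m.*2 + m'.*2).-1 - s1 z in
      if t < m'.*2 - i then N.-1 - t else m.*2 + u2 (m'.*2.-1 - t)
  else if z < M.*2 then
    if s2 (z - m.*2) < n.*2 then m.*2 + s2 (z - m.*2) else
      let t := (n.*2 + n'.*2).-1 - s2 (z - m.*2) in
      if t < i then u1 (m'.*2.-1 - t) else N.-1 - (m'.*2 + t - i.*2)
  else
    let t := N.-1 - z in
    if t < m'.*2 - i then u1 t else m.*2 + u2 (t + i.*2 - m'.*2).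

Let sL x : x < m.*2 -> s1 x < m.*2 -> s x = s1 x.
Proof. by move=> xm sx; rewrite /s xm sx. Qed.

Let sR x : x < n.*2 -> s2 x < n.*2 -> s (m.*2 + x) = m.*2 + s2 x.
Proof.
move=> xn sx; rewrite /s ifF; last by lia.
rewrite ifT; last by lia.
by rewrite (_ : m.*2 + x - m.*2 = x) ?sx //; lia.
Qed.

Let sTL t : t < m'.*2 - i -> s (u1 t) = N.-1 - t.
Proof.
move=> tl; have tm : t < m'.*2 by lia.
rewrite /s (foot_lt e1 tm) (mate_foot e1 tm) ifF; last by lia.
by rewrite (_ : (m.*2 + m'.*2).-1 - _ = t) ?tl //=; lia.
Qed.

Let sC t : t < i -> s (u1 (m'.*2.-1 - t)) = m.*2 + u2 t.
Proof.
move=> ti; have tm : m'.*2.-1 - t < m'.*2 by lia.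
rewrite /s (foot_lt e1 tm) (mate_foot e1 tm) ifF; last by lia.
rewrite (_ : (m.*2 + m'.*2).-1 - _ = m'.*2.-1 - t) /=; last by lia.
by rewrite ifF; [congr (_ + u2 _); lia | lia].
Qed.

Let sC' t : t < i -> s (m.*2 + u2 t) = u1 (m'.*2.-1 - t).
Proof.
move=> ti; have tn : t < n'.*2 by lia.
have fl := foot_lt e2 tn; rewrite /s ifF; last by lia.
rewrite ifT; last by lia.
rewrite (_ : m.*2 + u2 t - m.*2 = u2 t); last by lia.
rewrite (mate_foot e2 tn) ifF; last by lia.
by rewrite (_ : (n.*2 + n'.*2).-1 - _ = t) ?ti //=; lia.
Qed.

Let sTR t : i <= t -> t < n'.*2 -> s (m.*2 + u2 t) = N.-1 - (m'.*2 + t - i.*2).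
Proof.
move=> it tn; have fl := foot_lt e2 tn; rewrite /s ifF; last by lia.
rewrite ifT; last by lia.
rewrite (_ : m.*2 + u2 t - m.*2 = u2 t); last by lia.
rewrite (mate_foot e2 tn) ifF; last by lia.
rewrite (_ : (n.*2 + n'.*2).-1 - _ = t) /=; last by lia.
by rewrite ifF //; lia.
Qed.

Let sT1 t : t < m'.*2 - i -> s (N.-1 - t) = u1 t.
Proof.
move=> tl; rewrite /s ifF; last by lia.
rewrite ifF; last by lia.
by rewrite (_ : N.-1 - (N.-1 - t) = t) ?tl //=; lia.
Qed.

Let sT2 t : i <= t -> t < n'.*2 -> s (N.-1 - (m'.*2 + t - i.*2)) = m.*2 + u2 t.
Proof.
move=> it tn; rewrite /s ifF; last by lia.
rewrite ifF; last by lia.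
rewrite (_ : N.-1 - (N.-1 - _) = m'.*2 + t - i.*2) /=; last by lia.
by rewrite ifF; [congr (_ + u2 _); lia | lia].
Qed.

(** The strings of the joined diagram, each given by its smaller and its larger position. Planarity
    thereby becomes a comparison of five kinds of arcs, free of the nested conditionals of [s]. *)
Inductive arc : nat -> nat -> Prop :=
| ArcL x : x < s1 x -> s1 x < m.*2 -> arc x (s1 x)
| ArcR x : x < s2 x -> s2 x < n.*2 -> arc (m.*2 + x) (m.*2 + s2 x)
| ArcTL t : t < m'.*2 - i -> arc (u1 t) (N.-1 - t)
| ArcC t : t < i -> arc (u1 (m'.*2.-1 - t)) (m.*2 + u2 t)
| ArcTR t : i <= t -> t < n'.*2 -> arc (m.*2 + u2 t) (N.-1 - (m'.*2 + t - i.*2)).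

Let arcP x y : arc x y -> [/\ s x = y, s y = x, x < y & y < N].
Proof.
case=> {x y} [x xs sm|x xs sn|t tl|t ti|t it tn].
- have xm := ltn_trans xs sm; have [_ ssx ssm] := mate_in e1 xm sm.
  by rewrite (sL xm sm) (sL sm) ?ssx //; split=> //; lia.
- have xn := ltn_trans xs sn; have [_ ssx ssn] := mate_in e2 xn sn.
  by rewrite (sR xn sn) (sR sn) ?ssx //; split=> //; lia.
- have tm : t < m'.*2 by lia.
  by have fl := foot_lt e1 tm; rewrite sTL // sT1 //; split=> //; lia.
- have tm : m'.*2.-1 - t < m'.*2 by lia.
  have tn : t < n'.*2 by lia.
  by have fl := foot_lt e1 tm; have fl2 := foot_lt e2 tn; rewrite sC // sC' //; split=> //; lia.
by have fl := foot_lt e2 tn; rewrite sTR // sT2 //; split=> //; lia.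
Qed.

Let arc_cover z : z < N -> exists y, arc z y \/ arc y z.
Proof.
move=> zN; have [zm|mz] := ltnP z m.*2.
  have [sz|[t tm <-]] := mate_or_foot e1 zm.
    exists (s1 z); have [sz0 ssz ssm] := mate_in e1 zm sz.
    have [lt|le] := ltnP z (s1 z); first by left; apply: ArcL.
    by right; rewrite -{2}ssz; apply: ArcL; rewrite ssz //; lia.
  have [tl|tl] := ltnP t (m'.*2 - i); first by exists (N.-1 - t); left; exact: ArcTL.
  exists (m.*2 + u2 (m'.*2.-1 - t)); left.
  by rewrite {1}(_ : t = m'.*2.-1 - (m'.*2.-1 - t)); [apply: ArcC|]; lia.
have [zM|Mz] := ltnP z M.*2.
  have zn : z - m.*2 < n.*2 by lia.
  have -> : z = m.*2 + (z - m.*2) by lia.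
  have [sz|[t tn <-]] := mate_or_foot e2 zn.
    exists (m.*2 + s2 (z - m.*2)); have [sz0 ssz ssn] := mate_in e2 zn sz.
    have [lt|le] := ltnP (z - m.*2) (s2 (z - m.*2)); first by left; apply: ArcR.
    by right; rewrite -{2}ssz; apply: ArcR; rewrite ssz //; lia.
  have [ti|it] := ltnP t i; first by exists (u1 (m'.*2.-1 - t)); right; exact: ArcC.
  by exists (N.-1 - (m'.*2 + t - i.*2)); left; exact: ArcTR.
have -> : z = N.-1 - (N.-1 - z) by lia.
have [tl|tl] := ltnP (N.-1 - z) (m'.*2 - i); first by exists (u1 (N.-1 - z)); right; exact: ArcTL.
exists (m.*2 + u2 (N.-1 - z + i.*2 - m'.*2)); right.
rewrite [X in arc _ (_ - X)](_ : _ = m'.*2 + (N.-1 - z + i.*2 - m'.*2) - i.*2); last by lia.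
by apply: ArcTR; lia.
Qed.

Let foot_cancel j k (E : TL j k) t t' : epi E -> t < k.*2 -> t' < k.*2 ->
  foot E t < foot E t' -> t < t'.
Proof.
move=> eE tk tk' lt; have [//|] := ltnP t t'; rewrite leq_eqVlt => /orP[/eqP e|lt'].
  by rewrite e ltnn in lt.
by have := foot_increasing eE lt' tk; lia.
Qed.

(** Most pairs of kinds are excluded by the blocks their ends lie in. In the others, either two arcs
    of one factor would cross, or a bottom arc would cover a foot, or the feet of one factor would
    fail to increase; for two joining arcs, the feet increase on both sides while the pairing
    reverses the order, so they are nested. *)
Let arc_noncrossing a b a' b' : arc a b -> arc a' b' ->
  a < a' -> a' < b -> b < b' -> False.
Proof.
case=> {a b} [x xs sm|x xs sn|t tl|t ti|t it tn];
  case=> {a' b'} [x' xs' sm'|x' xs' sn'|t' tl'|t' ti'|t' it' tn'] aa' a'b bb';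
  try (have tm : t < m'.*2 by lia); try (have tm' : t' < m'.*2 by lia);
  try (have tn : t < n'.*2 by lia); try (have tn' : t' < n'.*2 by lia);
  try (have tM : m'.*2.-1 - t < m'.*2 by lia);
  try (have tM' : m'.*2.-1 - t' < m'.*2 by lia);
  try (have f1 := foot_lt e1 tm); try (have f2 := foot_lt e2 tn);
  try (have f1' := foot_lt e1 tm'); try (have f2' := foot_lt e2 tn');
  try (have F1 := foot_lt e1 tM); try (have F1' := foot_lt e1 tM');
  try lia.
- by apply: (@TL_noncrossing _ _ D1 x x') => //; lia.
- exact: (foot_uncovered e1 tm' aa' a'b sm).
- exact: (foot_uncovered e1 tM' aa' a'b sm).
- by apply: (@TL_noncrossing _ _ D2 x x') => //; lia.
- by apply: (foot_uncovered e2 tn' _ _ sn); lia.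
- by have := foot_cancel e1 tm tm' aa'; lia.
- by apply: (foot_uncovered e2 tn _ _ sn'); lia.
- by have := foot_cancel e1 tM tm' aa'; lia.
- have := foot_cancel e1 tM tM' aa'; have := @foot_cancel _ _ D2 t t' e2 tn tn'; lia.
- have := @foot_cancel _ _ D2 t' t e2 tn' tn; lia.
have := @foot_cancel _ _ D2 t t' e2 tn tn'; lia.
Qed.

Lemma splits_exists : exists2 D : TL M p, epi D & splits i D D1 D2.
Proof.
have [||D DE] := @make_TL M p s.
- by move=> x /arc_cover[y [/arcP[sx sy xy yN]|/arcP[sx sy xy yN]]];
    rewrite ?sx ?sy ?sx; split=> //; lia.
- move=> x y xy yx sxy syN.
  have arcU z : z < N -> z < s z -> arc z (s z).
    move=> /arc_cover[w [a|a]]; have [e1' e2' lt _] := arcP a; first by rewrite e1'.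
    by rewrite e2'; lia.
  by apply: (@arc_noncrossing x (s x) y (s y)) => //; apply: arcU; lia.
exists D.
  apply/forallP => x; apply/implyP => Mx; rewrite -TL_mateE DE //.
  have xN : x < N := ltn_ord x.
  have [tl|tl] := ltnP (N.-1 - x) (m'.*2 - i).
    rewrite (_ : nat_of_ord x = N.-1 - (N.-1 - x)); last by lia.
    rewrite sT1 //; have tm : N.-1 - x < m'.*2 by lia.
    by have := foot_lt e1 tm; lia.
  set t := N.-1 - x + i.*2 - m'.*2.
  rewrite (_ : nat_of_ord x = N.-1 - (m'.*2 + t - i.*2)); last by rewrite /t; lia.
  have it : i <= t by rewrite /t; lia.
  have tn : t < n'.*2 by rewrite /t; lia.
  by rewrite sT2 //; have := foot_lt e2 tn; lia.
split.
- by move=> x xm sx; rewrite DE ?sL //; lia.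
- by move=> x xm sx; rewrite DE ?sR //; lia.
- move=> t tl; have tm : t < m'.*2 by lia.
  by have fl := foot_lt e1 tm; rewrite DE ?sTL //; lia.
- move=> t ti; have tm : m'.*2.-1 - t < m'.*2 by lia.
  by have fl := foot_lt e1 tm; rewrite DE ?sC //; lia.
by move=> t it tn; have fl := foot_lt e2 tn; rewrite DE ?sTR //; lia.
Qed.

Lemma splits_left_lt (D : TL M p) : splits i D D1 D2 ->
  forall x, x < m.*2 -> (TL_mate D x < m.*2) = (s1 x < m.*2).
Proof.
move=> [L _ Tl C _] x xm.
have [sx|[t tm <-]] := mate_or_foot e1 xm; first by rewrite L.
rewrite (mate_foot e1 tm); have [tl|tl] := ltnP t (m'.*2 - i).
  by rewrite Tl //; lia.
have -> : t = m'.*2.-1 - (m'.*2.-1 - t) by lia.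
by rewrite C; lia.
Qed.

Lemma splits_right_lt (D : TL M p) : epi D -> splits i D D1 D2 ->
  forall x, x < n.*2 -> (m.*2 <= TL_mate D (m.*2 + x) < M.*2) = (s2 x < n.*2).
Proof.
move=> eD [_ R _ C Tr] x xn.
have [sx|[t tn <-]] := mate_or_foot e2 xn; first by rewrite R //; lia.
rewrite (mate_foot e2 tn); have [ti|it] := ltnP t i; last by rewrite Tr //; lia.
have tm : m'.*2.-1 - t < m'.*2 by lia.
have fl := foot_lt e1 tm.
have h2 : u1 (m'.*2.-1 - t) < N by lia.
by rewrite -C //; have [_ _ ->] := TL_mateP D h2; lia.
Qed.

End Join.

(** The arcs of [D] with both ends on one box are the bottom arcs of the factor there, and these
    determine an epi factor, its number of top points included. Then [i] follows from
    [p + i = m' + n']. *)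
Lemma splits_factors_unique (D : TL M p) m' n' i (D1 : TL m m') (D2 : TL n n')
    m'' n'' i' (E1 : TL m m'') (E2 : TL n n'') : epi D ->
  epi D1 -> epi D2 -> i <= m'.*2 -> i <= n'.*2 -> p + i = m' + n' ->
  epi E1 -> epi E2 -> i' <= m''.*2 -> i' <= n''.*2 -> p + i' = m'' + n'' ->
  splits i D D1 D2 -> splits i' D E1 E2 ->
  [/\ Tagged (TL m) D1 = Tagged (TL m) E1, Tagged (TL n) D2 = Tagged (TL n) E2 & i = i'].
Proof.
move=> eD d1 d2 im ik pi e1 e2 im' ik' pi' S S'.
have lt1 := splits_left_lt d1 d2 im ik pi S; have lt1' := splits_left_lt e1 e2 im' ik' pi' S'.
have lt2 := splits_right_lt d1 d2 im ik pi eD S.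
have lt2' := splits_right_lt e1 e2 im' ik' pi' eD S'.
have T1 : Tagged (TL m) D1 = Tagged (TL m) E1.
  apply: epi_bottom_eq => // x xm; first by rewrite -lt1 // lt1'.
  move=> sx; rewrite -(splits_left S) // (splits_left S') //.
  by rewrite -lt1' // lt1.
have T2 : Tagged (TL n) D2 = Tagged (TL n) E2.
  apply: epi_bottom_eq => // x xn; first by rewrite -lt2 // lt2'.
  move=> sx; have := splits_right S xn sx; rewrite (splits_right S') //; first by lia.
  by rewrite -lt2' // lt2.
by have /= := congr1 tag T1; have /= := congr1 tag T2; split=> //; lia.
Qed.

(** Each factor keeps the arcs of [D] inside its box and sends all other points to its top. From
    left to right, the points of a that leave a are the feet [u 0, ..., u (q-1)] of [D], then the
    left ends [c 0, ..., c (i-1)] of the joining strings; those of b that leave b are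
    [s (c (i-1)), ..., s (c 0)], then the remaining feet of [D]. Comparing these enumerations with
    the feet of [D1] and [D2] yields every clause of [splits]. *)
Lemma factors_exist (D : TL M p) : epi D -> exists m' n' i (D1 : TL m m') (D2 : TL n n'),
  [/\ epi D1 /\ epi D2, i <= m'.*2, i <= n'.*2, p + i = m' + n' & splits i D D1 D2].
Proof.
move=> eD; pose s := TL_mate D; pose u := foot D.
have sP x : x < M.*2 -> [/\ s x < M.*2 + p.*2, s x <> x & s (s x) = x].
  by move=> xM; apply: TL_mateP; lia.
have bet x y : x < M.*2 -> x < y -> y < s x -> x < s y < s x.
  by move=> xM; apply: TL_between; lia.
(* The fixed points are the points whose string leaves the box; [epi_exists] joins them to the
   top. *)
pose f1 x := if s x < m.*2 then s x else x.
have [|x y xy yf fm|m' [D1 [e1 D1E]]] := @epi_exists m f1.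
- move=> x xm; rewrite /f1; have [|_ _ ssx] := sP x; first by lia.
  by case: (ltnP (s x) m.*2) => sx; rewrite ?sx ?ssx ?xm // ltnNge sx.
- move: yf fm; rewrite /f1; case: ifP => [sx yf _|_]; last by lia.
  have b := bet x y _ xy yf; have [|_ sy _] := sP y; first by lia.
  by rewrite ifT; [split|]; lia.
pose f2 x := if m.*2 <= s (m.*2 + x) < M.*2 then s (m.*2 + x) - m.*2 else x.
have [|x y xy yf fm|n' [D2 [e2 D2E]]] := @epi_exists n f2.
- move=> x xn; rewrite /f2; have [|_ _ ssx] := sP (m.*2 + x); first by lia.
  case: ifP => sx; last by rewrite sx.
  by rewrite (_ : m.*2 + (s (m.*2 + x) - m.*2) = s (m.*2 + x)) ?ssx ?ifT; lia.
- move: yf fm; rewrite /f2; case: ifP => [sx yf _|_]; last by lia.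
  have b := bet (m.*2 + x) (m.*2 + y); have [|_ sy _] := sP (m.*2 + y); first by lia.
  by rewrite ifT; [split|]; lia.
(* Feet increase, so those lying in a belong to an initial segment of the top points, of length
   [q]. *)
have [q qp uq] := @threshold (fun t => u t < m.*2) p.*2
  (fun t t' tt' t'p => fun lt => ltn_trans (foot_increasing eD tt' t'p) lt).
have [cI cP Pc] := filter_enumeration (fun x => m.*2 <= s x < M.*2) m.*2.
set c := nth 0 _ in cI cP Pc; set i := count _ _ in cI cP Pc.
have uI := foot_increasing eD; rewrite -/u in uI.
have fl t : t < p.*2 -> u t < M.*2 by exact: foot_lt.
have su t : t < p.*2 -> s (u t) = (M.*2 + p.*2).-1 - t by exact: mate_foot.
have us x : x < M.*2 -> M.*2 <= s x -> exists2 t, t < p.*2 & u t = x by exact: foot_mate.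
(* Otherwise the joining string at [c t'] would enclose [u t], whose string goes to the top. *)
have u_c t t' : t < q -> t' < i -> u t < c t'.
  move=> tq t'i; have := cP _ t'i => /andP[cm cs].
  have utm : u t < m.*2 by rewrite uq //; lia.
  rewrite ltnNge; apply/negP; rewrite leq_eqVlt => /orP[/eqP e|lt].
    by move: cs; rewrite e su; lia.
  have := bet (c t') (u t) _ lt; rewrite su; lia.
(* Joining strings are nested, so their right ends come in the reverse order. *)
have s_c t t' : t < t' -> t' < i -> s (c t') < s (c t).
  move=> tt' t'i; have := cI _ _ tt' t'i.
  have /andP[cm cs] := cP _ t'i; have /andP[cm' cs'] := cP _ (ltn_trans tt' t'i).
  by move=> lt; have := bet (c t) (c t') _ lt; lia.
have c_u t t' : t < i -> q <= t' -> t' < p.*2 -> s (c t) < u t'.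
  move=> ti qt' t'p; have /andP[cm cs] := cP _ ti; have := fl _ t'p; have := su _ t'p.
  have : m.*2 <= u t' by have := uq _ t'p; lia.
  move=> ge sut ult; rewrite ltnNge; apply/negP; rewrite leq_eqVlt => /orP[/eqP e|lt].
    by have [|_ _ ss] := sP (c t); [lia | move: sut; rewrite e ss; lia].
  by have := bet (c t) (u t') _ _ lt; rewrite sut; lia.
have low1 x : x < m.*2 -> (m.*2 <= TL_mate D1 x) = (m.*2 <= s x).
  move=> xm; have [H1 H2] := D1E x xm; have [|_ sx _] := sP x; first by lia.
  move: H1 H2; rewrite /f1; case: ifP => sxm H1 H2; first by rewrite H2 // leqNgt sxm.
  by rewrite H1 //; lia.
have low2 x : x < n.*2 -> (n.*2 <= TL_mate D2 x) = ~~ (m.*2 <= s (m.*2 + x) < M.*2).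
  move=> xn; have [H1 H2] := D2E x xn; have [|_ sx _] := sP (m.*2 + x); first by lia.
  move: H1 H2; rewrite /f2; case: ifP => sxm H1 H2; first by rewrite H2; lia.
  by rewrite H1 //; lia.
have ut t : t < q -> u t < m.*2 by move=> tq; rewrite uq //; lia.
have [||q1 E1] := @enumeration_unique m'.*2 (q + i) (foot D1)
  (fun t => if t < q then u t else c (t - q)) (foot_increasing e1).
- move=> t t' tt' t'l; case: (ltnP t' q) => t'q.
    by rewrite ifT; [apply: uI|]; lia.
  by case: (ltnP t q) => tq; [apply: u_c | apply: cI]; lia.
- move=> x; split=> -[t tl <-].
    have xm := foot_lt e1 tl; have := mate_foot e1 tl.
    set x' := foot D1 t in xm *; move=> sx.
    have ge : m.*2 <= s x' by rewrite -low1 // sx; lia.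
    have [lt|Ms] := ltnP (s x') M.*2.
      have [r ri <-] := Pc _ xm (introT andP (conj ge lt)).
      by exists (q + r); [|rewrite ifF ?addKn //]; lia.
    have [|//|r rp ur] := us x'; first by lia.
    have rq : r < q by rewrite -uq ?ur.
    by exists r; rewrite ?rq //; lia.
  apply: foot_mate => //.
    case: (ltnP t q) => tq; first exact: ut.
    by have := cP (t - q); lia.
  case: (ltnP t q) => tq.
    by rewrite low1 ?ut // su; lia.
  have /andP[cm cs] : (c (t - q) < m.*2) && (m.*2 <= s (c (t - q)) < M.*2) by apply: cP; lia.
  by rewrite low1 //; lia.
have [||q2 E2] := @enumeration_unique n'.*2 (i + (p.*2 - q)) (foot D2)
  (fun t => if t < i then s (c (i.-1 - t)) - m.*2 else u (t - i + q) - m.*2) (foot_increasing e2).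
- move=> t t' tt' t'l; case: (ltnP t' i) => t'i.
    rewrite ifT; last by lia.
    have := s_c (i.-1 - t') (i.-1 - t); have := cP (i.-1 - t'); have := cP (i.-1 - t); lia.
  have um : ~~ (u (t' - i + q) < m.*2) by rewrite uq; lia.
  case: (ltnP t i) => ti.
    have := c_u (i.-1 - t) (t' - i + q); have := cP (i.-1 - t); lia.
  have um' : ~~ (u (t - i + q) < m.*2) by rewrite uq; lia.
  have := uI (t - i + q) (t' - i + q); lia.
- move=> x; split=> -[t tl <-].
    have xn := foot_lt e2 tl; have := mate_foot e2 tl.
    set x' := foot D2 t in xn *; move=> sx.
    have : n.*2 <= TL_mate D2 x' by rewrite sx; lia.
    rewrite low2 // => nin.
    have [lt|ge] := ltnP (s (m.*2 + x')) m.*2.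
      have [|_ _ ssx] := sP (m.*2 + x'); first by lia.
      have [|r ri cr] := Pc _ lt; first by rewrite ssx; lia.
      exists (i.-1 - r); first by lia.
      rewrite ifT; last by lia.
      have -> : i.-1 - (i.-1 - r) = r by lia.
      by rewrite cr ssx; lia.
    have [||r rp ur] := us (m.*2 + x'); [lia|lia|].
    have rq : ~~ (r < q) by rewrite -uq // ur; lia.
    exists (r - q + i); first by lia.
    rewrite ifF; last by lia.
    have -> : r - q + i - i + q = r by lia.
    by rewrite ur; lia.
  suff [lt nin] : (if t < i then s (c (i.-1 - t)) - m.*2 else u (t - i + q) - m.*2) < n.*2 /\
      ~~ (m.*2 <= s (m.*2 + (if t < i then s (c (i.-1 - t)) - m.*2 else u (t - i + q) - m.*2)) < M.*2).
    by apply: foot_mate => //; rewrite low2.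
  case: (ltnP t i) => ti.
    have /andP[cm cs] : (c (i.-1 - t) < m.*2) && (m.*2 <= s (c (i.-1 - t)) < M.*2) by apply: cP; lia.
    have [|_ _ ss] := sP (c (i.-1 - t)); first by lia.
    have -> : m.*2 + (s (c (i.-1 - t)) - m.*2) = s (c (i.-1 - t)) by lia.
    by rewrite ss; lia.
  have um : ~~ (u (t - i + q) < m.*2) by rewrite uq; lia.
  have ul := fl (t - i + q); have us' := su (t - i + q).
  have -> : m.*2 + (u (t - i + q) - m.*2) = u (t - i + q) by lia.
  by rewrite us'; lia.
exists m', n', i, D1, D2; split=> //; [lia|lia|lia|].
split.
- move=> x xm sx; have [H1 H2] := D1E x xm.
  have [e|/eqP ne] := eqVneq (f1 x) x; first by have := H1 e; lia.
  rewrite H2 //; move: ne; rewrite /f1; case: ifP => //.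
- move=> x xn sx; have [H1 H2] := D2E x xn.
  have [e|/eqP ne] := eqVneq (f2 x) x; first by have := H1 e; lia.
  rewrite H2 //; move: ne; rewrite /f2; case: ifP => // h _.
  by rewrite -/s; lia.
- move=> t tl; rewrite E1; last by lia.
  by rewrite ifT; [apply: su|]; lia.
- move=> t ti; rewrite E1; last by lia.
  rewrite E2; last by lia.
  rewrite ifF; last by lia.
  rewrite ti (_ : m'.*2.-1 - t - q = i.-1 - t); last by lia.
  by have := cP (i.-1 - t); rewrite -/s; lia.
move=> t it tn; rewrite E2 // ifF; last by lia.
have um : ~~ (u (t - i + q) < m.*2) by rewrite uq; lia.
rewrite (_ : m.*2 + (u (t - i + q) - m.*2) = u (t - i + q)); last by lia.
by rewrite -/s su; lia.
Qed.

End Split.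

(** * The two composite tangles *)

Section PairingNocap.
Variables (I : finType) (c : I -> color) (c0 : color).

Lemma sat_None (T : tangle c c0) (x : 'I_(c0.2.*2)) :
  sat T None x = Some (tend T (@mkend I c c0 None x)).
Proof. exact: (satE T (@mkend I c c0 None x)). Qed.

Lemma pairing_nocap f corners (pp : planar_pairing (mate_of (c := c) (c0 := c0) f) corners) :
  (forall x, x < c0.2.*2 -> exists i y, f (None, x) = (Some i, y) /\ y < (c i).2.*2) ->
  forall x y : 'I_(c0.2.*2),
    tend (pairing_tangle pp) (@mkend I c c0 None x) =
    tend (pairing_tangle pp) (@mkend I c c0 None y) -> x = y.
Proof.
move=> fN x y e; have [i [z [fx zl]]] := fN x (ltn_ord x).
have := @sat_pairing_eq _ _ _ _ _ pp None x None y (Some i) z fx (ltn_ord x) zl (ltn_ord y).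
by rewrite !sat_None e => /(_ erefl)[[yx]|//]; apply: val_inj.
Qed.

Lemma first_gap_seen (T : tangle c c0) i x : x <= (c i).2.*2 ->
  gat T None 0 = gat T (Some i) x -> exists i x,
  tgap T (@mkgap I c c0 (Some i) x) = tgap T (first_gap c c0 None).
Proof.
move=> xl; rewrite gat_first.
rewrite -[x]/(tagged (@mkgap I c c0 (Some i) (Ordinal (xl : x < _.+1))) : nat).
rewrite (gatE T (@mkgap I c c0 (Some i) (Ordinal (xl : x < _.+1)))) => -[e].
by exists i, (Ordinal (xl : x < _.+1)).
Qed.

End PairingNocap.

Section TLStrings.
Variables (i j k : nat) (D : TL i j).
Hypothesis eD : epi D.
Local Notation T := (TL_tangle k D).

Let TL_sat d x d' x' : TL_end D (d, x) = (d', x') ->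
  x < (if d is Some _ then i + k else j + k).*2 ->
  x' < (if d' is Some _ then i + k else j + k).*2 -> sat T d x = sat T d' x'.
Proof. by case: d => [u|]; case: d' => [u'|] e xl xl'; apply: sat_mate e _ _. Qed.

Lemma TL_sat_in y : y < i.*2 -> TL_mate D y < i.*2 ->
  sat T (Some tt) y = sat T (Some tt) (TL_mate D y).
Proof. by move=> yi sy; apply: TL_sat; rewrite /= ?yi ?sy //; lia. Qed.

Lemma TL_sat_foot t : t < j.*2 -> sat T (Some tt) (foot D t) = sat T None t.
Proof.
move=> tj; have fl := foot_lt eD tj; apply: TL_sat; rewrite /= ?fl ?(mate_foot eD tj); try lia.
by rewrite ifF; [congr (_, _)|]; lia.
Qed.

Lemma TL_sat_side x : x < k.*2 -> sat T (Some tt) (i.*2 + x) = sat T None (j.*2 + x).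
Proof. by move=> xk; apply: TL_sat; rewrite /= ?ifF; try congr (_, _); lia. Qed.

(** As [D] is epi, a string from a top point ends at a foot; the side strings run straight to the
    inner box. *)
Lemma TL_nocap (x y : 'I_((j + k).*2)) :
  tend T (@mkend _ (fun _ : unit => (false, i + k)) (false, j + k) None x) =
  tend T (@mkend _ (fun _ : unit => (false, i + k)) (false, j + k) None y) -> x = y.
Proof.
apply: pairing_nocap => {y} x /= xl; case: (ltnP x j.*2) => xj.
  exists tt, (foot D x); have fl := foot_lt eD xj.
  by rewrite -/(foot D x) fl; split=> //; lia.
by exists tt, (x + i.*2 - j.*2); split=> //; lia.
Qed.

Lemma TL_gat_first : gat T (Some tt) 0 = gat T None 0.
Proof. by apply: gat_corner; rewrite ?mem_head. Qed.

(** The region at the top right corners. For [k > 0] both gaps lie on the unshaded side of the first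
    right-hand string; for [k = 0] they are the last gaps of their discs, hence equal to the first
    ones. *)
Lemma TL_gat_corner : gat T (Some tt) i.*2 = gat T None j.*2.
Proof.
case: (posnP k) => [k0|k_gt0].
  have e1 : i.*2 = (dcol (fun _ : unit => (false, i + k)) (false, j + k) (Some tt)).2.*2.
    by rewrite /= k0 addn0.
  have e2 : j.*2 = (dcol (fun _ : unit => (false, i + k)) (false, j + k) None).2.*2.
    by rewrite /= k0 addn0.
  by rewrite {1}e1 {1}e2 !gat_last TL_gat_first.
have xl : i.*2 < (i + k).*2 by lia.
have yl : j.*2 < (j + k).*2 by lia.
pose p := @mkend _ (fun _ : unit => (false, i + k)) (false, j + k) (Some tt) (Ordinal xl).
pose q := @mkend _ (fun _ : unit => (false, i + k)) (false, j + k) None (Ordinal yl).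
have : Some (tend T p) = Some (tend T q).
  rewrite -!satE /=; have := @TL_sat_side 0; rewrite !addn0; apply; lia.
have -> : gat T (Some tt) i.*2 = Some (tgap T (before p)) by rewrite -gatE.
have -> : gat T None j.*2 = Some (tgap T (before q)) by rewrite -gatE.
have -> : before p = side_gap p false by rewrite /side_gap /shade /= odd_double.
have -> : before q = side_gap q false by rewrite /side_gap /shade /= odd_double.
by rewrite !tg_side => /Some_inj ->.
Qed.

Lemma TL_first : exists u x,
  tgap T (@mkgap _ (fun _ : unit => (false, i + k)) (false, j + k) (Some u) x) =
  tgap T (first_gap (fun _ : unit => (false, i + k)) (false, j + k) None).
Proof. by apply: (@first_gap_seen _ _ _ T tt 0); rewrite // TL_gat_first. Qed.

End TLStrings.

Section StarStrings.
Variables (m n k : nat) (i : 'I_(minn m.*2 n.*2).+1).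
Local Notation T := (star_tangle k i).

Let im : i <= m.*2. Proof. have := ltn_ord i; lia. Qed.
Let ik : i <= n.*2. Proof. have := ltn_ord i; lia. Qed.

Let star_sat d x d' x' : star_end m n k i (d, x) = (d', x') ->
  x < (match d with Some false => m + k | Some true => n + k | None => m + n - i + k end).*2 ->
  x' < (match d' with Some false => m + k | Some true => n + k | None => m + n - i + k end).*2 ->
  sat T d x = sat T d' x'.
Proof. by case: d => [[]|]; case: d' => [[]|] e xl xl'; apply: sat_mate e _ _. Qed.

Lemma star_sat_top_left t : t < m.*2 - i -> sat T (Some false) t = sat T None t.
Proof. by move=> tl; apply: star_sat; rewrite /= ?tl //; lia. Qed.

Lemma star_sat_cross t : t < i -> sat T (Some false) (m.*2.-1 - t) = sat T (Some true) t.
Proof. by move=> ti; apply/esym/star_sat; rewrite /= ?ti //; lia. Qed.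

Lemma star_sat_right t : i <= t -> t < n.*2 + k ->
  sat T (Some true) t = sat T None (m.*2 + t - i.*2).
Proof.
move=> it tn; apply: star_sat; rewrite /= ?tn; try lia.
by rewrite ifF; [congr (_, _)|]; lia.
Qed.

Lemma star_sat_middle x : x < k ->
  sat T (Some false) (m.*2 + x) = sat T (Some true) ((n.*2 + k.*2).-1 - x).
Proof.
move=> xk; apply: star_sat; rewrite /=; try lia.
do 2 (rewrite ifF; last by lia).
by rewrite ifT; [congr (_, _)|]; lia.
Qed.

Lemma star_sat_left x : x < k ->
  sat T (Some false) (m.*2 + k + x) = sat T None (m.*2 + n.*2 - i.*2 + k + x).
Proof.
move=> xk; apply: star_sat; rewrite /=; try lia.
by rewrite !ifF; try congr (_, _); lia.
Qed.

Lemma star_gat_first : gat T (Some false) 0 = gat T None 0.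
Proof. by apply: gat_corner; rewrite ?mem_head. Qed.

Lemma star_gat_corner : gat T (Some false) m.*2 = gat T (Some true) 0.
Proof. by apply: gat_corner; rewrite ?mem_second //=; lia. Qed.

End StarStrings.

Section Juxtaposition.
Variables (m n k : nat).
Local Notation T := (star_tangle k (ord0 : 'I_(minn m.*2 n.*2).+1)).
Local Notation sin := (two (false, m + k) (false, n + k)).
Local Notation sout := (false, m + n - (ord0 : 'I_(minn m.*2 n.*2).+1) + k).

Lemma star0_nocap (x y : 'I_(sout.2.*2)) :
  tend T (@mkend _ sin sout None x) = tend T (@mkend _ sin sout None y) -> x = y.
Proof.
apply: pairing_nocap => {y} x /= xl; case: ifP => xm.
  by exists false, x; split=> //=; lia.
case: ifP => xn.
  by exists true, (x + 0 - m.*2); split=> //=; lia.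
by exists false, (x + 0 - n.*2); split=> //=; lia.
Qed.

Lemma star0_first : exists b x,
  tgap T (@mkgap _ sin sout (Some b) x) = tgap T (first_gap sin sout None).
Proof. by apply: (@first_gap_seen _ _ _ T false 0) => //; exact/esym/star_gat_first. Qed.

End Juxtaposition.

(** * Isotopy from shared links and corners *)

Section IsotopicLinks.
Variables (I I' : finType) (h : I' -> I) (c : I -> color) (c0 : color).
Hypothesis h_bij : bijective h.
Local Notation c' := (fun i => c (h i)).

Lemma emap_inj : injective (@emap I I' h c c0).
Proof.
case=> [[i|] x] [[i'|] x'] // /eqP; rewrite -tag_eqE /tag_eq /=.
  case/andP=> /eqP[/(bij_inj h_bij) e]; case: _ / e x' => x'.
  by rewrite tagged_asE => /eqP ->.
by rewrite tagged_asE => /eqP ->.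
Qed.

(** A string has only two ends, so links that reach every end and hold in both tangles already give
    the whole pairing of ends in each of them. *)
Lemma isotopic_links (T : tangle c c0) (T' : tangle c' c0)
    (L : endpt c' c0 -> endpt c' c0 -> Prop) (K : gap c' c0 -> gap c' c0 -> Prop) :
  touching T -> touching T' ->
  (forall p, exists q, L p q \/ L q p) ->
  (forall p q, L p q -> p <> q) ->
  (forall p q, L p q -> tend T (emap p) = tend T (emap q)) ->
  (forall p q, L p q -> tend T' p = tend T' q) ->
  (forall D : option I' -> bool, (forall x y, K x y -> D (tag x) = D (tag y)) ->
    forall d d', D d = D d') ->
  (forall x y, K x y -> tgap T (gmap x) = tgap T (gmap y)) ->
  (forall x y, K x y -> tgap T' x = tgap T' y) ->
  isotopic T T'.
Proof.
move=> tT tT' Lall Lneq LT LT' Kconn KT KT'.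
apply: (isotopic_pairing h_bij tT tT' _ Kconn KT KT') => p q.
have [r [pr Tpr Tpr']] : exists r, [/\ p <> r, tend T (emap p) = tend T (emap r) &
    tend T' p = tend T' r].
  by have [r [] l] := Lall p; exists r; split;
    [exact: Lneq l|exact: LT|exact: LT'|move=> e; exact: Lneq l (esym e)|
     exact/esym/LT|exact/esym/LT'].
split=> e.
  have [|/emap_inj->|/emap_inj->] // := string_ends Tpr _ (esym e).
  by move/emap_inj.
by have [->|->] := string_ends Tpr' pr (esym e).
Qed.

End IsotopicLinks.

Section Split.
Variables (m n k m' n' : nat) (i : 'I_(minn m'.*2 n'.*2).+1).
Local Notation M := (m + n - (ord0 : 'I_(minn m.*2 n.*2).+1)).
Local Notation p := (m' + n' - i).
Variables (D : TL M p) (D1 : TL m m') (D2 : TL n n').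
Hypotheses (eD : epi D) (e1 : epi D1) (e2 : epi D2).
Hypothesis SD : splits i D D1 D2.

Let ME : M = m + n. Proof. exact: subn0. Qed.
Let im : i <= m'.*2. Proof. have := ltn_ord i; lia. Qed.
Let ik : i <= n'.*2. Proof. have := ltn_ord i; lia. Qed.

(** The strings common to both composites, as pairs of positions on the discs of a, of b and of the
    output. The first five kinds follow the fields of [splits]; the last three are the strings
    between a and b, to the right of b and to the left of a. *)
Inductive link : option bool * nat -> option bool * nat -> Prop :=
| LinkL x : x < m.*2 -> TL_mate D1 x < m.*2 ->
    link (Some false, x) (Some false, TL_mate D1 x)
| LinkR x : x < n.*2 -> TL_mate D2 x < n.*2 ->
    link (Some true, x) (Some true, TL_mate D2 x)
| LinkTL t : t < m'.*2 - i -> link (Some false, foot D1 t) (None, t)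
| LinkC t : t < i -> link (Some false, foot D1 (m'.*2.-1 - t)) (Some true, foot D2 t)
| LinkTR t : i <= t -> t < n'.*2 ->
    link (Some true, foot D2 t) (None, m'.*2 + t - i.*2)
| LinkM x : x < k -> link (Some false, m.*2 + x) (Some true, (n.*2 + k.*2).-1 - x)
| LinkSR x : x < k -> link (Some true, n.*2 + x) (None, p.*2 + x)
| LinkSL x : x < k -> link (Some false, m.*2 + k + x) (None, p.*2 + k + x).

Definition disc_size (d : option bool) : nat :=
  (match d with Some false => m + k | Some true => n + k | None => p + k end).*2.

Lemma link_ok q q' : link q q' ->
  [/\ q.2 < disc_size q.1, q'.2 < disc_size q'.1 & q <> q'].
Proof.
case=> {q q'} /= [x xm sx|x xn sx|t tl|t ti|t it tn|x xk|x xk|x xk];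
  rewrite /disc_size; try by split=> //; lia.
- have [sx0 _ _] := mate_in e1 xm sx; split; try lia.
  by case=> e; apply: sx0.
- have [sx0 _ _] := mate_in e2 xn sx; split; try lia.
  by case=> e; apply: sx0.
- have tm : t < m'.*2 by lia.
  by have := foot_lt e1 tm; split=> //; lia.
- have tm : m'.*2.-1 - t < m'.*2 by lia.
  have tn : t < n'.*2 by lia.
  by have := foot_lt e1 tm; have := foot_lt e2 tn; split=> //; lia.
by have := foot_lt e2 tn; split=> //; lia.
Qed.

Lemma link_cover d x : x < disc_size d -> exists q, link (d, x) q \/ link q (d, x).
Proof.
rewrite /disc_size; case: d => [[]|] xl.
- have [xn|nx] := ltnP x n.*2.
    have [sx|[t tn <-]] := mate_or_foot e2 xn.
      by exists (Some true, TL_mate D2 x); left; exact: LinkR.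
    have [ti|it] := ltnP t i.
      by exists (Some false, foot D1 (m'.*2.-1 - t)); right; exact: LinkC.
    by exists (None, m'.*2 + t - i.*2); left; exact: LinkTR.
  have [xk|kx] := ltnP x (n.*2 + k).
    exists (None, p.*2 + (x - n.*2)); left.
    by rewrite (_ : x = n.*2 + (x - n.*2)) ?addKn; [apply: LinkSR|]; lia.
  exists (Some false, m.*2 + ((n.*2 + k.*2).-1 - x)); right.
  by rewrite [X in link _ (_, X)](_ : x = (n.*2 + k.*2).-1 - ((n.*2 + k.*2).-1 - x));
    [apply: LinkM|]; lia.
- have [xm|mx] := ltnP x m.*2.
    have [sx|[t tm <-]] := mate_or_foot e1 xm.
      by exists (Some false, TL_mate D1 x); left; exact: LinkL.
    have [tl|tl] := ltnP t (m'.*2 - i).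
      by exists (None, t); left; exact: LinkTL.
    exists (Some true, foot D2 (m'.*2.-1 - t)); left.
    by rewrite [X in link (_, foot D1 X)](_ : t = m'.*2.-1 - (m'.*2.-1 - t));
      [apply: LinkC|]; lia.
  have [xk|kx] := ltnP x (m.*2 + k).
    exists (Some true, (n.*2 + k.*2).-1 - (x - m.*2)); left.
    by rewrite [X in link (_, X)](_ : x = m.*2 + (x - m.*2)); [apply: LinkM|]; lia.
  exists (None, p.*2 + k + (x - (m.*2 + k))); left.
  by rewrite [X in link (_, X)](_ : x = m.*2 + k + (x - (m.*2 + k)));
    [apply: LinkSL|]; lia.
have [xl1|xl1] := ltnP x (m'.*2 - i).
  by exists (Some false, foot D1 x); right; exact: LinkTL.
have [xp|px] := ltnP x p.*2.
  exists (Some true, foot D2 (x + i.*2 - m'.*2)); right.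
  by rewrite [X in link _ (_, X)](_ : x = m'.*2 + (x + i.*2 - m'.*2) - i.*2);
    [apply: LinkTR|]; lia.
have [xk|kx] := ltnP x (p.*2 + k).
  exists (Some true, n.*2 + (x - p.*2)); right.
  by rewrite [X in link _ (_, X)](_ : x = p.*2 + (x - p.*2)); [apply: LinkSR|]; lia.
exists (Some false, m.*2 + k + (x - (p.*2 + k))); right.
by rewrite [X in link _ (_, X)](_ : x = p.*2 + k + (x - (p.*2 + k)));
  [apply: LinkSL|]; lia.
Qed.

Local Notation cin := (two (false, m + k) (false, n + k)).
Local Notation cmid := (two (false, m' + k) (false, n' + k)).
Local Notation cout := (false, p + k).

(** [A] is [D] around one inner tangle with two discs, [B] is the product tangle around two inner
    tangles with one disc each. Their inputs are thus indexed by different sigma types, which [swap]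
    matches. *)
Let dA (u : unit) (b : bool) : color := cin b.
Let dB (b : bool) (u : unit) : color := cin b.
Local Notation TA := (TL_tangle k D).
Local Notation SA := (fun u : unit => star_tangle k (ord0 : 'I_(minn m.*2 n.*2).+1)).
Local Notation TB := (star_tangle k i).
Definition factor_tangle (b : bool) : tangle (fun _ : unit => cin b) (cmid b) :=
  match b with true => TL_tangle k D2 | false => TL_tangle k D1 end.

Section Glued.
Variables (A : tangle (glue_color dA) cout) (B : tangle (glue_color dB) cout).
Hypothesis glA : @is_gluing unit (fun=> bool) (fun=> (false, M + k)) cout dA TA SA A.
Hypothesis glB : @is_gluing bool (fun=> unit) cmid cout dB TB factor_tangle B.

Definition discA (d : option bool) : option {u : unit & bool} :=
  omap (fun b => Tagged (fun _ : unit => bool) (i := tt) b) d.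
Definition discB (d : option bool) : option {b : bool & unit} :=
  omap (fun b => Tagged (fun _ : bool => unit) (i := b) tt) d.

Lemma linkA q q' : link q q' -> sat A (discA q.1) q.2 = sat A (discA q'.1) q'.2.
Proof.
have [fT [fS [gT [gS gm]]]] := glA.
(* The string through point [y] of the circle along which the juxtaposition is put into [D]; top
   point [x] of b is point [m.*2 + x] there. *)
pose Y y := omap fT (sat TA (Some tt) y).
have out x : sat A (discA None) x = omap fT (sat TA None x) by exact: glue_sat_out gm x.
pose inS s := fS (Tagged (fun u : unit => str (SA u)) (s : str (SA tt))).
have inn b x : sat A (discA (Some b)) x = omap inS (sat (SA tt) (Some b) x).
  exact: (glue_sat_in gm (i:=tt) b x).
have mid y : omap inS (sat (SA tt) None y) = Y y by exact: glue_sat_mid gm tt y.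
have a_top x : x < m.*2 -> sat A (discA (Some false)) x = Y x.
  by move=> xm; rewrite inn star_sat_top_left ?mid ?subn0.
have b_right x : x < n.*2 + k -> sat A (discA (Some true)) x = Y (m.*2 + x).
  by move=> xn; rewrite inn star_sat_right // mid; congr Y; exact: subn0.
have Ymate y : y < M.*2 -> TL_mate D y < M.*2 -> Y y = Y (TL_mate D y).
  by move=> yM sy; rewrite /Y TL_sat_in.
have Yout y t : y < M.*2 -> t < p.*2 -> TL_mate D y = (M.*2 + p.*2).-1 - t ->
    Y y = sat A (discA None) t.
  move=> yM tp sy; have yN : y < M.*2 + p.*2 by lia.
  have [_ _ ssy] := TL_mateP D yN.
  by rewrite /Y (_ : y = foot D t) ?(TL_sat_foot k eD tp) ?out // /foot -sy ssy.
have Yside x : x < k.*2 -> Y (M.*2 + x) = sat A (discA None) (p.*2 + x).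
  by move=> xk; rewrite /Y TL_sat_side // out.
case=> {q q'} [x xm sx|x xn sx|t tl|t ti|t it tn|x xk|x xk|x xk]; rewrite ![fst _]/= ![snd _]/=.
- rewrite !a_top // Ymate ?(splits_left SD) //; lia.
- rewrite !b_right; try lia.
  rewrite Ymate ?(splits_right SD) //; lia.
- have tm : t < m'.*2 by lia.
  have fl := foot_lt e1 tm; rewrite a_top //; apply: Yout; try lia.
  by rewrite (splits_top_left SD).
- have tm : m'.*2.-1 - t < m'.*2 by lia.
  have tn : t < n'.*2 by lia.
  have fl := foot_lt e1 tm; have fl2 := foot_lt e2 tn.
  rewrite a_top // b_right; last by lia.
  rewrite Ymate ?(splits_cross SD) //; lia.
- have fl := foot_lt e2 tn; rewrite b_right; last by lia.
  by apply: Yout; rewrite ?(splits_top_right SD) //; lia.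
- by rewrite !inn star_sat_middle.
- rewrite b_right; last by lia.
  by rewrite -Yside; [congr Y|]; lia.
rewrite (_ : p.*2 + k + x = p.*2 + (k + x)); last by lia.
rewrite inn star_sat_left // mid -Yside; last by lia.
congr Y; have -> : (ord0 : 'I_(minn m.*2 n.*2).+1).*2 = 0 by []; lia.
Qed.

Lemma linkB q q' : link q q' -> sat B (discB q.1) q.2 = sat B (discB q'.1) q'.2.
Proof.
have [fT [fS [gT [gS gm]]]] := glB.
(* The string through point [y] of the circle along which [D1] or [D2] is put into the product
   tangle. *)
pose Z b y := omap fT (sat TB (Some b) y).
have out x : sat B (discB None) x = omap fT (sat TB None x) by exact: glue_sat_out gm x.
pose inS b (s : str (factor_tangle b)) := fS (Tagged (fun b => str (factor_tangle b)) s).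
have inn b x : sat B (discB (Some b)) x = omap (@inS b) (sat (factor_tangle b) (Some tt) x).
  exact: (glue_sat_in gm (i:=b) tt x).
have mid b y : omap (@inS b) (sat (factor_tangle b) None y) = Z b y by exact: glue_sat_mid gm b y.
have a_foot t : t < m'.*2 -> sat B (discB (Some false)) (foot D1 t) = Z false t.
  by move=> tm; rewrite inn (TL_sat_foot k e1) // (mid false).
have b_foot t : t < n'.*2 -> sat B (discB (Some true)) (foot D2 t) = Z true t.
  by move=> tn; rewrite inn (TL_sat_foot k e2) // (mid true).
have a_side x : x < k.*2 -> sat B (discB (Some false)) (m.*2 + x) = Z false (m'.*2 + x).
  by move=> xk; rewrite inn (TL_sat_side e1) // (mid false).
have b_side x : x < k.*2 -> sat B (discB (Some true)) (n.*2 + x) = Z true (n'.*2 + x).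
  by move=> xk; rewrite inn (TL_sat_side e2) // (mid true).
case=> {q q'} [x xm sx|x xn sx|t tl|t ti|t it tn|x xk|x xk|x xk]; rewrite ![fst _]/= ![snd _]/=.
- by rewrite !inn (TL_sat_in k e1 xm sx).
- by rewrite !inn (TL_sat_in k e2 xn sx).
- by rewrite a_foot ?out ?/Z ?star_sat_top_left //; lia.
- by rewrite a_foot ?b_foot ?/Z ?star_sat_cross //; lia.
- by rewrite b_foot ?out ?/Z ?star_sat_right //; lia.
- rewrite a_side; last by lia.
  rewrite (_ : (n.*2 + k.*2).-1 - x = n.*2 + (k.*2.-1 - x)); last by lia.
  rewrite b_side /Z; last by lia.
  by rewrite star_sat_middle //; congr (omap _ (sat _ _ _)); lia.
- rewrite b_side /Z; last by lia.
  by rewrite star_sat_right ?out; [congr (omap _ (sat _ _ _))| |]; lia.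
rewrite -addnA a_side /Z; last by lia.
by rewrite addnA star_sat_left ?out //; congr (omap _ (sat _ _ _)); lia.
Qed.

Lemma cornersA : gat A (discA (Some false)) 0 = gat A (discA None) 0 /\
  gat A (discA (Some false)) m.*2 = gat A (discA (Some true)) 0.
Proof.
have [fT [fS [gT [gS gm]]]] := glA.
pose inR r := gS (Tagged (fun u : unit => reg (SA u)) (r : reg (SA tt))).
have inn b x : gat A (discA (Some b)) x = omap inR (gat (SA tt) (Some b) x).
  exact: (glue_gat_in gm (i:=tt) b x).
split; last by rewrite !inn star_gat_corner.
rewrite inn star_gat_first (glue_gat_out gm) -TL_gat_first; exact: glue_gat_mid gm tt 0.
Qed.

(** For the second coincidence, the region right of the tops of a passes the corner of [D1], then
    the common corner in the product tangle, then the first gap of [D2]. *)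
Lemma cornersB : gat B (discB (Some false)) 0 = gat B (discB None) 0 /\
  gat B (discB (Some false)) m.*2 = gat B (discB (Some true)) 0.
Proof.
have [fT [fS [gT [gS gm]]]] := glB.
pose inR b (r : reg (factor_tangle b)) := gS (Tagged (fun b => reg (factor_tangle b)) r).
have inn b x : gat B (discB (Some b)) x = omap (@inR b) (gat (factor_tangle b) (Some tt) x).
  exact: (glue_gat_in gm (i:=b) tt x).
have mid b y : omap (@inR b) (gat (factor_tangle b) None y) = omap gT (gat TB (Some b) y).
  exact: glue_gat_mid gm b y.
have first b : gat (factor_tangle b) (Some tt) 0 = gat (factor_tangle b) None 0.
  by case: b; exact: TL_gat_first.
have corner : gat (factor_tangle false) (Some tt) m.*2 = gat (factor_tangle false) None m'.*2.
  exact: TL_gat_corner.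
split; rewrite !inn.
  by rewrite first mid star_gat_first -(glue_gat_out gm).
by rewrite corner first !mid star_gat_corner.
Qed.

Lemma touchingA : touching A.
Proof.
have [fT [fS [gT [gS gm]]]] := glA.
apply: (gluing_touching gm) => [[]|[]|//|[]]; [exact: star0_nocap|exact: star0_first| |];
  exact: pairing_touching.
Qed.

Lemma touchingB : touching B.
Proof.
have [fT [fS [gT [gS gm]]]] := glB.
apply: (gluing_touching gm) => [[]|[]| |[]];
  [exact: TL_nocap|exact: TL_nocap|exact: TL_first|exact: TL_first| | |];
  exact: pairing_touching.
Qed.

Definition swap (x : {b : bool & unit}) : {u : unit & bool} :=
  Tagged (fun _ : unit => bool) (i := tt) (tag x).

Lemma swap_bij : bijective swap.
Proof.
exists (fun x : {u : unit & bool} => existT (fun _ : bool => unit) (tagged x) tt); first by case=> b [].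
by case=> [[] b].
Qed.

Lemma split_isotopic : @isotopic _ _ swap (glue_color dA) cout A B.
Proof.
pose pos (q : endpt (glue_color dB) cout) : option bool * nat :=
  (omap (fun x => tag x) (tag q), tagged q : nat).
have satB q : sat B (discB (pos q).1) (pos q).2 = Some (tend B q).
  by rewrite -satE; case: q => [[[b []]|] x].
have satA q : sat A (discA (pos q).1) (pos q).2 = Some (tend A (@emap _ _ swap (glue_color dA) cout q)).
  by rewrite -satE; case: q => [[[b []]|] x].
pose gpos (q : gap (glue_color dB) cout) : option bool * nat :=
  (omap (fun x => tag x) (tag q), tagged q : nat).
have gatB q : gat B (discB (gpos q).1) (gpos q).2 = Some (tgap B q).
  by rewrite -gatE; case: q => [[[b []]|] x].
have gatA q : gat A (discA (gpos q).1) (gpos q).2 = Some (tgap A (@gmap _ _ swap (glue_color dA) cout q)).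
  by rewrite -gatE; case: q => [[[b []]|] x].
(* Two coincidences suffice: they connect the three discs. *)
pose K (x y : gap (glue_color dB) cout) :=
  gpos x = (Some false, 0) /\ gpos y = (None, 0) \/
  gpos x = (Some false, m.*2) /\ gpos y = (Some true, 0).
apply: (@isotopic_links _ _ _ _ _ swap_bij A B (fun x y => link (pos x) (pos y)) K).
- exact: touchingA.
- exact: touchingB.
- move=> x; have xl : (pos x).2 < disc_size (pos x).1.
    by case: x => [[[[] []]|] x]; exact: ltn_ord x.
  have [[d y] l] := link_cover xl; rewrite -surjective_pairing in l.
  have yl : y < disc_size d by case: l => /link_ok[].
  case: d yl l => [[]|] yl l.
  + by exists (@mkend _ (glue_color dB) cout (discB (Some true)) (Ordinal yl)).
  + by exists (@mkend _ (glue_color dB) cout (discB (Some false)) (Ordinal yl)).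
  by exists (@mkend _ (glue_color dB) cout None (Ordinal yl)).
- by move=> x y /link_ok[_ _ ne] e; apply: ne; rewrite e.
- by move=> x y /linkA; rewrite !satA => /Some_inj.
- by move=> x y /linkB; rewrite !satB => /Some_inj.
- move=> F FK.
  pose ga := @mkgap _ (glue_color dB) cout (discB (Some false)).
  have e1' : F (discB (Some false)) = F None.
    by apply: (FK (ga ord0) (first_gap _ _ None)); left.
  have ml : m.*2 < (m + k).*2.+1 by lia.
  have e2' : F (discB (Some false)) = F (discB (Some true)).
    by apply: (FK (ga (Ordinal ml)) (first_gap _ _ (discB (Some true)))); right.
  suff FN d : F d = F None by move=> d d'; rewrite !FN.
  by case: d => [[[] []]|]; rewrite // -?e1' -?e2'.
- have [c1 c2] := cornersA; move=> x y [] [xE yE]; apply: Some_inj; rewrite -!gatA xE yE //.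
have [c1 c2] := cornersB; move=> x y [] [xE yE]; apply: Some_inj; rewrite -!gatB xE yE //.
Qed.

End Glued.

Lemma split_gluings : exists A B,
  [/\ @is_gluing unit (fun=> bool) (fun=> (false, M + k)) cout dA TA SA A,
      @is_gluing bool (fun=> unit) cmid cout dB TB factor_tangle B &
      @isotopic _ _ swap (glue_color dA) cout A B].
Proof.
have [|A gA] := @gluing_exists unit (fun=> bool) (fun=> (false, M + k)) cout dA TA SA.
  by case; exact: star0_nocap.
have [|B gB] := @gluing_exists bool (fun=> unit) cmid cout dB TB factor_tangle.
  by case; exact: TL_nocap.
by exists A, B; split=> //; exact: split_isotopic.
Qed.

Lemma star_TL_act (R : realType) (P : subfactor_planar_algebra R) (a : Pk P k m) (b : Pk P k n) :
  TL_act D (star_i (ord0 : 'I_(minn m.*2 n.*2).+1) a b) = star_i i (TL_act D1 a) (TL_act D2 b).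
Proof.
have [A [B [gA gB iso]]] := split_gluings.
pose x (q : {u : unit & bool}) : P (glue_color dA q) := @two_inputs (fun c => P c) _ _ a b (tagged q).
have eA := act_gluing gA x; have eB := act_gluing gB (fun q => x (swap q)).
rewrite /TL_act /star_i -[LHS]eA -(act_isotopic swap_bij iso x) eB.
congr act; apply: functional_extensionality_dep => -[] //.
Qed.

End Split.

(** * Summation *)

Section Sums.
Variable V : nmodType.
Local Open Scope ring_scope.

(** The bijection is given as a relation because cutting and joining are known only as existence
    statements. Both sums equal the sum over related pairs, in which every row and every column has
    exactly one entry. *)
Lemma sum_correspondence (A B : finType) (P : pred A) (Q : pred B) (S : A -> B -> Prop)
    (F : A -> V) (G : B -> V) :
  (forall a, P a -> exists b, Q b /\ S a b) ->
  (forall b, Q b -> exists a, P a /\ S a b) ->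
  (forall a b b', P a -> Q b -> Q b' -> S a b -> S a b' -> b = b') ->
  (forall a a' b, P a -> P a' -> Q b -> S a b -> S a' b -> a = a') ->
  (forall a b, P a -> Q b -> S a b -> F a = G b) ->
  \sum_(a | P a) F a = \sum_(b | Q b) G b.
Proof.
move=> ex ex' un un' FG.
transitivity (\sum_(a | P a) \sum_(b | Q b && `[< S a b >]) F a).
  apply: eq_bigr => a Pa; have [b [Qb Sab]] := ex a Pa.
  rewrite (bigD1 b) ?Qb /=; last exact/asboolP.
  rewrite big1 ?addr0 // => b' /andP[/andP[Qb' /asboolP Sab']].
  by rewrite (un a b' b) ?eqxx.
rewrite (exchange_big_dep Q) /=; last by move=> a b _ /andP[].
apply: eq_bigr => b Qb; have [a [Pa Sab]] := ex' b Qb.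
rewrite (bigD1 a) ?Pa ?Qb /=; last exact/asboolP.
rewrite big1 ?addr0; first exact: FG.
move=> a' /andP[/andP[Pa' /asboolP Sab']].
by rewrite (un' a' a b) ?eqxx.
Qed.

Lemma fsum_nat (F : nat -> V) B : (forall n, (B <= n)%N -> F n = 0) ->
  \sum_(n \in [set: nat]) F n = \sum_(n < B) F n.
Proof.
move=> F0; rewrite fsbig_ord; apply/esym/fsbig_widen => // n [_ /= /negP].
by rewrite -leqNgt; exact: F0.
Qed.

Lemma fsum_nat_pair (F : nat * nat -> V) B C :
  (forall m n, (B <= m)%N || (C <= n)%N -> F (m, n) = 0) ->
  \sum_(mn \in [set: nat * nat]) F mn = \sum_(m < B) \sum_(n < C) F (m : nat, n : nat).
Proof.
move=> F0; rewrite (@fsbig_ord _ _ _ B (fun m => \sum_(n < C) F (m, n : nat))).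
rewrite (eq_fsbigr (fun m => \sum_(n \in `I_C) F (m, n))); last first.
  by move=> m _; rewrite (@fsbig_ord _ _ _ C (fun n => F (m, n))).
rewrite (@pair_fsbig _ _ _ _ _ _ _ (fun m n => F (m, n))) //=.
transitivity (\sum_(mn \in (`I_B `*` `I_C)%classic) F mn); last by apply: eq_fsbigr => -[].
apply/esym/fsbig_widen => // -[m n] [_ /= H]; apply: F0; apply: contra_notT H.
by rewrite negb_or -!ltnNge => /andP.
Qed.

End Sums.

Lemma dsum_eq (V : nat -> zmodType) (x y : dsum V) : (forall n, x n = y n) -> x = y.
Proof.
case: x => x hx; case: y => y hy /= xy; have e : x = y.
  exact: functional_extensionality_dep.
by case: _ / e hy => hy; congr DSum; exact: Prop_irrelevance.
Qed.

Section Linearity.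
Variables (R : realType) (P : subfactor_planar_algebra R) (k : nat).
Local Notation Pk := (Pk P k).
Local Open Scope ring_scope.

Lemma actD (I : finType) (c : I -> color) c0 (T : tangle c c0) (i : I)
    (x y z : forall i, P (c i)) :
  z i = x i + y i -> (forall j, j != i -> z j = x j /\ z j = y j) ->
  act P T z = act P T x + act P T y.
Proof.
by move=> zi zj; rewrite (@act_linear _ P I c c0 T i 1 x y z) ?scale1r.
Qed.

Lemma TL_actD i j (D : TL i j) (x y : Pk i) : TL_act D (x + y) = TL_act D x + TL_act D y.
Proof. by apply: (@actD _ _ _ _ tt) => // -[]. Qed.

Lemma TL_act0 i j (D : TL i j) : TL_act D (0 : Pk i) = 0.
Proof. exact: (@act0 R P _ _ _ _ tt). Qed.

Lemma X_blockD i j (x y : Pk i) : X_block j (x + y) = X_block j x + X_block j y.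
Proof. by rewrite /X_block -big_split; apply: eq_bigr => D _; rewrite TL_actD. Qed.

Lemma X_block0 i j : X_block j (0 : Pk i) = 0.
Proof. by apply: big1 => D _; rewrite TL_act0. Qed.

Lemma X_block_gt i j (x : Pk i) : (i < j)%N -> X_block j x = 0.
Proof. by move=> ij; apply: big1 => D /epi_leq; rewrite leqNgt ij. Qed.

Lemma X_block_sum i j (I : Type) (r : seq I) (Q : pred I) (F : I -> Pk i) :
  X_block j (\sum_(a <- r | Q a) F a) = \sum_(a <- r | Q a) X_block j (F a).
Proof. exact: (big_morph _ (@X_blockD i j) (@X_block0 i j)). Qed.

Lemma star_iDl m n (i : 'I_(minn m.*2 n.*2).+1) (x y : Pk m) (b : Pk n) :
  star_i i (x + y) b = star_i i x b + star_i i y b.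
Proof. by apply: (@actD _ _ _ _ false) => // -[]. Qed.

Lemma star_iDr m n (i : 'I_(minn m.*2 n.*2).+1) (a : Pk m) (x y : Pk n) :
  star_i i a (x + y) = star_i i a x + star_i i a y.
Proof. by apply: (@actD _ _ _ _ true) => // -[]. Qed.

Lemma star_i_sum m n (i : 'I_(minn m.*2 n.*2).+1) (I J : Type) (r : seq I) (s : seq J)
    (A : pred I) (B : pred J) (F : I -> Pk m) (G : J -> Pk n) :
  star_i i (\sum_(a <- r | A a) F a) (\sum_(b <- s | B b) G b) =
  \sum_(a <- r | A a) \sum_(b <- s | B b) star_i i (F a) (G b).
Proof.
rewrite (big_morph (fun x => star_i i x _) (fun x y => star_iDl i x y _) (id1 := 0)); last first.
  by apply: star_i0; left.
apply: eq_bigr => a _; apply: (big_morph _ (star_iDr i _) (id1 := 0)).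
by apply: star_i0; right.
Qed.

Lemma homogD d p (x y : Pk d) : homog (x + y) p = homog x p + homog y p.
Proof.
by rewrite /homog; case: eqP => [e|_]; [case: _ / e | rewrite addr0].
Qed.

Lemma homog_sum d p (I : Type) (r : seq I) (Q : pred I) (F : I -> Pk d) :
  homog (\sum_(a <- r | Q a) F a) p = \sum_(a <- r | Q a) homog (F a) p.
Proof. exact: (big_morph (fun x => homog x p) (@homogD d p) (homog0 P k d p)). Qed.

Lemma homog_id d (x : Pk d) : homog x d = x.
Proof. by rewrite /homog; case: eqP => // e; rewrite (eq_axiomK e). Qed.

Lemma X_block_homog B d p (x : Pk d) : (d < B)%N ->
  \sum_(e < B) X_block p (homog x e) = X_block p x.
Proof.
move=> dB; rewrite (bigD1 (Ordinal dB)) //= homog_id big1 ?addr0 // => e ne.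
by rewrite homog_neq ?X_block0 // eq_sym; apply: contra ne => /eqP e'; apply/eqP/val_inj.
Qed.

End Linearity.

(** * The identity for homogeneous elements *)

Section Homogeneous.
Variables (R : realType) (P : subfactor_planar_algebra R) (k : nat).
Variables (B C m n p : nat) (a : Pk P k m) (b : Pk P k n).
Hypotheses (mB : m < B) (nC : n < C).
Local Open Scope ring_scope.

(** All triples of an [i] and two diagrams, of any degrees, in one finite type. Epi diagrams do not
    raise the degree, so the bounds [B] and [C] lose none of them. *)
Local Notation datum := {q : 'I_B * 'I_C &
  ('I_(minn q.1.*2 q.2.*2).+1 * (TL m q.1 * TL n q.2))%type}.

Let good (t : datum) : bool :=
  [&& epi (tagged t).2.1, epi (tagged t).2.2 &
   ((tag t).1 + (tag t).2 - (tagged t).1 == p)%N].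

Let value (t : datum) : Pk P k p :=
  homog (star_i (tagged t).1 (TL_act (tagged t).2.1 a) (TL_act (tagged t).2.2 b)) p.

Let bounds m' n' (i : 'I_(minn m'.*2 n'.*2).+1) : (m' + n' - i = p)%N ->
  [/\ (i <= m'.*2)%N, (i <= n'.*2)%N & (p + i = m' + n')%N].
Proof. by have := ltn_ord i => il pE; split; lia. Qed.

Lemma X_star_data :
  X_block p (star_i (ord0 : 'I_(minn m.*2 n.*2).+1) a b) = \sum_(t : datum | good t) value t.
Proof.
have ME : (m + n - (ord0 : 'I_(minn m.*2 n.*2).+1) = m + n)%N by exact: subn0.
apply: (@sum_correspondence _ _ _ _ _ (fun D (t : datum) =>
  splits (tagged t).1 D (tagged t).2.1 (tagged t).2.2)).
- move=> D eD; have [m' [n' [i [D1 [D2 [[e1 e2] im ik pi S]]]]]] := factors_exist ME eD.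
  have m'B : (m' < B)%N by exact: leq_ltn_trans (epi_leq e1) mB.
  have n'C : (n' < C)%N by exact: leq_ltn_trans (epi_leq e2) nC.
  have il : (i < (minn m'.*2 n'.*2).+1)%N by lia.
  exists (existT (fun q : 'I_B * 'I_C =>
    ('I_(minn q.1.*2 q.2.*2).+1 * (TL m q.1 * TL n q.2))%type)
    (Ordinal m'B, Ordinal n'C) (Ordinal il, (D1, D2))); split=> //.
  by rewrite /good /= e1 e2; apply/eqP; lia.
- case=> [[m' n'] [i [D1 D2]]] /and3P[/= e1 e2 /eqP/bounds[im ik pi]].
  by have [D eD S] := splits_exists ME e1 e2 im ik pi; exists D.
- move=> D [[m' n'] [i [D1 D2]]] [[m'' n''] [i' [E1 E2]]] eD.
  move=> /and3P[/= d1 d2 /eqP/bounds[im ik pi]] /and3P[/= e1 e2 /eqP/bounds[im' ik' pi']] S S'.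
  have [T1 T2 ii'] := splits_factors_unique ME eD d1 d2 im ik pi e1 e2 im' ik' pi' S S'.
  have mm : m' = m'' by apply: ord_inj; have := congr1 (fun z => tag z) T1.
  have nn : n' = n'' by apply: ord_inj; have := congr1 (fun z => tag z) T2.
  clear bounds S S' im ik pi im' ik' pi'; subst m'' n''.
  have {}ii' : i = i' by apply: val_inj.
  move: T1 => /eqP; rewrite -tag_eqE /tag_eq /= eqxx /= tagged_asE => /eqP ->.
  move: T2 => /eqP; rewrite -tag_eqE /tag_eq /= eqxx /= tagged_asE => /eqP ->.
  by rewrite ii'.
- move=> D D' [[m' n'] [i [D1 D2]]] eD eD' /and3P[/= e1 e2 /eqP/bounds[im ik pi]] S S'.
  exact: (splits_unique ME e1 e2 im ik pi eD eD' S S').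
move=> D [[m' n'] [i [D1 D2]]] eD /and3P[/= e1 e2 /eqP pE] S.
(* Substituting the degree of the product for [p] turns [homog] into the identity. *)
rewrite /value /=; case: _ / pE D eD S => D eD S.
by rewrite homog_id; exact: star_TL_act.
Qed.

Lemma X_star_homogeneous :
  X_block p (star_i (ord0 : 'I_(minn m.*2 n.*2).+1) a b) =
  \sum_(m' < B) \sum_(n' < C) \sum_(i < (minn m'.*2 n'.*2).+1)
    homog (star_i i (X_block m' a) (X_block n' b)) p.
Proof.
rewrite X_star_data pair_big /=.
transitivity (\sum_(t : datum | epi (tagged t).2.1 && epi (tagged t).2.2) value t).
  (* Data whose product has degree other than [p] contribute zero through [homog]. *)
  rewrite [RHS](bigID (fun t : datum => (tag t).1 + (tag t).2 - (tagged t).1 == p)%N) /=.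
  rewrite [X in _ = _ + X]big1 ?addr0; last by move=> t /andP[_ ne]; apply: homog_neq.
  by apply: eq_bigl => t; rewrite /good andbA.
rewrite -(@sig_big_dep _ _ _ _ _ xpredT
   (fun (q : 'I_B * 'I_C) (t : 'I_(minn q.1.*2 q.2.*2).+1 * (TL m q.1 * TL n q.2)) => epi t.2.1 && epi t.2.2)
   (fun (q : 'I_B * 'I_C) (t : 'I_(minn q.1.*2 q.2.*2).+1 * (TL m q.1 * TL n q.2)) =>
     homog (star_i t.1 (TL_act t.2.1 a) (TL_act t.2.2 b)) p)) /=.
apply: eq_bigr => -[m' n'] _ /=.
rewrite -(@pair_big_dep _ _ _ _ _ xpredT (fun i (t : TL m m' * TL n n') => epi t.1 && epi t.2)
  (fun i (t : TL m m' * TL n n') => homog (star_i i (TL_act t.1 a) (TL_act t.2 b)) p)) /=.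
apply: eq_bigr => i _.
rewrite -(@pair_big_dep _ _ _ _ _ (@epi m m') (fun=> @epi n n')
  (fun D1 D2 => homog (star_i i (TL_act D1 a) (TL_act D2 b)) p)) /=.
rewrite /X_block star_i_sum homog_sum; apply: eq_bigr => D1 _.
by rewrite homog_sum.
Qed.

End Homogeneous.

Theorem lemma5p2 (R : realType) (P : subfactor_planar_algebra R) (k : nat)
    (a b : Gr P k) :
  X_map (bullet a b) = star (X_map a) (X_map b).
Proof.
apply: dsum_eq => p /=.
have [[B aB] [C bC]] := (comp_finite a, comp_finite b).
(* [X] never raises the degree, so the bounds for a and b also bound [X a] and [X b]. *)
have X0 (x : Gr P k) N : (forall n, N <= n -> x n = 0%R) -> forall n, N <= n -> X_comp x n = 0%R.
  move=> xN n Nn; apply: fsbig1 => i _; have [Ni|iN] := leqP N i.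
    by rewrite xN // X_block0.
  by rewrite X_block_gt //; exact: leq_trans Nn.
have XE (x : Gr P k) N : (forall n, N <= n -> x n = 0%R) ->
    forall n, X_comp x n = (\sum_(i < N) X_block n (x i))%R.
  by move=> xN n; rewrite /X_comp (@fsum_nat _ _ N) // => i Ni; rewrite xN // X_block0.
have bE d : bullet_comp a b d = (\sum_(m < B) \sum_(n < C)
    homog (star_i (ord0 : 'I_(minn m.*2 n.*2).+1) (a m) (b n)) d)%R.
  rewrite /bullet_comp (@fsum_nat_pair _ _ B C) // => m n mn /=.
  by rewrite star_i0 ?homog0 //; case/orP: mn => ?; [left; apply: aB | right; apply: bC].
(* Degrees below [B] and [C] add up to a degree below [B + C]. *)
rewrite (XE (bullet a b) (B + C)); last first.
  move=> d dBC /=; rewrite bE big1 // => m _; rewrite big1 // => n _.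
  apply: homog_neq; have := ltn_ord m; have := ltn_ord n => nC mB.
  by rewrite subn0; lia.
rewrite (eq_bigr (fun d : 'I_(B + C) => \sum_(m < B) \sum_(n < C) X_block p
    (homog (star_i (ord0 : 'I_(minn m.*2 n.*2).+1) (a m) (b n)) d))%R); last first.
  move=> d _ /=; rewrite bE X_block_sum; apply: eq_bigr => m _; exact: X_block_sum.
rewrite exchange_big /= /star_comp (@fsum_nat_pair _ _ B C); last first.
  move=> m n mn /=; rewrite big1 // => i _; rewrite star_i0 ?homog0 //.
  by case/orP: mn => ?; [left; apply: (X0 a B) | right; apply: (X0 b C)].
rewrite (eq_bigr (fun m : 'I_B => \sum_(n < C) \sum_(m' < B) \sum_(n' < C)
    \sum_(i < (minn m'.*2 n'.*2).+1) homog (star_i i (X_block m' (a m)) (X_block n' (b n))) p)%R);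
  last first.
  move=> m _; rewrite exchange_big; apply: eq_bigr => n _ /=.
  rewrite X_block_homog.
    exact: (X_star_homogeneous p (a m) (b n) (ltn_ord m) (ltn_ord n)).
  by have := ltn_ord m; have := ltn_ord n; rewrite subn0; lia.
(* The degrees after applying [X] become the outer indices, as in the definition of [star]; the
   inner sums then assemble to the components of [X a] and [X b]. *)
transitivity (\sum_(m' < B) \sum_(n' < C) \sum_(m < B) \sum_(n < C)
    \sum_(i < (minn m'.*2 n'.*2).+1) homog (star_i i (X_block m' (a m)) (X_block n' (b n))) p)%R.
  under eq_bigr do rewrite exchange_big.
  rewrite exchange_big; apply: eq_bigr => m' _.
  under eq_bigr do rewrite exchange_big.
  exact: exchange_big.
apply: eq_bigr => m' _; apply: eq_bigr => n' _ /=; rewrite (XE a B aB) (XE b C bC).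
under [RHS]eq_bigr do rewrite star_i_sum homog_sum.
rewrite [RHS]exchange_big; apply: eq_bigr => m _ /=.
under [RHS]eq_bigr do rewrite homog_sum.
exact: exchange_big.
Qed.
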